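(* Let $\mathfrak{g}$ be a finite-dimensional real Lie algebra with a nil-invariant symmetric bilinear form $\langle\cdot,\cdot\rangle$, and let $\mathfrak{g}=(\mathfrak{k}\times\mathfrak{s})\ltimes\mathfrak{r}$ be a Levi decomposition, where $\mathfrak{r}$ is the solvable radical, $\mathfrak{k}$ is semisimple of compact type and $\mathfrak{s}$ is semisimple without factors of compact type; put $\mathfrak{g}_{\rm s}=\mathfrak{s}\ltimes\mathfrak{r}$. Assume that the metric radical $\mathfrak{g}^\perp$ does not contain any non-trivial ideal of $\mathfrak{g}$. Let $\mathfrak{z}(\mathfrak{g}_{\rm s})$ denote the center of $\mathfrak{g}_{\rm s}$. Then $$\mathfrak{g}^\perp\subseteq\mathfrak{k}\ltimes\mathfrak{z}(\mathfrak{g}_{\rm s})\quad\text{and}\quad[\mathfrak{g}^\perp,\mathfrak{g}_{\rm s}]\subseteq\mathfrak{z}(\mathfrak{g}_{\rm s})\cap\mathfrak{g}^\perp.$$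
   Context: Nil-invariance: let $\overline{\mathrm{Inn}(\mathfrak{g})}^{\rm z}$ be the Zariski closure of the adjoint group $\mathrm{Inn}(\mathfrak{g})$ in $\mathrm{Aut}(\mathfrak{g})$. A symmetric bilinear form $\langle\cdot,\cdot\rangle$ on $\mathfrak{g}$ (possibly degenerate) is nil-invariant if $\langle\varphi X_1,X_2\rangle=-\langle X_1,\varphi X_2\rangle$ for all $X_1,X_2\in\mathfrak{g}$ and all nilpotent elements $\varphi$ of the Lie algebra of $\overline{\mathrm{Inn}(\mathfrak{g})}^{\rm z}$. The metric radical is the kernel $\mathfrak{g}^\perp=\{X\in\mathfrak{g}\mid\langle X,Y\rangle=0\text{ for all }Y\in\mathfrak{g}\}$, a linear subspace. A semisimple Lie algebra is of compact type if its Killing form is definite. ''Non-trivial ideal'' means non-zero ideal. *)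

(* Defs.v *)
From HB Require Import structures.
From mathcomp Require Import all_boot all_order all_algebra.
From mathcomp Require Import all_classical all_reals all_analysis.
From mathcomp Require mpoly.

Set Implicit Arguments.
Unset Strict Implicit.
Unset Printing Implicit Defensive.

Import Order.TTheory GRing.Theory Num.Theory.
Import numFieldNormedType.Exports.

Local Open Scope classical_set_scope.
Local Open Scope ring_scope.

HB.mixin Record Vector_isLieAlgebra (F : fieldType) (V : Type)
    of Vector F V := {
  lie : V -> V -> V;
  lie_linearl : forall y, linear (lie^~ y);
  lie_linearr : forall x, linear (lie x);
  liexx : forall x, lie x x = 0;
  lie_jacobi : forall x y z,
    lie x (lie y z) + lie y (lie z x) + lie z (lie x y) = 0
}.

#[short(type="lieAlgType")]
HB.structure Definition LieAlgebra (F : fieldType) :=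
  { V of Vector F V & Vector_isLieAlgebra F V }.

HB.instance Definition _ (F : fieldType) (g : lieAlgType F) :=
  bilinear_isBilinear.Build F g g g *:%R *:%R (@lie F g)
    (@lie_linearl F g, @lie_linearr F g).

HB.instance Definition _ (F : fieldType) (g : lieAlgType F) (x : g) :=
  GRing.isLinear.Build F g g *:%R (lie x) (lie_linearr x).

Section LieAlgebra.
Variables (F : fieldType) (g : lieAlgType F).
Implicit Types (U V h I J : {vspace g}) (x y : g).

Definition ad x : 'End(g) := linfun (lie x).

(* The linear span of all brackets [u, v] with u in U and v in V; by
   bilinearity the brackets of basis vectors suffice. *)
Definition lie_prod U V : {vspace g} :=
  <<[seq lie u v | u <- vbasis U, v <- vbasis V]>>%VS.

Definition lie_subalgebra h : bool := (lie_prod h h <= h)%VS.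

Definition lie_ideal I h : bool := (I <= h)%VS && (lie_prod h I <= I)%VS.

Definition lie_derived (n : nat) h : {vspace g} :=
  iter n (fun U => lie_prod U U) h.

Definition lie_solvable h : Prop := exists n, lie_derived n h = 0%VS.

Definition solvable_radical r : Prop :=
  [/\ lie_ideal r fullv, lie_solvable r
    & forall I, lie_ideal I fullv -> lie_solvable I -> (I <= r)%VS].

Definition lie_semisimple h : Prop :=
  lie_subalgebra h /\
  forall I, lie_ideal I h -> lie_solvable I -> I = 0%VS.

Definition lie_center h : {vspace g} :=
  (h :&: \bigcap_(i < \dim h) lker (ad (vbasis h)`_i))%VS.

(* The Killing form of the subalgebra h itself, i.e. the trace of the
   restriction of ad x \o ad y to h; meaningful when h is a subalgebra. *)
Definition killing h x y : F :=
  \sum_(i < \dim h) coord (vbasis h) i (lie x (lie y (vbasis h)`_i)).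

(* I is a factor of h: h is the direct product of I and another ideal. *)
Definition lie_factor I h : Prop :=
  exists J, [/\ lie_ideal I h, lie_ideal J h,
                (I + J)%VS = h & (I :&: J)%VS = 0%VS].

Definition lie_automorphism (f : 'End(g)) : Prop :=
  lker f = 0%VS /\ forall x y, f (lie x y) = lie (f x) (f y).

End LieAlgebra.

Section RealLieAlgebra.
Variables (R : realType) (g : lieAlgType R).
Implicit Types (h I k s r : {vspace g}).

Definition definite_on h (b : g -> g -> R) : Prop :=
  {in h, forall x, x != 0 -> 0 < b x x} \/
  {in h, forall x, x != 0 -> b x x < 0}.

Definition compact_type h : Prop :=
  lie_semisimple h /\ definite_on h (killing h).

Definition no_compact_factor h : Prop :=
  forall I, lie_factor I h -> compact_type I -> I = 0%VS.

(* g = (k x s) |x r; the radical r is an ideal by solvable_radical. *)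
Definition levi_decomposition k s r : Prop :=
  [/\ solvable_radical r,
      compact_type k,
      lie_semisimple s /\ no_compact_factor s,
      lie_prod k s = 0%VS
    & (k + s + r)%VS = fullv /\ directv (k + s + r)].

Definition endo_mx (f : 'End(g)) : 'M[R]_(\dim {:g}) :=
  passmx.mxof (vbasis {:g}) (vbasis {:g}) f.

Definition expmx n (A : 'M[R]_n) : 'M[R]_n :=
  \matrix_(i, j) limn (series (fun m : nat => (A ^+ m) i j / m`!%:R)).

Definition endo_exp (f : 'End(g)) : 'End(g) :=
  passmx.hommx (vbasis {:g}) (vbasis {:g}) (expmx (endo_mx f)).

(* The adjoint group: the subgroup of Aut(g) generated by the exp(ad x). *)
Inductive Inn : set 'End(g) :=
| Inn_exp x : Inn (endo_exp (ad x))
| Inn_id : Inn \1%VF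
| Inn_comp f1 f2 : Inn f1 -> Inn f2 -> Inn (f1 \o f2)%VF
| Inn_inv f : Inn f -> Inn (f^-1)%VF.

Definition poly_eval
    (p : mpoly.mpoly (\dim {:g} * \dim {:g}) R) (f : 'End(g)) : R :=
  mpoly.meval (mxvec (endo_mx f) 0) p.

(* Closure of S in the Zariski topology of Aut(g). The regular functions on
   GL(g) are the quotients of polynomials in the matrix entries by powers of
   the determinant, so polynomials define the same closed sets. *)
Definition zariski_closure_Aut (S : set 'End(g)) : set 'End(g) :=
  [set f | lie_automorphism f /\
    forall p, (forall u, S u -> poly_eval p u = 0) -> poly_eval p f = 0].

(* The Lie algebra of a closed subgroup G of GL(g). *)
Definition lie_algebra_of (G : set 'End(g)) : set 'End(g) :=
  [set f | forall t : R, G (endo_exp (t *: f))].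

Definition nilpotent_endo (f : 'End(g)) : Prop :=
  exists n, forall x, iter n f x = 0.

Definition nil_invariant (b : {symmetric g}) : Prop :=
  forall f, lie_algebra_of (zariski_closure_Aut Inn) f -> nilpotent_endo f ->
  forall x1 x2, b (f x1) x2 = - b x1 (f x2).

Definition metric_radical (b : {symmetric g}) : {vspace g} :=
  orthov b fullv.

End RealLieAlgebra.

(* Main.v *)
From HB Require Import structures.
Require Import Defs.
From mathcomp Require Import all_boot all_order all_algebra.
From mathcomp Require Import all_classical all_reals all_analysis.
From mathcomp Require Import spectral complex ring.
From mathcomp Require mpoly.
Import -(notations) mpoly.

Set Implicit Arguments.
Unset Strict Implicit.
Unset Printing Implicit Defensive.

Import Order.TTheory GRing.Theory Num.Theory.
Import numFieldNormedType.Exports.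

Local Open Scope ring_scope.
Local Open Scope complex_scope.

(* If [p] vanishes on [Inn g], differentiating [p (exp (s ad x))] shows that [p]
   also vanishes on the one-parameter group of the nilpotent Jordan part of
   [ad x]; hence that part is skew for the form. The noncompact semisimple
   factor [s] is generated by its ad-nilpotent elements, because the Killing
   complement of the subalgebra they generate is a compact factor; so [ad y] is
   skew for [y] in [s]. For [y] in [r] every [ad [y, z]] is nilpotent, hence
   skew, and the Fitting decomposition of [ad y] reduces skewness of [ad y] to
   that of its nilpotent part. Thus [ad y] is skew for all [y] in [g_s = s + r].

   Consequently the bracket of [g_s] with the radical of the form restricted to
   [g_s] is an ideal of [g] inside the metric radical, hence zero: that radical
   is central in [g_s], which gives the second inclusion. For the first, write
   [x = a + c + d] along [k + s + r] with [x] in the metric radical. Modulo the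
   center, [x] acts trivially on [g_s]; this forces [c = 0] and puts [a] in an
   ideal [k1] of [k] which acts on [g_s] modulo its center through [r], hence
   trivially, [k1] being perfect. Complete reducibility for [k1] then splits
   [g_s] into [k1]-invariants and a central part, and the elements behaving like
   [d] span a [k]-module whose bracket with [g_s] is again an ideal in the metric
   radical, so [d] is central. *)

(** * Polynomials in an endomorphism and complexification *)

(** The ground field is real while eigenvalues are complex, so every Jordan-type component is built
    as a real polynomial in the endomorphism itself. One construction serves three purposes: given
    an additive map [phi] of the complex numbers that commutes with conjugation, a polynomial taking
    the value [phi l] at each eigenvalue [l] of a derivation, to high enough order, yields a
    derivation again. Conjugation gives Cartan's criterion, through a trace equal to the sum of
    |l|^2; the real part gives the hyperbolic component; the identity gives the semisimple one. The
    Zariski closure enters only through its vanishing polynomials. Right multiplication by the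
    matrix of [ad x] induces a derivation of the coordinate ring whose Jordan decomposition comes
    from that of [ad x]; the ring being infinite-dimensional, the decomposition is handled vector by
    vector. In the last step the component [d] need not lie in the metric radical, so [noideal]
    cannot be applied to it directly; what is known is that its pairing with brackets of
    [k1]-invariants vanishes. *)

Section PolyApp.
Variables (K : fieldType) (V : lmodType K) (f : {linear V -> V}).
Implicit Types (p q : {poly K}) (v : V).

(** Stated for arbitrary modules, since it is also applied to complexifications and to a polynomial
    ring, which is infinite-dimensional. *)
Definition papp q v : V := \sum_(i < size q) q`_i *: iter i f v.

Lemma iter_linear i : linear (iter i f).
Proof. by elim: i => [|i IH] a u v //=; rewrite IH linearP. Qed.

Lemma papp_linear q : linear (papp q).
Proof.
move=> a u v; rewrite /papp scaler_sumr -big_split; apply: eq_bigr => i _.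
by rewrite iter_linear scalerDr scalerA mulrC -scalerA.
Qed.
HB.instance Definition _ q := GRing.isLinear.Build K V V _ (papp q) (papp_linear q).

Lemma papp_widen n q v : (size q <= n)%N ->
  papp q v = \sum_(i < n) q`_i *: iter i f v.
Proof.
move=> le_qn; rewrite /papp (big_ord_widen n (fun i => q`_i *: iter i f v)) //.
rewrite big_mkcond; apply: eq_bigr => i _.
by case: ltnP => // /(nth_default 0) ->; rewrite scale0r.
Qed.

Lemma pappD p q v : papp (p + q) v = papp p v + papp q v.
Proof.
pose n := maxn (size p) (size q).
rewrite !(@papp_widen n) ?leq_maxl ?leq_maxr ?size_polyD // -big_split.
by apply: eq_bigr => i _; rewrite coefD scalerDl.
Qed.

Lemma pappZ a q v : papp (a *: q) v = a *: papp q v.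
Proof.
rewrite (@papp_widen (size q) (a *: q)) ?size_scale_leq // (@papp_widen (size q) q) // scaler_sumr.
by apply: eq_bigr => i _; rewrite coefZ scalerA.
Qed.

Lemma pappN q v : papp (- q) v = - papp q v.
Proof. by rewrite -(scaleN1r q) pappZ scaleN1r. Qed.

Lemma pappB p q v : papp (p - q) v = papp p v - papp q v.
Proof. by rewrite pappD pappN. Qed.

Lemma papp0 v : papp 0 v = 0.
Proof. by rewrite /papp size_poly0 big_ord0. Qed.

Lemma pappC c v : papp c%:P v = c *: v.
Proof.
by rewrite (@papp_widen 1) ?size_polyC ?leq_b1 // big_ord1 coefC.
Qed.

Lemma papp1 v : papp 1 v = v.
Proof. by rewrite -[1]/(1%:P) pappC scale1r. Qed.

Lemma pappMX p v : papp (p * 'X) v = papp p (f v).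
Proof.
rewrite (@papp_widen (size p).+1) ?(leq_trans (size_polyMleq _ _)) ?size_polyX //; last first.
  by rewrite addn2.
rewrite big_ord_recl coefMX eqxx scale0r add0r; apply: eq_bigr => i _.
by rewrite coefMX /= /bump /= -iterS iterSr.
Qed.

Lemma pappM p q v : papp (p * q) v = papp p (papp q v).
Proof.
elim/poly_ind: q v => [|q c IH] v; first by rewrite mulr0 !papp0 linear0.
rewrite mulrDr mulrA !pappD pappMX IH pappMX linearD mulrC mul_polyC pappZ.
by rewrite pappC linearZ.
Qed.

Lemma pappX v : papp 'X v = f v.
Proof. by rewrite -['X]mul1r pappMX papp1. Qed.

Lemma pappXn n v : papp 'X^n v = iter n f v.
Proof.
elim: n v => [|n IH] v; first by rewrite expr0 papp1.
by rewrite exprSr pappMX IH -iterSr.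
Qed.

Lemma papp_comm p q v : papp p (papp q v) = papp q (papp p v).
Proof. by rewrite -!pappM mulrC. Qed.

Lemma papp_sum (I : Type) (s : seq I) (P : pred I) (F : I -> {poly K}) v :
  papp (\sum_(i <- s | P i) F i) v = \sum_(i <- s | P i) papp (F i) v.
Proof.
elim/big_rec2: _ => [|i x y _ <-]; first exact: papp0.
by rewrite pappD.
Qed.

Lemma papp_dvd p q v : p %| q -> papp p v = 0 -> papp q v = 0.
Proof. by move=> /dvdpP[r ->] pv0; rewrite pappM pv0 linear0. Qed.

Lemma papp_eqC P q c v : P %| q - c%:P -> papp P v = 0 -> papp q v = c *: v.
Proof.
move=> dvP Pv0; apply/eqP; rewrite -subr_eq0 -pappC -pappB.
by rewrite (papp_dvd dvP Pv0).
Qed.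

Lemma papp_eigen q c v : f v = c *: v -> papp q v = q.[c] *: v.
Proof.
move=> fv; apply: (@papp_eqC ('X - c%:P)).
  by rewrite dvdp_XsubCl /root hornerD hornerN hornerC subrr.
by rewrite pappB pappX pappC fv subrr.
Qed.

Lemma papp_closed (S : V -> Prop) q v :
  (forall u w, S u -> S w -> S (u + w)) -> (forall a u, S u -> S (a *: u)) ->
  (forall u, S u -> S (f u)) -> S v -> S (papp q v).
Proof.
move=> SD SZ Sf Sv; have Si i : S (iter i f v) by elim: i => //= i; apply: Sf.
rewrite /papp; elim/big_ind: _ => [|x y|i _]; last exact/SZ/Si.
  by rewrite -(scale0r v); apply: SZ.
exact: SD.
Qed.
End PolyApp.

Lemma papp_morph (K : fieldType) (V W : lmodType K) (f : {linear V -> V})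
    (g : {linear W -> W}) (h : {linear V -> W}) q v :
  (forall u, h (f u) = g (h u)) -> h (papp f q v) = papp g q (h v).
Proof.
move=> hfg; rewrite /papp linear_sum; apply: eq_bigr => i _.
rewrite linearZ /=; congr (_ *: _); elim: (nat_of_ord i) => //= j <-.
exact: hfg.
Qed.

(** The pair [(u, v)] stands for u + iv; the separate name carries the [R[i]]-scaling [cscale] in
    place of the componentwise one. *)
Definition cpx (R : Type) (V : Type) : Type := (V * V)%type.

Section Complexify.
Variables (R : rcfType) (V : lmodType R).
Local Notation C := R[i].
Local Notation VC := (cpx R V).
HB.instance Definition _ := GRing.Zmodule.copy VC (V * V)%type.

Definition cscale (z : C) (w : VC) : VC :=
  (complex.Re z *: w.1 - complex.Im z *: w.2,
   complex.Re z *: w.2 + complex.Im z *: w.1).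

Lemma cscaleA a b w : cscale a (cscale b w) = cscale (a * b) w.
Proof.
case: a b w => [a a'] [b b'] [u v]; rewrite /cscale /=; congr (_, _).
  rewrite !scalerBr !scalerDr !scalerA !scalerBl !scalerDl !opprD !addrA.
  by rewrite [LHS]addrAC; congr (_ - _); rewrite addrAC.
rewrite !scalerBr !scalerDr !scalerA !scalerBl !scalerDl !addrA.
by rewrite [LHS]addrAC; congr (_ + _); rewrite addrAC.
Qed.

Lemma cscale1 : left_id 1 cscale.
Proof.
by case=> u v; rewrite /cscale /= !scale1r !scale0r subr0 addr0.
Qed.

Lemma cscaleDr : right_distributive cscale +%R.
Proof.
move=> [a a'] [u v] [u' v']; rewrite /cscale /=; congr (_, _) => /=.
  by rewrite !scalerDr opprD addrACA.
by rewrite !scalerDr addrACA.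
Qed.

Lemma cscaleDl w : {morph cscale^~ w : a b / a + b}.
Proof.
case: w => u v [a a'] [b b']; rewrite /cscale /=; congr (_, _) => /=.
  by rewrite !scalerDl opprD addrACA.
by rewrite !scalerDl addrACA.
Qed.

HB.instance Definition _ := GRing.Zmodule_isLmodule.Build C VC
  cscaleA cscale1 cscaleDr cscaleDl.

Definition cinj (v : V) : VC := (v, 0).

Lemma cinjD u v : cinj (u + v) = cinj u + cinj v.
Proof. by congr (_, _); rewrite /= addr0. Qed.

Lemma cinjZ a v : cinj (a *: v) = a%:C *: cinj v.
Proof. by congr (_, _); rewrite /= ?(scale0r, scaler0, subr0, addr0). Qed.

Lemma cpx_split (w : VC) : w = cinj w.1 + 'i%C *: cinj w.2.
Proof.
by case: w => u v; congr (_, _); rewrite /= ?(scale0r, scaler0, scale1r, subr0, add0r, addr0).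
Qed.
End Complexify.

Section ComplexifyLin.
Variables (R : rcfType) (V W : lmodType R) (f : {linear V -> W}).
Local Notation C := R[i].

Definition clin (w : cpx R V) : cpx R W := (f w.1, f w.2).

Lemma clin_linear : linear clin.
Proof.
move=> [a a'] [u v] [u' v']; congr (_, _) => /=.
  by rewrite linearD linearB !linearZ.
by rewrite !linearD !linearZ.
Qed.
HB.instance Definition _ := GRing.isLinear.Build C (cpx R V) (cpx R W) _ clin clin_linear.

Lemma clin_inj v : clin (cinj v) = cinj (f v).
Proof. by congr (_, _); rewrite /= linear0. Qed.
End ComplexifyLin.

Section ComplexifyPoly.
Variables (R : rcfType) (V : lmodType R) (f : {linear V -> V}).

Lemma papp_clin (q : {poly R}) v :
  papp (clin f) (map_poly (real_complex R) q) (cinj v) = cinj (papp f q v).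
Proof.
rewrite /papp size_map_poly; have cinj0 : cinj (0 : V) = 0 by [].
have -> : cinj (\sum_(i < size q) q`_i *: iter i f v) =
   \sum_(i < size q) (q`_i)%:C *: cinj (iter i f v).
  elim/big_rec2: _ => [|i x y _ <-]; first exact: cinj0.
  by rewrite cinjD cinjZ.
apply: eq_bigr => i _; rewrite coef_map; congr (_ *: _).
by elim: (nat_of_ord i) => //= j ->; rewrite -clin_inj.
Qed.
End ComplexifyPoly.

Local Ltac perm4 := rewrite ?opprD ?opprK -?addrA; congr (_ + _);
  first [done | by rewrite addrCA | by rewrite addrC -?addrA
  | by congr (_ + _); rewrite addrC | by rewrite addrCA; congr (_ + _); rewrite addrC
  | by rewrite [in LHS]addrC -?addrA addrCA
  | by rewrite [in LHS]addrC -?addrA; congr (_ + _); rewrite addrC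
  | by rewrite [in RHS]addrC -?addrA
  | by rewrite [in RHS]addrC -?addrA; congr (_ + _); rewrite addrC ].

Section ComplexifyBilin.
Variables (R : rcfType) (U V W : lmodType R) (b : U -> V -> W).
Hypotheses (bl : forall v, linear (b^~ v)) (br : forall u, linear (b u)).
Local Notation C := R[i].

Definition cbil (x : cpx R U) (y : cpx R V) : cpx R W :=
  (b x.1 y.1 - b x.2 y.2, b x.1 y.2 + b x.2 y.1).

Let blD u u' v : b (u + u') v = b u v + b u' v.
Proof. by have := bl v 1 u u'; rewrite !scale1r. Qed.
Let brD u v v' : b u (v + v') = b u v + b u v'.
Proof. by have := br u 1 v v'; rewrite !scale1r. Qed.
Let bl0 v : b 0 v = 0.
Proof. by apply: (addIr (b 0 v)); rewrite -blD !add0r. Qed.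
Let br0 u : b u 0 = 0.
Proof. by apply: (addIr (b u 0)); rewrite -brD !add0r. Qed.
Let blZ a u v : b (a *: u) v = a *: b u v.
Proof. by have := bl v a u 0; rewrite bl0 !addr0. Qed.
Let brZ a u v : b u (a *: v) = a *: b u v.
Proof. by have := br u a v 0; rewrite br0 !addr0. Qed.
Let blN u v : b (- u) v = - b u v.
Proof. by rewrite -scaleN1r blZ scaleN1r. Qed.
Let brN u v : b u (- v) = - b u v.
Proof. by rewrite -scaleN1r brZ scaleN1r. Qed.

Lemma cbilDl x x' y : cbil (x + x') y = cbil x y + cbil x' y.
Proof.
by congr (_, _); rewrite /= !blD ?opprD addrACA.
Qed.

Lemma cbilDr x y y' : cbil x (y + y') = cbil x y + cbil x y'.
Proof.
by congr (_, _); rewrite /= !brD ?opprD addrACA.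
Qed.

Lemma cbilZl (a : C) x y : cbil (a *: x) y = a *: cbil x y.
Proof.
case: a x y => [a a'] [u u'] [v v']; congr (_, _) => /=.
  by rewrite !blD !blN !blZ !scalerBr !scalerDr; perm4.
by rewrite !blD !blN !blZ !scalerBr !scalerDr; perm4.
Qed.

Lemma cbilZr (a : C) x y : cbil x (a *: y) = a *: cbil x y.
Proof.
case: a x y => [a a'] [u u'] [v v']; congr (_, _) => /=.
  by rewrite !brD !brN !brZ !scalerBr !scalerDr; perm4.
by rewrite !brD !brN !brZ !scalerBr !scalerDr; perm4.
Qed.

Lemma cbil_inj u v : cbil (cinj u) (cinj v) = cinj (b u v).
Proof. by congr (_, _); rewrite /= ?br0 ?bl0 ?subr0 ?addr0. Qed.
End ComplexifyBilin.

(** * Chinese remainders and generalized eigenspaces *)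

Section Interp.
Variable F : fieldType.
Implicit Types (s : seq F) (K : nat) (p q Q : {poly F}).

Lemma coprimep_XsubC_exp_prod s K (l : F) : l \notin s ->
  coprimep (('X - l%:P) ^+ K) (\prod_(m <- s) ('X - m%:P) ^+ K).
Proof.
elim: s => [|m s IH]; first by rewrite big_nil coprimep1.
rewrite inE negb_or => /andP[lm ls]; rewrite big_cons coprimepMr IH // andbT.
by apply/coprimep_expl/coprimep_expr; rewrite coprimep_XsubC2 // subr_eq0 eq_sym.
Qed.

(** Chinese remainder theorem for the pairwise coprime moduli (X - l)^K. *)
Lemma poly_crt s K (r : F -> {poly F}) : uniq s ->
  exists Q, forall l, l \in s -> ('X - l%:P) ^+ K %| Q - r l.
Proof.
elim: s => [|m s IH]; first by exists 0.
move=> /= /andP[ms /IH[Q HQ]].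
have /Bezout_coprimepP[[u v] /= Huv] := coprimep_XsubC_exp_prod K ms.
set P := \prod_(_ <- _) _ in Huv; set M := (_ - _) ^+ K in Huv.
have [c c0 Hc] : exists2 c : F, c != 0 & u * M + v * P = c%:P.
  move: Huv; rewrite -size_poly_eq1 => /eqP/eqP/size_poly1P[c c0 ->]; by exists c.
(* [c^-1 *: (v * P)] is 1 modulo [M] and 0 modulo the other factors, so the correction affects only
   the condition at [m]. *)
exists (Q + c^-1 *: (v * P) * (r m - Q)) => l; rewrite inE => /orP[/eqP->|ls].
  have -> : c^-1 *: (v * P) = 1 - c^-1 *: (u * M).
    apply/eqP; rewrite eq_sym subr_eq -scalerDr [v * P + _]addrC Hc.
    by rewrite scale_polyC mulVf.
  have -> : Q + (1 - c^-1 *: (u * M)) * (r m - Q) - r m = - (c^-1 *: (u * M) * (r m - Q)).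
    by move: (c^-1 *: _) => X; ring.
  by rewrite dvdpNr -scalerAl dvdpZr ?invr_eq0 // mulrAC dvdp_mull.
rewrite addrAC dvdp_add ?HQ // -scalerAl dvdpZr ?invr_eq0 //.
rewrite mulrAC dvdp_mull // /P; elim: (s) ls => // k t IHt.
rewrite inE big_cons => /orP[/eqP->|/IHt kt]; first exact: dvdp_mulr.
exact: dvdp_mull.
Qed.
End Interp.

Section GenEigen.
Variables (F : closedFieldType) (V : lmodType F) (f : {linear V -> V}).

(** Multiplicities are at most [size chi], so a single exponent serves all roots. *)
Lemma closed_dvdp_roots (chi : {poly F}) : chi != 0 ->
  exists2 s : seq F, uniq s & (forall l, l \in s -> root chi l) /\
    chi %| \prod_(l <- s) ('X - l%:P) ^+ (size chi).
Proof.
move=> chi0; have [rs Hrs] := closed_field_poly_normal chi.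
have lc0 : lead_coef chi != 0 by rewrite lead_coef_eq0.
exists (undup rs); first exact: undup_uniq.
split=> [l|].
  by rewrite mem_undup Hrs rootZ // root_prod_XsubC.
rewrite {1}Hrs dvdpZl // -big_undup_iterop_count /=.
have szrs : (size rs <= size chi)%N.
  by rewrite Hrs size_scale // size_prod_XsubC.
rewrite big_seq [X in _ %| X]big_seq.
elim/big_rec2: _ => [|l x y lrs xy]; first exact: dvdpp.
apply: dvdp_mul => //; rewrite -[iterop _ _ _ _]/(_ ^+ _).
by rewrite dvdp_exp2l // (leq_trans (count_size _ _)).
Qed.

(** Primary decomposition as an induction principle: Bezout splits a vector into its component at
    one root and the rest, so no direct sum of eigenspaces has to be formed. *)
Lemma geig_ind (S : V -> Prop) (chi : {poly F}) : chi != 0 ->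
  S 0 -> (forall u v, S u -> S v -> S (u + v)) ->
  (forall l v, root chi l -> papp f (('X - l%:P) ^+ size chi) v = 0 -> S v) ->
  forall w, papp f chi w = 0 -> S w.
Proof.
move=> chi0 S0 SD Sg; have [s us [sr dv]] := closed_dvdp_roots chi0.
move=> w /(papp_dvd dv) => {dv}; set K := size chi in Sg *.
elim: s us sr w => [|m s IH] /= us sr w.
  by rewrite big_nil papp1 => ->.
case/andP: us => ms us; rewrite big_cons => Hw.
have /Bezout_coprimepP[[u v] /= Huv] := coprimep_XsubC_exp_prod K ms.
set P := \prod_(_ <- _) _ in Hw Huv; set M := (_ - _) ^+ K in Hw Huv.
have [c c0 Hc] : exists2 c : F, c != 0 & u * M + v * P = c%:P.
  move: Huv; rewrite -size_poly_eq1 => /eqP/eqP/size_poly1P[c c0 ->]; by exists c.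
have -> : w = papp f (c^-1 *: (v * P)) w + papp f (c^-1 *: (u * M)) w.
  by rewrite -pappD -scalerDr [v * P + _]addrC Hc scale_polyC mulVf // papp1.
apply: SD.
  apply: (Sg m); first by apply: sr; rewrite mem_head.
  by rewrite -pappM -scalerAr pappZ mulrCA pappM Hw linear0 scaler0.
apply: IH => //; first by move=> l ls; apply: sr; rewrite inE ls orbT.
by rewrite -pappM -scalerAr pappZ mulrCA [P * M]mulrC pappM Hw linear0 scaler0.
Qed.
End GenEigen.

Section GenEigenBil.
Variables (F : fieldType) (U V W : lmodType F) (b : U -> V -> W).
Hypotheses (bDl : forall u u' v, b (u + u') v = b u v + b u' v)
  (bDr : forall u v v', b u (v + v') = b u v + b u v')
  (bZl : forall a u v, b (a *: u) v = a *: b u v)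
  (bZr : forall a u v, b u (a *: v) = a *: b u v).
Variables (f : {linear U -> U}) (f' : {linear V -> V}) (f'' : {linear W -> W}).
Hypothesis fb : forall u v, f'' (b u v) = b (f u) v + b u (f' v).

Let b0l v : b 0 v = 0. Proof. by have := bZl 0 0 v; rewrite !scale0r. Qed.
Let b0r u : b u 0 = 0. Proof. by have := bZr 0 u 0; rewrite !scale0r. Qed.

(** Weights add: by the Leibniz rule each application of f'' - (l + m) lowers one of the two
    exponents, whence the induction on [i + j]. *)
Lemma geig_bil l m i j u v :
  papp f (('X - l%:P) ^+ i) u = 0 -> papp f' (('X - m%:P) ^+ j) v = 0 ->
  papp f'' (('X - (l + m)%:P) ^+ (i + j)) (b u v) = 0.
Proof.
have [n Hn] : exists n, n = (i + j)%N by eexists.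
rewrite -Hn; elim: n i j u v Hn => [|n IH] i j u v Hn.
  case: i Hn => // _; rewrite expr0 papp1 => -> _.
  by rewrite expr0 papp1 b0l.
case: i Hn => [|i] Hn; first by rewrite expr0 papp1 => ->; rewrite b0l linear0.
case: j Hn => [|j] Hn; first by move=> _; rewrite expr0 papp1 => ->; rewrite b0r linear0.
move=> Hu Hv; rewrite exprSr pappM pappB pappX pappC fb.
have -> : b (f u) v + b u (f' v) - (l + m) *: b u v =
   b (papp f ('X - l%:P) u) v + b u (papp f' ('X - m%:P) v).
  rewrite !pappB !pappX !pappC -!scaleN1r bDl bDr bZl bZr bZr bZl.
  by rewrite addrACA !scaleN1r -opprD -scalerDl.
have Hij : n = (i + j.+1)%N by case: Hn.
rewrite linearD /= (IH i j.+1) -?pappM -?exprSr //.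
by rewrite (IH i.+1 j) -?pappM -?exprSr ?addr0 // Hij addSnnS.
Qed.
End GenEigenBil.

Section RealInterp.
Variable R : rcfType.
Local Notation C := R[i].
Local Notation toC := (map_poly (real_complex R)).

Lemma toC_Re (Q : {poly C}) :
  exists q : {poly R}, toC q = 2%:R^-1 *: (Q + map_poly (@conjc R) Q).
Proof.
exists (\poly_(i < size Q) complex.Re Q`_i); apply/polyP => i.
rewrite coef_map coefZ coefD coef_map coef_poly /=.
case: ltnP => [_|/(nth_default 0) ->]; last first.
  by rewrite rmorph0 addr0 mulr0.
by rewrite ReJ_add mulrC.
Qed.

(** Interpolation at [s] and its conjugates makes [Q] and its coefficientwise conjugate satisfy the
    same congruences at [s]; their average is real. *)
Lemma real_interp (f : C -> C) (s : seq C) K :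
  (forall z, f (conjc z) = conjc (f z)) ->
  exists q : {poly R}, forall l, l \in s -> ('X - l%:P) ^+ K %| toC q - (f l)%:P.
Proof.
move=> fJ.
have [Q HQ] := poly_crt K (fun l => (f l)%:P) (undup_uniq (s ++ map (@conjc R) s)).
have [q Hq] := toC_Re Q; exists q => l ls.
have H1 : ('X - l%:P) ^+ K %| Q - (f l)%:P.
  by apply: HQ; rewrite mem_undup mem_cat ls.
have H2 : ('X - l%:P) ^+ K %| map_poly (@conjc R) Q - (f l)%:P.
  have : ('X - (conjc l)%:P) ^+ K %| Q - (f (conjc l))%:P.
    by apply: HQ; rewrite mem_undup mem_cat map_f ?orbT.
  rewrite -(dvdp_map (@conjc R)) rmorphXn !rmorphB /= map_polyX !map_polyC /=.
  by rewrite -[in X in X -> _]fJ !conjcK.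
rewrite Hq.
have -> : (f l)%:P = 2%:R^-1 *: ((f l)%:P + (f l)%:P).
  by rewrite -mulr2n -polyCMn scale_polyC -[f l *+ 2]mulr_natl mulKf // pnatr_eq0.
by rewrite -scalerBr dvdpZr ?invr_eq0 ?pnatr_eq0 // opprD addrACA dvdp_add.
Qed.
End RealInterp.

(** * Spectra and traces of real endomorphisms *)

Section HornerMx.
Variable K : fieldType.
(** [horner_mx] without the restriction to positive size, as the ambient space may be zero. *)
Definition hmx n (A : 'M[K]_n) (p : {poly K}) : 'M[K]_n :=
  \sum_(i < size p) p`_i *: A ^+ i.

Lemma hmxE n (A : 'M[K]_n.+1) p : hmx A p = horner_mx A p.
Proof.
rewrite /horner_mx /horner_morph horner_coef size_map_poly.
by apply: eq_bigr => i _; rewrite coef_map /= -mul_scalar_mx.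
Qed.

Lemma hmx_char_poly n (A : 'M[K]_n) : hmx A (char_poly A) = 0.
Proof.
case: n A => [|n] A; first by rewrite [LHS]flatmx0.
by rewrite hmxE Cayley_Hamilton.
Qed.

Lemma trig_mul n (A B : 'M[K]_n) : is_trig_mx A -> is_trig_mx B ->
  is_trig_mx (A *m B) /\ forall i, (A *m B) i i = A i i * B i i.
Proof.
move=> /is_trig_mxP HA /is_trig_mxP HB; split=> [|i].
  apply/is_trig_mxP => i j ij; rewrite mxE big1 // => k _.
  by case: (ltnP i k) => [/HA->|ki]; rewrite ?mul0r // HB ?mulr0 // (leq_ltn_trans ki).
rewrite mxE (bigD1 i) //= big1 ?addr0 // => k ki.
case: (ltngtP i k) => [/HA->|/HB->|/ord_inj eik]; rewrite ?mul0r ?mulr0 //.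
by rewrite eik eqxx in ki.
Qed.

Lemma trig_horner n (A : 'M[K]_n.+1) p : is_trig_mx A ->
  is_trig_mx (horner_mx A p) /\ forall i, horner_mx A p i i = p.[A i i].
Proof.
move=> tA; elim/poly_ind: p => [|p c [IHt IHd]].
  by rewrite rmorph0; split=> [|i]; rewrite ?mxE ?horner0 ?mx0_is_trig.
rewrite rmorphD rmorphM /= horner_mx_X horner_mx_C.
have [Ht Hd] := trig_mul IHt tA; split.
  apply/is_trig_mxP => i j ij; rewrite mxE (is_trig_mxP Ht) // mxE.
  by rewrite -val_eqE /= (ltn_eqF ij) addr0.
move=> i; rewrite mxE Hd IHd !mxE eqxx mulr1n.
by rewrite !hornerE.
Qed.
End HornerMx.

Section Spectrum.
Variable C : numClosedFieldType.
(** [rs] is the diagonal of a Schur triangularisation, that is, the eigenvalues with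
    multiplicity. *)
Lemma spectrum_mx n (A : 'M[C]_n) : exists rs : seq C,
  [/\ (forall l, root (char_poly A) l -> l \in rs), hmx A (\prod_(l <- rs) ('X - l%:P)) = 0,
    forall p, \tr (hmx A p) = \sum_(l <- rs) p.[l]
  & forall p, hmx A p = 0 -> forall l, l \in rs -> root p l].
Proof.
case: n A => [|n] A.
  exists [::]; split=> //.
  - by move=> l; rewrite /char_poly det_mx00 => /negPn; rewrite root1.
  - by rewrite [LHS]flatmx0.
  - by move=> p; rewrite /mxtrace big_ord0 big_nil.
have [P Pu] := Schur A (ltn0Sn n); rewrite /similar_to /= => trT.
have uP : P \in unitmx by rewrite unitarymx_unit.
set T := conjmx P A in trT.
have HT p : horner_mx T p = P *m horner_mx A p *m invmx P.
  by rewrite /T conjumx // horner_mx_uconj.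
have AT p : horner_mx T p = 0 -> horner_mx A p = 0.
  rewrite HT => /(congr1 (fun X => invmx P *m X *m P)).
  by rewrite !mulmxA mulVmx // mul1mx mulmxKV // mulmx0 mul0mx.
set rs := [seq T i i | i <- enum 'I_n.+1].
have H0 : horner_mx A (\prod_(l <- rs) ('X - l%:P)) = 0.
  by rewrite AT // big_map big_enum /= -char_poly_trig ?Cayley_Hamilton.
exists rs; split.
- move=> l; rewrite -root_mxminpoly => /(root_dvdp (mxminpoly_min H0)).
  by rewrite root_prod_XsubC.
- by rewrite hmxE.
- move=> p; rewrite big_map big_enum hmxE.
  have -> : \tr (horner_mx A p) = \tr (horner_mx T p).
    by rewrite HT mxtrace_mulC mulmxA mulVmx // mul1mx.
  by apply: eq_bigr => i _; have [_ ->] := trig_horner p trT.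
- move=> p; rewrite hmxE => pA l /mapP[i _ ->]; apply/rootP.
  have [_ <-] := trig_horner p trT.
  by rewrite HT pA mulmx0 mul0mx mxE.
Qed.
End Spectrum.

Section EndoTrace.
Variables (K : fieldType) (V : vectType K).
Implicit Types (f g : 'End(V)) (p q : {poly K}).
Local Notation n := (\dim {:V}).

Definition emx f : 'M[K]_n := passmx.mxof (vbasis {:V}) (vbasis {:V}) f.
Definition etr f : K := \tr (emx f).
Definition epapp q f : 'End(V) := linfun (papp f q).

Let eB : basis_of {:V} (vbasis {:V}) := vbasisP {:V}.

Lemma emx_inj : injective emx. Proof. exact: can_inj (passmx.mxofK eB eB). Qed.

Lemma emx_linear : linear emx.
Proof. exact: passmx.mxof_linear. Qed.
HB.instance Definition _ := GRing.isLinear.Build K _ _ _ emx emx_linear.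

Lemma etr_linear : linear (etr : 'End(V) -> K^o).
Proof. by move=> a f g; rewrite /etr linearD linearZ /= mxtraceD mxtraceZ. Qed.
HB.instance Definition _ := GRing.isLinear.Build K 'End(V) K^o _ etr etr_linear.

(** The order is reversed because matrices act on row vectors. *)
Lemma emx_comp f g : emx (f \o g)%VF = emx g *m emx f.
Proof. exact: passmx.mxof_comp. Qed.

Lemma emx1 : emx \1%VF = 1%:M.
Proof. exact: passmx.mxof1 (basis_free eB). Qed.

Lemma etrC f g : etr (f \o g)%VF = etr (g \o f)%VF.
Proof. by rewrite /etr !emx_comp mxtrace_mulC. Qed.

Lemma epappE q f v : epapp q f v = papp f q v. Proof. by rewrite lfunE. Qed.

Lemma linfun_iter i f : linfun (iter i f) =1 iter i f.
Proof.
pose fi := GRing.isLinear.Build _ _ _ _ _ (iter_linear f i).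
pose fl : {linear V -> V} := HB.pack (iter i f) fi.
by move=> v; rewrite -[iter i f]/(fl : V -> V) lfunE.
Qed.

Lemma emx_iter i f (h : 'End(V)) : h =1 iter i f -> emx h = emx f ^+ i.
Proof.
elim: i h => [|i IH] h Hh.
  by rewrite expr0 -[1]/(1%:M) -emx1; congr emx; apply/lfunP => v; rewrite Hh lfunE.
have Hg := linfun_iter i f.
rewrite exprSr -[_ * _]/(_ *m _) -(IH _ Hg) -emx_comp; congr emx.
by apply/lfunP => v; rewrite Hh comp_lfunE Hg.
Qed.

Lemma emx_epapp q f : emx (epapp q f) = hmx (emx f) q.
Proof.
have -> : epapp q f = \sum_(i < size q) q`_i *: linfun (iter i f).
  apply/lfunP => v; rewrite epappE sum_lfunE; apply: eq_bigr => i _.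
  by rewrite scale_lfunE linfun_iter.
rewrite linear_sum; apply: eq_bigr => i _; rewrite linearZ /=.
by rewrite (emx_iter (linfun_iter i f)).
Qed.

Lemma epapp_charpoly f : epapp (char_poly (emx f)) f = 0.
Proof. by apply: emx_inj; rewrite emx_epapp hmx_char_poly linear0. Qed.

Lemma papp_charpoly f v : papp f (char_poly (emx f)) v = 0.
Proof. by rewrite -epappE epapp_charpoly lfunE. Qed.

Lemma epappM p q f : epapp (p * q) f = (epapp p f \o epapp q f)%VF.
Proof. by apply/lfunP => v; rewrite comp_lfunE !epappE pappM. Qed.

Lemma epappX f : epapp 'X f = f.
Proof. by apply/lfunP => v; rewrite epappE pappX. Qed.

Lemma epappB p q f : epapp (p - q) f = epapp p f - epapp q f.
Proof. by apply/lfunP => v; rewrite add_lfunE opp_lfunE !epappE pappB. Qed.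

Lemma epapp0_dvd p q f : p %| q -> epapp p f = 0 -> epapp q f = 0.
Proof. by move=> /dvdpP[r ->] H; rewrite epappM H comp_lfun0r. Qed.

Lemma epapp_comm f g q : (f \o g = g \o f)%VF -> (epapp q f \o g = g \o epapp q f)%VF.
Proof.
move=> fg; apply/lfunP => v; rewrite !comp_lfunE !epappE.
apply/esym; apply: papp_morph => u.
by have /lfunP/(_ u) := fg; rewrite !comp_lfunE.
Qed.

(* [tr (u |-> l u *: w) = l w]: the trace is independent of the basis. *)
Lemma etr_rank1 (l : V -> K) (w : V) : scalar l ->
  etr (linfun (fun u => l u *: w)) = l w.
Proof.
move=> ll.
have lin : linear (fun u => l u *: w).
  by move=> a u v; rewrite ll scalerDl scalerA.
pose gl : {linear V -> V} := HB.pack (fun u => l u *: w) (GRing.isLinear.Build _ _ _ _ _ lin).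
pose l' : {linear V -> K^o} := HB.pack (l : V -> K^o) (GRing.isLinear.Build _ _ (K^o) _ _ (ll : linear (l : V -> K^o))).
rewrite /etr /mxtrace.
rewrite [w in RHS](coord_basis eB) ?memvf // -[l]/(l' : V -> K) linear_sum /=.
apply: eq_bigr => i _; rewrite !mxE /= passmx.vecof_delta.
rewrite -[fun u => l u *: w]/(gl : V -> V) lfunE /= linearZ /=.
by rewrite mulrC; apply/esym; apply: (linearZ_LR l').
Qed.

(** Expanding in a basis of [U] writes [f] as a sum of rank-one maps; this links the trace to the
    definition of [killing]. *)
Lemma etr_limg (U : {vspace V}) f : (forall v, f v \in U) ->
  etr f = \sum_(i < \dim U) coord (vbasis U) i (f (vbasis U)`_i).
Proof.
move=> fU.
have sc (i : 'I_(\dim U)) : scalar (fun u => coord (vbasis U) i (f u)).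
  by move=> a u v; rewrite !linearP.
have Hf : f = \sum_(i < \dim U) linfun (fun u => coord (vbasis U) i (f u) *: (vbasis U)`_i).
  apply/lfunP => u; rewrite sum_lfunE [LHS](coord_vbasis (fU u)).
  apply: eq_bigr => i _.
  have lin : linear (fun u => coord (vbasis U) i (f u) *: (vbasis U)`_i).
    by move=> a v w; rewrite sc scalerDl scalerA.
  pose gl : {linear V -> V} := HB.pack (fun u => coord (vbasis U) i (f u) *: (vbasis U)`_i) (GRing.isLinear.Build _ _ _ _ _ lin).
  by rewrite -[RHS]/(linfun gl u) lfunE.
by rewrite [in LHS]Hf linear_sum; apply: eq_bigr => i _; exact: (etr_rank1 _ (sc i)).
Qed.
End EndoTrace.

Section RealSpectrum.
Variables (R : rcfType) (V : vectType R).
Local Notation C := R[i].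
Local Notation toC := (map_poly (real_complex R)).
Implicit Types (f g : 'End(V)) (p q : {poly R}).

Definition nilp f := exists n, forall v, iter n f v = 0.

Lemma nilpP f : nilp f <-> exists n, epapp 'X^n f = 0.
Proof.
split=> -[n Hn]; exists n.
  by apply/lfunP => v; rewrite epappE pappXn Hn lfunE.
by move=> v; rewrite -pappXn -epappE Hn lfunE.
Qed.

Lemma hmx_toC n (A : 'M[R]_n) p :
  hmx (map_mx (real_complex R) A) (toC p) = map_mx (real_complex R) (hmx A p).
Proof.
rewrite /hmx size_map_poly map_mx_sum; apply: eq_bigr => i _.
rewrite map_mxZ coef_map /=; congr (_ *: _).
elim: (nat_of_ord i) => [|j IH]; first by rewrite !expr0 -[1]/(1%:M) -[X in map_mx _ X]/(1%:M) map_mx1.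
by rewrite !exprS IH; apply/esym; exact: map_mxM.
Qed.

Definition spec f (rs : seq C) :=
  [/\ (forall p, (etr (epapp p f))%:C = \sum_(l <- rs) (toC p).[l]),
      (forall p, epapp p f = 0 -> forall l, l \in rs -> root (toC p) l),
      (forall p, (forall l, l \in rs -> root (toC p) l) ->
         epapp (p ^+ size rs) f = 0)
    & (forall l, root (toC (char_poly (emx f))) l = (l \in rs))].

Lemma specP f : exists rs, spec f rs.
Proof.
have [rs [H1 H2 H3 H4]] := spectrum_mx (map_mx (real_complex R) (emx f)).
have Hr p : epapp p f = 0 -> forall l, l \in rs -> root (toC p) l.
  by move=> /(congr1 (@emx _ _)); rewrite emx_epapp linear0 => Hp; apply: H4; rewrite hmx_toC Hp map_mx0.
exists rs; split=> //.
- by move=> p; rewrite -H3 hmx_toC /etr emx_epapp -trace_map_mx.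
- move=> p Hp; apply: emx_inj; rewrite linear0 emx_epapp.
  apply: (@map_mx_inj _ _ (real_complex R)); rewrite map_mx0 -hmx_toC rmorphXn /=.
  have /dvdpP[r ->] : \prod_(l <- rs) ('X - l%:P) %| toC p ^+ size rs.
    elim: (rs) Hp => [|l s IH] Hp; first by rewrite big_nil dvd1p.
    rewrite big_cons exprS; apply: dvdp_mul; last by apply: IH => m ms; apply: Hp; rewrite inE ms orbT.
    by rewrite dvdp_XsubCl Hp ?mem_head.
  case: (\dim {:V}) (emx f) H2 => [|n] A H; first by apply/matrixP => -[].
  by move: H; rewrite !hmxE rmorphM /= => ->; rewrite mulr0.
- move=> l; apply/idP/idP; last exact/Hr/epapp_charpoly.
  by rewrite map_char_poly => /H1.
Qed.

Lemma spec0_nilp f rs : spec f rs -> {in rs, forall l, l = 0} -> nilp f.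
Proof.
case=> _ _ H _ rs0; apply/nilpP; exists (size rs); rewrite -['X^_]/('X ^+ _) H //.
by move=> l /rs0 ->; rewrite map_polyX; apply/rootP; rewrite hornerX.
Qed.

Lemma nilp_etr f : nilp f -> etr f = 0.
Proof.
move=> /nilpP[n Hn]; have [rs [Ht Hr _ _]] := specP f.
apply: (@complexI R); rewrite -[f in LHS]epappX Ht rmorph0 big_seq big1 // => l.
move=> /(Hr _ Hn); rewrite map_polyXn map_polyX hornerX => /rootP.
by rewrite hornerXn => /eqP; rewrite expf_eq0 => /andP[_ /eqP].
Qed.

Lemma sum_normC0 (rs : seq C) : \sum_(l <- rs) l * conjc l = 0 -> {in rs, forall l, l = 0}.
Proof.
move/eqP; rewrite psumr_eq0 => [/allP H l /H|l _]; last exact: mulcJ_ge0.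
by rewrite mulf_eq0 conjc_eq0 orbb => /eqP.
Qed.

(** The trace of [f \o epapp q f] is the sum of |l|^2 over the eigenvalues. *)
Lemma spec_conj_nilp f q :
  (forall l, root (toC (char_poly (emx f))) l -> (toC q).[l] = conjc l) ->
  etr (f \o epapp q f)%VF = 0 -> nilp f.
Proof.
move=> Hq tr0; have [rs Hs] := specP f; apply: (spec0_nilp Hs).
case: Hs => Ht _ _ Hr; apply: sum_normC0.
have := Ht ('X * q); rewrite epappM epappX tr0 rmorph0 => /esym; apply: etrans.
rewrite big_seq [RHS]big_seq; apply: eq_bigr => l ls; rewrite rmorphM /= map_polyX hornerM hornerX.
by rewrite Hq // Hr.
Qed.

(** For [q] interpolating conjugation on the spectrum, ['X * q] has no constant term, so its trace
    at [f] is a combination of the given power traces. *)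
Lemma etr_pow_nilp f : (forall k, (0 < k)%N -> etr (epapp 'X^k f) = 0) -> nilp f.
Proof.
move=> Hk; have [rs [_ _ _ Hr]] := specP f.
have [q Hq] := real_interp rs 1 (fun z => erefl (conjc (conjc z))).
apply: (@spec_conj_nilp f q) => [l|].
  rewrite Hr => /Hq; rewrite expr1 dvdp_XsubCl /root hornerD hornerN hornerC subr_eq0.
  by move/eqP.
rewrite -[X in (X \o _)%VF]epappX -epappM.
have -> : 'X * q = \sum_(i < size q) q`_i *: 'X^(i.+1).
  rewrite -[q in LHS]coefK poly_def mulr_sumr; apply: eq_bigr => i _.
  by rewrite -scalerAr -exprS.
have -> : epapp (\sum_(i < size q) q`_i *: 'X^(i.+1)) f =
   \sum_(i < size q) q`_i *: epapp 'X^(i.+1) f.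
  apply/lfunP => v; rewrite epappE papp_sum sum_lfunE; apply: eq_bigr => i _.
  by rewrite pappZ scale_lfunE epappE.
rewrite linear_sum big1 // => i _; rewrite linearZ /= Hk //; exact: mulr0.
Qed.

(** Purely imaginary spectrum, expressed by an annihilating polynomial so that it passes easily to
    compositions with projectors. *)
Definition imspec f := exists p, [/\ p != 0, epapp p f = 0
  & forall l, root (toC p) l -> complex.Re l = 0].

(** An imaginary [l] satisfies l^2 = -|l|^2, so the trace of the square is minus a sum of
    squares. *)
Lemma imspec_etr f : imspec f ->
  etr (f \o f)%VF <= 0 /\ (etr (f \o f)%VF = 0 -> nilp f).
Proof.
move=> [p [_ p0 Hp]]; have [rs Hs] := specP f.
have [Ht Hr _ _] := Hs.
have Him l : l \in rs -> l ^+ 2 = - (l * conjc l).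
  move=> /(Hr _ p0)/Hp; case: l => a b /= ->.
  by rewrite expr2; congr (_ +i* _) => /=; ring.
have E : (etr (f \o f)%VF)%:C = - \sum_(l <- rs) l * conjc l.
  have -> : (f \o f)%VF = epapp 'X^2 f by rewrite exprS expr1 epappM epappX.
  rewrite Ht -sumrN big_seq [RHS]big_seq; apply: eq_bigr => l /Him <-.
  by rewrite map_polyXn hornerXn.
split.
  by rewrite -lecR E rmorph0 oppr_le0 sumr_ge0 // => l _; apply: mulcJ_ge0.
move=> e0; move: E; rewrite e0 rmorph0 => /esym/eqP; rewrite oppr_eq0 => /eqP.
by move=> /sum_normC0 /(spec0_nilp Hs).
Qed.

(** The real part of the trace is the sum of (Re l)^2, because Re (l * Re l) = (Re l)^2. *)
Lemma spec_Re_imspec f q :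
  (forall l, root (toC (char_poly (emx f))) l -> (toC q).[l] = (complex.Re l)%:C) ->
  etr (f \o epapp q f)%VF = 0 -> imspec f.
Proof.
move=> Hq tr0; have [rs [Ht _ _ Hr]] := specP f.
exists (char_poly (emx f)); split.
- exact/monic_neq0/char_poly_monic.
- exact: epapp_charpoly.
move=> l; rewrite Hr => lrs.
have := Ht ('X * q); rewrite epappM epappX tr0 => /(congr1 (@complex.Re R)) /=.
rewrite raddf_sum /= => /esym/eqP; rewrite big_seq.
have E m : m \in rs -> complex.Re (toC ('X * q)).[m] = complex.Re m ^+ 2.
  move=> ms; rewrite rmorphM /= map_polyX hornerM hornerX Hq ?Hr //.
  by case: m {ms} => a b /=; ring.
rewrite (eq_bigr (fun m => complex.Re m ^+ 2)) => [|m /E //].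
rewrite -big_seq psumr_eq0 => [/allP /(_ l lrs)|m _]; last exact: sqr_ge0.
by rewrite sqrf_eq0 => /eqP.
Qed.
End RealSpectrum.

(** [P] fixes the range of [f \o P], on which the composite acts as [f]; the factor ['X] first moves
    a vector into that range and adds only the eigenvalue 0. *)
Lemma imspec_comp (R : rcfType) (V : vectType R) (f P : 'End(V)) :
  (P \o (f \o P) = f \o P)%VF -> imspec f -> imspec (f \o P)%VF.
Proof.
move=> /lfunP HP [p [p0 Hp Hr]]; exists (p * 'X); split.
- by rewrite mulf_neq0 // polyX_eq0.
- apply/lfunP => v; rewrite epappE pappMX [RHS]lfunE /= comp_lfunE.
  have Hw : papp f p (f (P v)) = 0 by rewrite -epappE Hp lfunE.
  have HPw : P (f (P v)) = f (P v) by have := HP v; rewrite !comp_lfunE.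
  rewrite -[RHS]Hw /papp; apply: eq_bigr => i _; congr (_ *: _).
  suff [] : iter i (f \o P)%VF (f (P v)) = iter i f (f (P v)) /\
     P (iter i f (f (P v))) = iter i f (f (P v)) by [].
  elim: (nat_of_ord i) => //= j [IH1 IH2]; rewrite IH1 comp_lfunE IH2; split=> //.
  by have := HP (iter j f (f (P v))); rewrite !comp_lfunE IH2.
- move=> l; rewrite rmorphM /= map_polyX rootM => /orP[/Hr //|].
  by rewrite /root hornerX => /eqP ->.
Qed.

(** * Derivations of a Lie algebra and their Jordan parts *)

Section Derivations.
Variables (R : rcfType) (g : lieAlgType R).
Local Notation C := R[i].
Local Notation toC := (map_poly (real_complex R)).
Implicit Types (x y z : g) (D : 'End(g)).

Lemma lieDr x y z : lie x (y + z) = lie x y + lie x z.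
Proof. exact: linearD. Qed.
Lemma lieZr a x y : lie x (a *: y) = a *: lie x y.
Proof. exact: linearZ. Qed.
Lemma lieDl x y z : lie (x + y) z = lie x z + lie y z.
Proof. by have := @lie_linearl R g z 1 x y; rewrite !scale1r. Qed.
Lemma lieC x y : lie x y = - lie y x.
Proof.
apply/eqP; rewrite -addr_eq0; have := liexx (x + y).
by rewrite lieDl !lieDr !liexx add0r addr0 => ->.
Qed.
Lemma lieZl a x y : lie (a *: x) y = a *: lie x y.
Proof. by rewrite lieC lieZr -scalerN -lieC. Qed.
Lemma lieNr x y : lie x (- y) = - lie x y. Proof. exact: linearN. Qed.
Lemma lieNl x y : lie (- x) y = - lie x y.
Proof. by rewrite lieC lieNr -lieC. Qed.
Lemma lie0r x : lie x 0 = 0. Proof. exact: linear0. Qed.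
Lemma lie0l x : lie 0 x = 0. Proof. by rewrite lieC lie0r oppr0. Qed.
Lemma lieBr x y z : lie x (y - z) = lie x y - lie x z.
Proof. by rewrite lieDr lieNr. Qed.
Lemma lieBl x y z : lie (x - y) z = lie x z - lie y z.
Proof. by rewrite lieDl lieNl. Qed.

Lemma jacobi x y z : lie x (lie y z) = lie (lie x y) z + lie y (lie x z).
Proof.
have := lie_jacobi x y z; rewrite (lieC z x) lieNr (lieC z) => /eqP.
by rewrite -addrA -opprD subr_eq0 => /eqP ->; rewrite addrC.
Qed.

Definition deriv D := forall x y, D (lie x y) = lie (D x) y + lie x (D y).

Lemma adE x y : ad x y = lie x y. Proof. by rewrite lfunE. Qed.

Lemma deriv_ad x : deriv (ad x).
Proof. by move=> y z; rewrite !adE jacobi. Qed.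

Lemma adD x y : ad (x + y) = ad x + ad y.
Proof. by apply/lfunP => z; rewrite add_lfunE !adE lieDl. Qed.
Lemma adZ a x : ad (a *: x) = a *: ad x.
Proof. by apply/lfunP => z; rewrite scale_lfunE !adE lieZl. Qed.

Lemma ad_lie x y : ad (lie x y) = (ad x \o ad y)%VF - (ad y \o ad x)%VF.
Proof.
apply/lfunP => z; rewrite add_lfunE opp_lfunE !comp_lfunE !adE.
by rewrite (jacobi x y z) addrK.
Qed.

Lemma deriv_comm D x : deriv D -> ad (D x) = (D \o ad x)%VF - (ad x \o D)%VF.
Proof.
move=> dD; apply/lfunP => z; rewrite add_lfunE opp_lfunE !comp_lfunE !adE dD.
by rewrite addrK.
Qed.

Lemma derivB D D' : deriv D -> deriv D' -> deriv (D - D').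
Proof.
move=> dD dD' x y; rewrite !add_lfunE !opp_lfunE dD dD' lieBl lieBr opprD.
exact: addrACA.
Qed.

Lemma papp_toC_charpoly D (w : cpx R g) :
  papp (clin D) (toC (char_poly (emx D))) w = 0.
Proof.
rewrite [w]cpx_split linearD linearZ /= !papp_clin !papp_charpoly.
by rewrite [cinj 0](_ : _ = 0) // scaler0 addr0.
Qed.

(** On generalized eigenvectors for [l] and [n] the polynomial acts by [phi l] and [phi n], and on
    their bracket by [phi (l + n)]; additivity of [phi] is then the Leibniz rule. *)
Lemma deriv_interp D (phi : C -> C) m :
  deriv D -> {morph phi : a b / a + b} -> (forall z : C, phi (conjc z) = conjc (phi z)) ->
  exists q, [/\ 'X^m %| q, deriv (epapp q D) &
    forall l, root (toC (char_poly (emx D))) l ->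
      ('X - l%:P) ^+ size (char_poly (emx D)) %| toC q - (phi l)%:P].
Proof.
move=> dD phiD phiJ; have [rs [_ _ _ Hr]] := specP D.
set chi := char_poly (emx D) in Hr *.
(* Sums of eigenvalues are nodes too, since brackets have these weights and are killed with the
   added exponents; the node 0 makes ['X^m] divide [q]. *)
pose K := maxn m (size chi + size chi).
have [q Hq] := real_interp (0 :: rs ++ [seq a + b | a <- rs, b <- rs]) K phiJ.
have Hrs l : l \in rs -> ('X - l%:P) ^+ size chi %| toC q - (phi l)%:P.
  move=> ls; apply: dvdp_trans (Hq l _); last by rewrite inE mem_cat ls orbT.
  by apply: dvdp_exp2l; rewrite leq_max leq_addr orbT.
exists q; split; last by move=> l; rewrite Hr; apply: Hrs.
  have phi0 : phi 0 = 0 by apply: (addIr (phi 0)); rewrite -phiD !add0r.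
  have := Hq 0 (mem_head _ _); rewrite phi0 !subr0 => H.
  rewrite -(dvdp_map (real_complex R)) map_polyXn; apply: dvdp_trans H.
  by apply: dvdp_exp2l; rewrite leq_max leqnn.
have chi0 : toC chi != 0 by rewrite map_poly_eq0; apply/monic_neq0/char_poly_monic.
have szchi : size (toC chi) = size chi by rewrite size_map_poly.
pose br := cbil (@lie _ g).
have brDl (u u' v : cpx R g) : br (u + u') v = br u v + br u' v.
  exact: cbilDl (@lie_linearl R g) _ _ _.
have brDr (u v v' : cpx R g) : br u (v + v') = br u v + br u v'.
  exact: cbilDr (@lie_linearr R g) _ _ _.
have brZl (a : C) (u v : cpx R g) : br (a *: u) v = a *: br u v.
  exact: cbilZl (@lie_linearl R g) _ _ _.
have brZr (a : C) (u v : cpx R g) : br u (a *: v) = a *: br u v.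
  exact: cbilZr (@lie_linearr R g) _ _ _.
have brf (u v : cpx R g) : clin D (br u v) = br (clin D u) v + br u (clin D v).
  by congr (_, _); rewrite /= ?linearD ?linearN /= !dD ?opprD addrACA.
suff H (u v : cpx R g) : papp (clin D) (toC q) (br u v) =
    br (papp (clin D) (toC q) u) v + br u (papp (clin D) (toC q) v).
  move=> x y; have := H (cinj x) (cinj y).
  rewrite /br (cbil_inj (@lie_linearl R g) (@lie_linearr R g)) !papp_clin.
  rewrite !(cbil_inj (@lie_linearl R g) (@lie_linearr R g)) -cinjD !epappE.
  by case.
have b0l (w : cpx R g) : br 0 w = 0 by have := brZl 0 0 w; rewrite !scale0r.
have b0r (w : cpx R g) : br w 0 = 0 by have := brZr 0 w 0; rewrite !scale0r.
move: u (papp_toC_charpoly D u).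
apply: (geig_ind chi0) => [|u u' Hu Hu'|l u rl Hu]; first by rewrite linear0 !b0l linear0 addr0.
  by rewrite brDl !linearD /= Hu Hu' brDl brDl addrACA.
move: v (papp_toC_charpoly D v).
apply: (geig_ind chi0) => [|v v' Hv Hv'|n v rn Hv]; first by rewrite linear0 !b0r linear0 addr0.
  by rewrite brDr !linearD /= Hv Hv' brDr [in RHS]brDr addrACA.
rewrite szchi in Hu Hv; rewrite Hr in rl; rewrite Hr in rn.
rewrite (papp_eqC (Hrs l rl) Hu) (papp_eqC (Hrs n rn) Hv).
rewrite brZl brZr -scalerDl -phiD.
apply: (@papp_eqC _ _ _ (('X - (l + n)%:P) ^+ (size chi + size chi))).
  apply: dvdp_trans (Hq _ _); last by rewrite inE mem_cat allpairs_f ?orbT.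
  by apply: dvdp_exp2l; rewrite leq_max leqnn orbT.
exact: (geig_bil brDl brDr brZl brZr brf Hu Hv).
Qed.
End Derivations.

Section LieProd.
Variables (R : rcfType) (g : lieAlgType R).
Implicit Types (x y z u v w : g) (U V W h I : {vspace g}).

Lemma mem_lie_prod U V u v : u \in U -> v \in V -> lie u v \in lie_prod U V.
Proof.
move=> /coord_vbasis -> /coord_vbasis ->.
have lZl (I : finType) (c : I -> R) (e : I -> g) z :
    lie (\sum_i c i *: e i) z = \sum_i c i *: lie (e i) z.
  rewrite lieC linear_sum /= -sumrN; apply: eq_bigr => i _.
  by rewrite lieZr -scalerN -lieC.
rewrite lZl; apply: memv_suml => i _; apply: memvZ.
rewrite linear_sum; apply: memv_suml => j _ /=; rewrite lieZr; apply: memvZ.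
by apply: memv_span; apply: allpairs_f; rewrite mem_nth ?size_tuple.
Qed.

Lemma lie_prodP U V W :
  reflect (forall u v, u \in U -> v \in V -> lie u v \in W) (lie_prod U V <= W)%VS.
Proof.
apply: (iffP idP) => [/subvP H u v uU vV|H]; first exact/H/mem_lie_prod.
by apply/span_subvP => w /allpairsP[[u v] [/= uU vV ->]]; rewrite H ?vbasis_mem.
Qed.

Lemma lie_prod_ind U V (S : g -> Prop) :
  S 0 -> (forall a b, S a -> S b -> S (a + b)) -> (forall c a, S a -> S (c *: a)) ->
  (forall u v, u \in U -> v \in V -> S (lie u v)) ->
  forall w, w \in lie_prod U V -> S w.
Proof.
move=> S0 SD SZ SL w; rewrite /lie_prod => ws.
rewrite (coord_span (X := in_tuple _) ws); elim/big_ind: _ => // i _; apply: SZ.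
have /allpairsP[[u v] [/= uU vV ->]] :=
  mem_nth (0 : g) (ltn_ord i : i < size [seq lie u v | u <- vbasis U, v <- vbasis V])%N.
by apply: SL; apply: vbasis_mem.
Qed.

Lemma lie_prodC U V : lie_prod U V = lie_prod V U.
Proof.
apply/eqP; rewrite eqEsubv; apply/andP; split; apply/lie_prodP => u v uU vV;
  by rewrite lieC memvN mem_lie_prod.
Qed.

Lemma lie_idealP I h :
  reflect ((I <= h)%VS /\ forall x y, x \in h -> y \in I -> lie x y \in I) (lie_ideal I h).
Proof.
by apply: (iffP andP) => -[H1 H2]; split=> //; [move/lie_prodP: H2|apply/lie_prodP].
Qed.

Lemma lie_subalgP h :
  reflect (forall x y, x \in h -> y \in h -> lie x y \in h) (lie_subalgebra h).
Proof. exact: lie_prodP. Qed.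
End LieProd.

(** Dividing the components of (H - r) v by [r' - r] gives [b] with (H - r) b = (H - r) v, so
    [v - b] is an eigenvector for [r]. *)
Lemma split_ind (K : fieldType) (V : vectType K) (H : 'End(V)) (U : {vspace V})
    (rhos : seq K) (S : V -> Prop) : uniq rhos ->
  (forall u, u \in U -> H u \in U) ->
  S 0 -> (forall a b, S a -> S b -> S (a + b)) ->
  (forall rho u, rho \in rhos -> u \in U -> H u = rho *: u -> S u) ->
  forall v, v \in U -> papp H (\prod_(r <- rhos) ('X - r%:P)) v = 0 -> S v.
Proof.
move=> us HU; elim: rhos us S => [|r rs IH] /= us S S0 SD SE v vU.
  by rewrite big_nil papp1 => ->.
case/andP: us => rrs us; rewrite big_cons mulrC pappM => Hv.
set w := papp H ('X - r%:P) v in Hv.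
have wE : w = H v - r *: v by rewrite /w pappB pappX pappC.
pose T a := exists b, [/\ S b, b \in U & H b - r *: b = a].
have [] : T w.
  apply: (IH us T) Hv.
  - by exists 0; split; rewrite ?mem0v // linear0 scaler0 subrr.
  - move=> a a' [b [Sb bU <-]] [b' [Sb' bU' <-]]; exists (b + b'); split.
    + exact: SD.
    + exact: memvD.
    + by rewrite linearD scalerDr opprD addrACA.
  - move=> r' u r's uU Hu.
    have nz : r' - r != 0 by rewrite subr_eq0; apply: contraNneq rrs => <-.
    have HuZ : H ((r' - r)^-1 *: u) = r' *: ((r' - r)^-1 *: u).
      by rewrite linearZ /= Hu !scalerA mulrC.
    exists ((r' - r)^-1 *: u); split.
    + apply: (SE r'); rewrite ?inE ?r's ?orbT ?memvZ //.
    + exact: memvZ.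
    + by rewrite HuZ -scalerBl scalerA mulfV ?scale1r.
  - by rewrite wE; apply: memvB; rewrite ?HU ?memvZ.
move=> b [Sb bU Eb].
rewrite -(subrK b v); apply: SD => //; apply: (SE r); rewrite ?mem_head ?memvB //.
apply/eqP; rewrite -subr_eq0 linearB scalerBr /= opprB [r *: b - _]addrC addrACA.
by rewrite -wE [- H b + _]addrC -opprB Eb subrr.
Qed.

Section PappExtra.
Variables (K : fieldType) (V : vectType K).
Implicit Types (f : 'End(V)) (U : {vspace V}).

Lemma papp_comp (W : lmodType K) (f h : {linear W -> W}) p q :
  (forall v, h v = papp f q v) -> forall v, papp h p v = papp f (p \Po q) v.
Proof.
move=> hE; elim/poly_ind: p => [|p c IH] v.
  by rewrite comp_poly0 !papp0.
by rewrite comp_poly_MXaddC !pappD pappMX !pappC IH hE pappM.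
Qed.

Lemma papp_mem f U q v : (forall u, u \in U -> f u \in U) -> v \in U -> papp f q v \in U.
Proof.
move=> fU vU; apply: (papp_closed (S := fun w => w \in U)) => //.
- by move=> u w; apply: memvD.
- by move=> a u; apply: memvZ.
Qed.

Lemma papp_dvdXn f q m : 'X^m %| q -> exists r, forall v, 
  papp f q v = papp f r (iter m f v) /\ papp f q v = iter m f (papp f r v).
Proof.
move=> /dvdpP[r ->]; exists r => v; rewrite -!pappXn; split; first by rewrite pappM.
by rewrite mulrC pappM.
Qed.

Lemma papp_dvdX_mem f (U W : {vspace V}) q : 'X %| q ->
  (forall u, u \in U -> f u \in W) -> (forall u, u \in W -> f u \in W) ->
  forall v, v \in U -> papp f q v \in W.
Proof.
move=> /dvdpP[r ->] fU fW v vU; rewrite pappM pappX; apply: papp_mem => //; exact: fU.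
Qed.

Lemma papp_dvdX_ker f q v : 'X %| q -> f v = 0 -> papp f q v = 0.
Proof. by move=> /dvdpP[r ->] fv; rewrite pappM pappX /= fv linear0. Qed.

End PappExtra.

Section DerivParts.
Variables (R : rcfType) (g : lieAlgType R).
Local Notation C := R[i].
Local Notation toC := (map_poly (real_complex R)).
Implicit Types (D : 'End(g)).

Let dvd_horner (q : {poly R}) (l c : C) n : ('X - l%:P) ^+ n.+1 %| toC q - c%:P ->
  (toC q).[l] = c.
Proof.
move=> H; have : 'X - l%:P %| toC q - c%:P by apply: dvdp_trans H; rewrite exprS dvdp_mulr.
by rewrite dvdp_XsubCl /root hornerD hornerN hornerC subr_eq0 => /eqP.
Qed.

Let size_chi D : exists n, size (char_poly (emx D)) = n.+1.
Proof. by exists (\dim {:g}); rewrite size_char_poly. Qed.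

Lemma deriv_conj D : deriv D -> exists q, [/\ 'X %| q, deriv (epapp q D) &
  forall l, root (toC (char_poly (emx D))) l -> (toC q).[l] = conjc l].
Proof.
move=> dD; have [||q [Hm Hd Hq]] := @deriv_interp R g D (@conjc R) 1 dD.
- exact: rmorphD.
- by [].
exists q; split=> // l /Hq; have [n ->] := size_chi D; exact: dvd_horner.
Qed.

(** The hyperbolic part: it acts as the scalar [Re l] on the whole generalized eigenspace of [l],
    hence is diagonalizable over [R]. *)
Lemma deriv_hyp D : deriv D -> exists q, [/\ 'X %| q, deriv (epapp q D),
    forall l, root (toC (char_poly (emx D))) l -> (toC q).[l] = (complex.Re l)%:C
  & exists2 rhos : seq R, uniq rhos &
      forall v, papp (epapp q D) (\prod_(r <- rhos) ('X - r%:P)) v = 0].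
Proof.
move=> dD; have [||q [Hm Hd Hq]] := @deriv_interp R g D (fun z : C => (complex.Re z)%:C) 1 dD.
- by move=> a b /=; rewrite raddfD rmorphD.
- by case=> a b; rewrite /= oppr0.
exists q; split=> //.
  by move=> l /Hq; have [n ->] := size_chi D; exact: dvd_horner.
have [rs [_ _ _ Hr]] := specP D.
exists (undup (map (@complex.Re R) rs)); first exact: undup_uniq.
set h := \prod_(r <- _) _ => v.
rewrite (@papp_comp _ _ D _ h q) => [|u]; last exact: epappE.
suff H (w : cpx R g) : papp (clin D) (toC (h \Po q)) w = 0.
  by have := H (cinj v); rewrite papp_clin => -[].
have chi0 : toC (char_poly (emx D)) != 0 by rewrite map_poly_eq0; apply/monic_neq0/char_poly_monic.
move: w (papp_toC_charpoly D w); apply: (geig_ind chi0) => [|u u' Hu Hu'|l u rl Hu].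
- exact: linear0.
- by rewrite linearD /= Hu Hu' addr0.
apply: papp_dvd Hu; rewrite size_map_poly; apply: dvdp_trans (Hq l rl) _.
rewrite map_comp_poly.
have -> : toC q - ((complex.Re l)%:C)%:P = ('X - ((complex.Re l)%:C)%:P) \Po toC q.
  by rewrite comp_polyB comp_polyX comp_polyC.
apply: dvdp_comp_poly; rewrite dvdp_XsubCl.
rewrite fmorph_root /h root_prod_XsubC mem_undup; apply: map_f.
by rewrite -Hr.
Qed.

(** [epapp q D] is the semisimple Jordan part. Divisibility by ['X^m] makes it vanish on the kernel
    of D^m, where the nilpotent part therefore equals [D]. *)
Lemma deriv_nil D m : deriv D -> exists q, [/\ 'X^m %| q, deriv (D - epapp q D),
    nilp (D - epapp q D)
  & forall l, root (toC (char_poly (emx D))) l ->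
      ('X - l%:P) ^+ size (char_poly (emx D)) %| toC q - l%:P].
Proof.
move=> dD; have [||q [Hm Hd Hq]] := @deriv_interp R g D idfun m dD => //.
exists q; split=> //; first exact: derivB.
have [rs [_ _ H3 Hr]] := specP D.
apply/nilpP; exists (size rs); apply/lfunP => v; rewrite epappE.
rewrite (@papp_comp _ _ D _ 'X^(size rs) ('X - q)) => [|u]; last first.
  by rewrite pappB pappX /= add_lfunE opp_lfunE epappE.
rewrite comp_Xn_poly -epappE H3 // => l ls.
have := Hq l; rewrite Hr => /(_ ls); have [n ->] := size_chi D => /dvd_horner ql.
by rewrite rmorphB /= map_polyX /root hornerD hornerN hornerX ql subrr.
Qed.

(** As [rho *: ad w] is the commutator of [H] and [ad w], every positive power of [ad w] is a
    commutator up to the factor [rho], so its trace is 0. *)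
Lemma deriv_eigen_nilp (H : 'End(g)) (w : g) (rho : R) :
  deriv H -> H w = rho *: w -> rho != 0 -> nilp (ad w).
Proof.
move=> dH Hw r0; apply: etr_pow_nilp => -[//|k] _.
have E : rho *: epapp 'X^(k.+1) (ad w) =
   ((H \o ad w) \o epapp 'X^k (ad w))%VF - ((ad w \o H) \o epapp 'X^k (ad w))%VF.
  apply/lfunP => v; rewrite add_lfunE opp_lfunE scale_lfunE exprS epappM epappX.
  rewrite !comp_lfunE; set u := epapp _ _ v.
  have := deriv_comm w dH; rewrite Hw adZ => /lfunP/(_ u).
  by rewrite scale_lfunE add_lfunE opp_lfunE !comp_lfunE.
have cm : (epapp 'X^k (ad w) \o ad w = ad w \o epapp 'X^k (ad w))%VF by exact: epapp_comm.
have := congr1 (@etr _ _) E; rewrite linearB linearZ /=.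
have -> : etr ((ad w \o H) \o epapp 'X^k (ad w))%VF = etr ((H \o ad w) \o epapp 'X^k (ad w))%VF.
  by rewrite -[in LHS]comp_lfunA [LHS]etrC -[in LHS]comp_lfunA cm comp_lfunA.
rewrite subrr => /eqP; rewrite -[_ *: _]/(_ * _).
by rewrite mulf_eq0 (negPf r0) /= => /eqP.
Qed.
End DerivParts.

(** * Bilinear forms and trace forms *)

Section BilinForms.
Variables (K : fieldType) (V : vectType K) (Q : V -> V -> K).
Hypotheses (Ql : forall v, scalar (Q^~ v)) (Qr : forall u, scalar (Q u)).
Implicit Types (U W : {vspace V}).

Lemma formDl u u' v : Q (u + u') v = Q u v + Q u' v.
Proof. by have := Ql v 1 u u'; rewrite scale1r mul1r. Qed.
Lemma formDr u v v' : Q u (v + v') = Q u v + Q u v'.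
Proof. by have := Qr u 1 v v'; rewrite scale1r mul1r. Qed.
Lemma form0l v : Q 0 v = 0.
Proof. by apply: (addIr (Q 0 v)); rewrite -formDl !add0r. Qed.
Lemma form0r u : Q u 0 = 0.
Proof. by apply: (addIr (Q u 0)); rewrite -formDr !add0r. Qed.
Lemma formZl a u v : Q (a *: u) v = a * Q u v.
Proof. by have := Ql v a u 0; rewrite form0l !addr0. Qed.
Lemma formZr a u v : Q u (a *: v) = a * Q u v.
Proof. by have := Qr u a v 0; rewrite form0r !addr0. Qed.
Lemma formNl u v : Q (- u) v = - Q u v.
Proof. by rewrite -scaleN1r formZl mulN1r. Qed.
Lemma formNr u v : Q u (- v) = - Q u v.
Proof. by rewrite -scaleN1r formZr mulN1r. Qed.
Lemma formBl u u' v : Q (u - u') v = Q u v - Q u' v.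
Proof. by rewrite formDl formNl. Qed.

Definition perp W U : {vspace V} :=
  (W :&: \bigcap_(i < \dim U) lker (linfun (fun v => Q v (vbasis U)`_i : K^o)))%VS.

Lemma perpP W U v : reflect (v \in W /\ forall u, u \in U -> Q v u = 0) (v \in perp W U).
Proof.
have lin u : linear (fun v => Q v u : K^o) by exact: Ql.
have E u w : (linfun (fun v => Q v u : K^o)) w = Q w u.
  pose h : {linear V -> K^o} := HB.pack (fun v => Q v u : K^o) (GRing.isLinear.Build _ _ _ _ _ (lin u)).
  by rewrite -[X in X w]/(linfun h : V -> K^o) lfunE.
rewrite memv_cap; apply: (iffP andP) => -[vW H]; split=> //.
  move=> u /coord_vbasis ->.
  have : forall i : 'I_(\dim U), Q v (vbasis U)`_i = 0.
    move=> i; have /subv_bigcapP/(_ i isT) : (<[v]> <= \bigcap_(i < \dim U)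
      lker (linfun (fun v => Q v (vbasis U)`_i : K^o)))%VS by rewrite -memvE.
    by rewrite -memvE memv_ker E => /eqP.
  move=> Q0; elim/big_rec: _ => [|i x _ IH]; first exact: form0r.
  by rewrite formDr formZr Q0 mulr0 add0r.
rewrite memvE; apply/subv_bigcapP => i _; rewrite -memvE memv_ker E.
by apply/eqP/H/vbasis_mem/mem_nth; rewrite size_tuple.
Qed.

Lemma dim_perp W U : (\dim W <= \dim (perp W U) + \dim U)%N.
Proof.
have lin : linear (fun v => \row_(i < \dim U) Q v (vbasis U)`_i).
  by move=> a u v; apply/rowP => i; rewrite !mxE formDl formZl.
pose h : {linear V -> 'rV[K]_(\dim U)} := HB.pack (fun v => \row_(i < \dim U) Q v (vbasis U)`_i) (GRing.isLinear.Build _ _ _ _ _ lin).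
rewrite -(limg_ker_dim (linfun h) W); apply: leq_add; last first.
  by apply: leq_trans (dimvS (subvf _)) _; rewrite dimvf /dim /= mul1n.
apply/dimvS/subvP => v; rewrite memv_cap => /andP[vW]; rewrite memv_ker lfunE => /eqP /= /rowP H.
apply/perpP; split=> // u /coord_vbasis ->.
elim/big_rec: _ => [|i x _ IH]; first exact: form0r.
by rewrite formDr formZr IH; have := H i; rewrite !mxE => ->; rewrite mulr0 addr0.
Qed.

Lemma perp_ex W U : (\dim U < \dim W)%N -> exists v, [/\ v \in W, v != 0
  & forall u, u \in U -> Q v u = 0].
Proof.
move=> lt; have := dim_perp W U; have [->|nz] := eqVneq (perp W U) 0%VS.
  by rewrite dimv0 add0n leqNgt lt.
move=> _; have := vpick0 (perp W U); set v := vpick _ => v0.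
have /perpP[vW H] := memv_pick (perp W U).
by exists v; split=> //; rewrite v0.
Qed.

Definition aniso U := forall u, u \in U -> Q u u = 0 -> u = 0.

(** If N (N u) = 0 then Q (N u) (N u) = - Q u (N (N u)) = 0 and anisotropy gives N u = 0; so the
    nilpotency index drops to 1. *)
Lemma skew_nilp_aniso U (N : 'End(V)) n : aniso U -> 
  (forall u, u \in U -> N u \in U) ->
  (forall u v, u \in U -> v \in U -> Q (N u) v = - Q u (N v)) ->
  (forall u, u \in U -> iter n N u = 0) -> forall u, u \in U -> N u = 0.
Proof.
move=> aU NU sk Hn; have N2 u : u \in U -> N (N u) = 0 -> N u = 0.
  move=> uU Nu; apply: aU; rewrite ?NU // sk ?NU // Nu form0r oppr0 //.
elim: n Hn => [|n IH] Hn u uU; first by rewrite [u]Hn // linear0.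
case: n IH Hn => [|n] IH Hn; first exact: Hn.
apply: IH => // w wU; rewrite iterS; apply: N2; last by rewrite -!iterS Hn.
by elim: n {Hn} => //= j; apply: NU.
Qed.

(** Gram-Schmidt without normalisation, so that definite forms of either sign are covered. *)
Lemma orth_basis U : aniso U -> {in U &, forall u v, Q u v = Q v u} ->
  exists e : seq V, [/\ uniq e, {subset e <= U}, (forall a, a \in e -> Q a a != 0),
    (forall a b, a \in e -> b \in e -> a != b -> Q a b = 0)
  & forall x, x \in U -> x = \sum_(a <- e) (Q x a / Q a a) *: a].
Proof.
move=> aU Qs; have [n Hn] : exists n, (\dim U <= n)%N by exists (\dim U).
elim: n U Hn aU Qs => [|n IH] U Hn aU Qs.
  exists [::]; split=> // x; rewrite big_nil.
  by move: Hn; rewrite leqn0 dimv_eq0 => /eqP ->; rewrite memv0 => /eqP.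
have [->|U0] := eqVneq U 0%VS.
  by exists [::]; split=> // x; rewrite big_nil memv0 => /eqP.
set u := vpick U; have u0 : u != 0 by rewrite vpick0.
have uU : u \in U := memv_pick U.
have Quu : Q u u != 0 by apply: contra_neq u0 => /(aU u uU).
pose U' := perp U <[u]>.
have U'P x : reflect (x \in U /\ Q x u = 0) (x \in U').
  apply: (iffP (perpP _ _ _)) => -[xU H]; split=> //; first by apply: H; apply: memv_line.
  by move=> _ /vlineP[k ->]; rewrite formZr H mulr0.
have U'U : (U' <= U)%VS by apply/subvP => x /U'P[].
have [|x xU'|x y xU' yU'|e [ue eU nz orth dec]] := IH U'.
- rewrite -ltnS; apply: leq_trans Hn; rewrite ltn_neqAle dimvS // andbT.
  apply: contra_neq Quu => eqd; have /eqP eqU : U' == U by rewrite eqEdim U'U eqd leqnn.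
  by have := uU; rewrite -eqU => /U'P[].
- by apply: aU; have /U'P[] := xU'.
- by apply: Qs; apply: (subvP U'U).
have uNe : u \notin e by apply: contra Quu => /eU /U'P[_ ->].
exists (u :: e); split.
- by rewrite /= uNe.
- by move=> x; rewrite inE => /orP[/eqP -> //|/eU /U'P[]].
- by move=> x; rewrite inE => /orP[/eqP -> //|/nz].
- move=> a b; rewrite !inE => /orP[/eqP ->|ae] /orP[/eqP ->|be]; rewrite ?eqxx // => ab.
  + by have /U'P[bU] := eU _ be; rewrite Qs.
  + by have /U'P[] := eU _ ae.
  + exact: orth.
move=> x xU; rewrite big_cons -[x in LHS](subrK ((Q x u / Q u u) *: u)) addrC; congr (_ + _).
have xU' : x - (Q x u / Q u u) *: u \in U'.
  by apply/U'P; split; rewrite ?memvB ?memvZ // formBl formZl divfK // subrr.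
rewrite [LHS]dec // !big_seq; apply: eq_bigr => a ae; congr (_ / _ *: _).
by have /U'P[aU' Ha] := eU _ ae; rewrite formBl formZl [Q u a]Qs // Ha mulr0 subr0.
Qed.
End BilinForms.

Section TraceForm.
Variables (R : rcfType) (g : lieAlgType R).
Local Notation C := R[i].
Local Notation toC := (map_poly (real_complex R)).
Implicit Types (x y z : g) (D : 'End(g)) (U h : {vspace g}).

Definition stab U D := forall u, u \in U -> D u \in U.

Lemma etr_stab U (X Y : 'End(g)) : stab U X -> stab U Y ->
  etr (X \o (Y \o projv U))%VF = etr (Y \o (X \o projv U))%VF.
Proof.
move=> sX sY; have pP (Z : 'End(g)) : stab U Z -> (Z \o projv U = projv U \o (Z \o projv U))%VF.
  by move=> sZ; apply/lfunP => v; rewrite !comp_lfunE [RHS]projv_id // sZ // memv_proj.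
by rewrite (pP Y sY) [in LHS]comp_lfunA [LHS]etrC -[in LHS]comp_lfunA -(pP X sX).
Qed.

(** The projector restricts the trace to [U] while keeping bilinearity on all of [g]. For [fullv]
    this is the Killing form of [g]; for a subalgebra it extends [killing]. *)
Definition tform U x y : R := etr (ad x \o (ad y \o projv U))%VF.

Lemma tform_linl U y : scalar (tform U ^~ y).
Proof.
by move=> a x x'; rewrite /tform adD adZ comp_lfunDl -comp_lfunZl linearP.
Qed.
Lemma tform_linr U x : scalar (tform U x).
Proof.
by move=> a y y'; rewrite /tform adD adZ comp_lfunDl comp_lfunDr -comp_lfunZl -comp_lfunZr linearP.
Qed.

Lemma tformC U x y : stab U (ad x) -> stab U (ad y) -> tform U x y = tform U y x.
Proof. exact: etr_stab. Qed.

Lemma killingE h x y : lie_subalgebra h -> x \in h -> y \in h ->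
  killing h x y = tform h x y.
Proof.
move=> /lie_subalgP sh xh yh; rewrite /tform (@etr_limg _ _ h) => [|v]; last first.
  by rewrite !comp_lfunE !adE sh // sh // memv_proj.
apply: eq_bigr => i _; rewrite !comp_lfunE !adE projv_id //.
by apply/vbasis_mem/mem_nth; rewrite size_tuple.
Qed.

Lemma tform_deriv U D x y : deriv D -> stab U D -> stab U (ad x) -> stab U (ad y) ->
  tform U (D x) y = - tform U x (D y).
Proof.
move=> dD sD sx sy; rewrite /tform !deriv_comm // !comp_lfunDl !comp_lfunNl comp_lfunDr comp_lfunNr.
rewrite !linearB /= opprK [RHS]addrC -!comp_lfunA; congr (_ - _).
have := @etr_stab U D (ad x \o ad y)%VF; rewrite -!comp_lfunA; apply=> //.
by move=> u uU; rewrite comp_lfunE; apply/sx/sy.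
Qed.

(** [H] commutes with [ad b] for [b] in [U], so its trace against a commutator of [ad a] and [ad b]
    vanishes. *)
Lemma etr_hyp0 U (H : 'End(g)) u : deriv H -> (forall v, v \in U -> H v = 0) ->
  u \in lie_prod U U -> etr (ad u \o H)%VF = 0.
Proof.
move=> dH H0; move: u; apply: lie_prod_ind => [|a b Ha Hb|c a Ha|a b aU bU].
- by rewrite (_ : ad 0 = 0) ?comp_lfun0l ?linear0 //; apply/lfunP => v; rewrite adE lie0l lfunE.
- by rewrite adD comp_lfunDl linearD /= Ha Hb addr0.
- by rewrite adZ -comp_lfunZl linearZ /= Ha; exact: mulr0.
rewrite ad_lie comp_lfunDl comp_lfunNl linearB /= -!comp_lfunA.
have cm : (ad b \o H = H \o ad b)%VF.
  have := deriv_comm b dH; rewrite H0 // (_ : ad 0 = 0).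
    by move/esym/eqP; rewrite subr_eq0 => /eqP.
  by apply/lfunP => v; rewrite adE lie0l lfunE.
by rewrite cm [in X in X - _]comp_lfunA [X in X - _]etrC subrr.
Qed.

Lemma imspec_tform U u : stab U (ad u) -> imspec (ad u) -> tform U u u <= 0 /\
  (tform U u u = 0 -> exists n, forall v, v \in U -> iter n (ad u) v = 0).
Proof.
move=> su im; pose T := (ad u \o projv U)%VF.
have PT : (projv U \o T = T)%VF.
  by apply/lfunP => v; rewrite !comp_lfunE [LHS]projv_id // su // memv_proj.
have imT : imspec T by apply: imspec_comp.
have TE : tform U u u = etr (T \o T)%VF.
  by rewrite /tform -/T -{1}PT comp_lfunA.
have [le0 eq0] := imspec_etr imT; rewrite TE; split=> // /eq0[n Hn]; exists n => v vU.
rewrite -[RHS](Hn v); have : iter n T v = iter n (ad u) v /\ iter n (ad u) v \in U.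
  elim: n {Hn} => [|n [IH1 IH2]] //=; split; last exact: su.
  by rewrite IH1 comp_lfunE projv_id.
by case=> ->.
Qed.
End TraceForm.

(** * Engel's theorem and Cartan's criterion *)

Section Engel.
Variables (R : rcfType) (g : lieAlgType R).
Implicit Types (x y z u v w : g) (U J h I : {vspace g}).

(** A proper subalgebra of maximal dimension, enlarged by an outside element normalizing it, must be
    all of [J]. *)
Lemma codim1_subalg J : lie_subalgebra J -> J != 0%VS ->
  (forall J0, lie_subalgebra J0 -> (J0 <= J)%VS -> (\dim J0 < \dim J)%N ->
     exists y, [/\ y \in J, y \notin J0 & forall z, z \in J0 -> lie z y \in J0]) ->
  exists J0 y, [/\ lie_subalgebra J0, (J0 <= J)%VS, (\dim J0 < \dim J)%N, y \in J &
    (forall z, z \in J0 -> lie z y \in J0) /\ J = (J0 + <[y]>)%VS].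
Proof.
move=> sJ J0 H.
pose P k := `[< exists J0, [/\ lie_subalgebra J0, (J0 <= J)%VS, (\dim J0 < \dim J)%N & \dim J0 = k] >].
have exP : exists k, P k.
  exists 0%N; apply/asboolP; exists 0%VS; split; rewrite ?sub0v ?dimv0 ?lt0n ?dimv_eq0 //.
  by apply/lie_subalgP => x y; rewrite memv0 => /eqP -> _; rewrite lie0l mem0v.
have ubP k : P k -> (k <= \dim J)%N by move=> /asboolP[J1 [_ _ /ltnW lt <-]].
have [k /asboolP[J1 [s1 sub1 lt1 dk]] maxk] := ex_maxnP exP ubP.
have [y [yJ yJ1 Hy]] := H J1 s1 sub1 lt1.
exists J1, y; split=> //; split=> //.
have subJ : (J1 + <[y]> <= J)%VS by rewrite subv_add sub1 -memvE.
apply/esym/eqP; rewrite eqEdim subJ leqNgt; apply/negP => lt.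
have : P (\dim (J1 + <[y]>)).
  apply/asboolP; exists (J1 + <[y]>)%VS; split=> //.
  apply/lie_subalgP => a b /memv_addP[a1 a1J [_ /vlineP[c ->] ->]].
  move=> /memv_addP[b1 b1J [_ /vlineP[d ->] ->]].
  rewrite lieDl !lieDr !lieZl !lieZr liexx !scaler0 addr0.
  have sJ1 := lie_subalgP _ s1.
  apply: (subvP (addvSl _ _)); apply: memvD.
    by apply: memvD; [apply: sJ1|apply/memvZ/Hy].
  by apply: memvZ; rewrite lieC memvN Hy.
move=> /maxk; rewrite -dk leqNgt => /negP; apply.
rewrite ltn_neqAle dimvS ?addvSl // andbT; apply: contra yJ1 => /eqP ed.
suff -> : J1 = (J1 + <[y]>)%VS by apply: (subvP (addvSr _ _)); rewrite memv_line.
by apply/eqP; rewrite eqEdim addvSl ed leqnn.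
Qed.

(** Engel's theorem for the quotient of [U] by [U'], with a pair of stable subspaces in place of the
    quotient. *)
Lemma engel J : lie_subalgebra J -> (forall z, z \in J -> nilp (ad z)) ->
  forall U' U, (U' <= U)%VS -> (\dim U' < \dim U)%N ->
  (forall z, z \in J -> stab U (ad z) /\ stab U' (ad z)) ->
  exists u, [/\ u \in U, u \notin U' & forall z, z \in J -> lie z u \in U'].
Proof.
have [n Hn] : exists n, (\dim J <= n)%N by exists (\dim J).
elim: n J Hn => [|n IH] J Hn sJ nJ U' U sub lt st.
all: have [u0 u0U u0U'] : exists2 u, u \in U & u \notin U' by
  (apply/subvPn; apply/negP => sub'; move: lt; rewrite ltnNge dimvS).
  exists u0; split=> // z; move: Hn; rewrite leqn0 dimv_eq0 => /eqP ->.
  by rewrite memv0 => /eqP ->; rewrite lie0l mem0v.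
have [J0|J0] := eqVneq J 0%VS.
  exists u0; split=> // z; rewrite J0.
  by rewrite memv0 => /eqP ->; rewrite lie0l mem0v.
have [|J1 [y [s1 sub1 lt1 yJ [Hy JE]]]] := codim1_subalg sJ J0.
  move=> J1 s1 sub1 lt1; apply: IH => //.
  - by rewrite -ltnS; apply: leq_trans lt1 Hn.
  - by move=> z /(subvP sub1); apply: nJ.
  - move=> z z1; split=> w wJ; rewrite adE; last exact: (lie_subalgP _ s1).
    by apply: (lie_subalgP _ sJ) => //; apply: (subvP sub1).
have [|||u1 [u1U u1U' Hu1]] := IH J1 _ s1 _ U' U sub lt.
- by rewrite -ltnS; apply: leq_trans lt1 Hn.
- by move=> z /(subvP sub1); apply: nJ.
- by move=> z /(subvP sub1); apply: st.
have [styU styU'] := st y yJ.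
have Hit k : iter k (ad y) u1 \in U /\ forall z, z \in J1 -> lie z (iter k (ad y) u1) \in U'.
  elim: k => [|k [IH1 IH2]] //=; split; first exact: styU.
  move=> z zJ; rewrite adE jacobi; apply: memvD; first exact/IH2/Hy.
  by rewrite -adE; apply/styU'/IH2.
have [m Hm] := nJ y yJ.
(* The last iterate of [u1] under [ad y] outside [U'] is killed modulo [U'] by [y] as well as by
   [J1]. *)
have ex : exists k, iter k (ad y) u1 \in U' by exists m; rewrite Hm mem0v.
have := ex_minnP ex; case=> -[|k] Hk mink; first by rewrite Hk in u1U'.
exists (iter k (ad y) u1); have [Hk1 Hk2] := Hit k; split=> //.
  by apply/negP => /mink; rewrite ltnn.
move=> z; rewrite JE => /memv_addP[z1 z1J [_ /vlineP[c ->] ->]].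
rewrite lieDl lieZl; apply: memvD; first exact: Hk2.
by apply: memvZ; rewrite -adE.
Qed.

(** [lie_prod J J] lies in a subalgebra of codimension one, so the induction on dimension applies to
    it. *)
Lemma engel_solvable J : lie_subalgebra J -> (forall z, z \in J -> nilp (ad z)) ->
  lie_solvable J.
Proof.
have [n Hn] : exists n, (\dim J <= n)%N by exists (\dim J).
elim: n J Hn => [|n IH] J Hn sJ nJ.
  by exists 0%N; apply/eqP; rewrite -dimv_eq0 -leqn0.
have [J0|J0] := eqVneq J 0%VS; first by exists 0%N.
have [|J1 [y [s1 sub1 lt1 yJ [Hy JE]]]] := codim1_subalg sJ J0.
  move=> J1 s1 sub1 lt1; apply: (engel (J := J1)) => //.
  - by move=> z /(subvP sub1); apply: nJ.
  - move=> z z1; split=> w wJ; rewrite adE; last exact: (lie_subalgP _ s1).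
    by apply: (lie_subalgP _ sJ) => //; apply: (subvP sub1).
have subJ1 : (lie_prod J J <= J1)%VS.
  apply/lie_prodP => a b; rewrite JE => /memv_addP[a1 a1J [_ /vlineP[c ->] ->]].
  move=> /memv_addP[b1 b1J [_ /vlineP[d ->] ->]].
  rewrite lieDl !lieDr !lieZl !lieZr liexx !scaler0 addr0.
  have sJ1 := lie_subalgP _ s1.
  apply: memvD; first by apply: memvD; [apply: sJ1|apply/memvZ/Hy].
  by apply: memvZ; rewrite lieC memvN Hy.
have [|||m Hm] := IH (lie_prod J J).
- by rewrite -ltnS; apply: leq_trans Hn; apply: leq_ltn_trans (dimvS subJ1) lt1.
- by apply/lie_subalgP => x y' xJ yJ'; apply: mem_lie_prod; apply: (subvP sJ).
- by move=> z /(subvP sJ); apply: nJ.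
by exists m.+1; rewrite /lie_derived iterSr.
Qed.
End Engel.

Section Cartan.
Variables (R : rcfType) (g : lieAlgType R).
Implicit Types (x y z u v w : g) (U J h I : {vspace g}).

Lemma lie_centerP h v : reflect (v \in h /\ forall u, u \in h -> lie u v = 0) (v \in lie_center h).
Proof.
rewrite memv_cap; apply: (iffP andP) => -[vh H]; split=> //.
  move=> u /coord_vbasis ->; rewrite lieC linear_sum /= big1 ?oppr0 // => i _.
  rewrite linearZ /= lieC.
  have /subv_bigcapP/(_ i isT) : (<[v]> <= \bigcap_(i < \dim h)
      lker (ad (vbasis h)`_i))%VS by rewrite -memvE.
  by rewrite -memvE memv_ker adE => /eqP ->; rewrite oppr0 scaler0.
rewrite memvE; apply/subv_bigcapP => i _; rewrite -memvE memv_ker adE.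
by apply/eqP/H/vbasis_mem/mem_nth; rewrite size_tuple.
Qed.

Lemma semisimple_center h v : lie_semisimple h -> v \in h ->
  (forall u, u \in h -> lie u v = 0) -> v = 0.
Proof.
move=> [sh H] vh Hv; suff E : lie_center h = 0%VS.
  by apply/eqP; rewrite -memv0 -E; apply/lie_centerP.
apply: H.
  apply/lie_idealP; split; first exact: capvSl.
  move=> x y xh /lie_centerP[yh Hy]; rewrite Hy //; exact: mem0v.
exists 1%N; apply/eqP; rewrite -subv0; apply/lie_prodP => a b /lie_centerP[ah _].
by move=> /lie_centerP[_ Hb]; rewrite Hb // mem0v.
Qed.

(** Otherwise some nonzero [v] in [h] is orthogonal to all brackets; invariance makes [lie u v]
    orthogonal to [h], hence 0, and [v] is central. *)
Lemma perfect_of_form h (Q : g -> g -> R) : 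
  (forall v, scalar (Q^~ v)) -> (forall u, scalar (Q u)) ->
  lie_subalgebra h ->
  (forall x y z, x \in h -> y \in h -> z \in h -> Q (lie x y) z = - Q y (lie x z)) ->
  (forall x, x \in h -> (forall y, y \in h -> Q x y = 0) -> x = 0) ->
  (forall v, v \in h -> (forall u, u \in h -> lie u v = 0) -> v = 0) ->
  lie_prod h h = h.
Proof.
move=> Ql Qr sh inv nd ct; have sub : (lie_prod h h <= h)%VS := sh.
apply/eqP; rewrite eqEdim sub leqNgt; apply/negP => lt.
have [v [vh v0 Hv]] := perp_ex Ql Qr lt.
move/negP: v0; apply; apply/eqP/ct => // u uh; apply: nd => [|w wh].
  exact: (lie_subalgP _ sh).
by rewrite inv // Hv ?oppr0 // mem_lie_prod.
Qed.

Let stabf D : stab (fullv : {vspace g}) D. Proof. by move=> u _; apply: memvf. Qed.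

Lemma tform_inv x y z : tform fullv (lie x y) z = - tform fullv y (lie x z).
Proof. by rewrite -!adE; apply: tform_deriv => //; apply: deriv_ad. Qed.

Lemma tformfE x y : tform fullv x y = etr (ad x \o ad y)%VF.
Proof.
rewrite /tform; congr etr; congr (_ \o _)%VF; apply/lfunP => v.
by rewrite comp_lfunE projv_id ?memvf.
Qed.

(** Cartan's criterion for the Killing form of the ambient [g]. On brackets [z] of the radical [I]
    of the form on [h], the interpolated conjugate of [ad z] has zero trace against [ad z]; so
    [ad z] is nilpotent, and Engel makes [I] solvable. *)
Lemma semisimple_nondeg h x : lie_semisimple h -> x \in h ->
  (forall y, y \in h -> tform fullv x y = 0) -> x = 0.
Proof.
move=> [sh ss] xh Hx; have sh' := lie_subalgP _ sh.
pose I := perp (tform (fullv : {vspace g})) h h.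
have IP v : reflect (v \in h /\ forall u, u \in h -> tform fullv v u = 0) (v \in I).
  by apply: perpP; [apply: tform_linl|apply: tform_linr].
suff I0 : I = 0%VS by apply/eqP; rewrite -memv0 -I0; apply/IP.
have idI : lie_ideal I h.
  apply/lie_idealP; split=> [|u v uh /IP[vh Hv]]; first by apply/subvP => v /IP[].
  apply/IP; split=> [|w wh]; first exact: sh'.
  by rewrite tform_inv Hv ?oppr0 // sh'.
apply: ss => //; have [Ih /= cI] := lie_idealP _ _ idI.
have sI : (lie_prod I I <= I)%VS.
  by apply/lie_prodP => a b /(subvP Ih) ah bI; apply: cI.
have [||n Hn] := @engel_solvable R g (lie_prod I I).
- by apply/lie_subalgP => a b aI bI; apply: mem_lie_prod; apply: (subvP sI).
- move=> z zI; have zh : z \in h by apply/(subvP Ih)/(subvP sI).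
  have [q [qX dq Hq]] := deriv_conj (deriv_ad z).
  apply: (spec_conj_nilp Hq); set D := epapp q (ad z) in dq *.
  have Dh b : b \in h -> D b \in h.
    move=> bh; rewrite epappE; apply: (papp_dvdX_mem (U := h)) => // u uh;
    by rewrite adE sh'.
  move: zI; move: {1 2}z; apply: lie_prod_ind => [|a b Ha Hb|c a Ha|a b aI bI].
  + by rewrite (_ : ad 0 = 0) ?comp_lfun0l ?linear0 //; apply/lfunP => v; rewrite adE lie0l lfunE.
  + by rewrite adD comp_lfunDl linearD /= Ha Hb addr0.
  + by rewrite adZ -comp_lfunZl linearZ /= Ha; exact: mulr0.
  have /IP[ah Ha] := aI; have /IP[bh Hb] := bI.
  (* Cyclicity turns this trace, up to sign, into the form at [a] and [D b]; [D b] stays in [h], to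
     which [a] is orthogonal. *)
  rewrite ad_lie comp_lfunDl comp_lfunNl linearB /= -!comp_lfunA.
  rewrite [X in _ - X]etrC -[in X in _ - X]comp_lfunA -linearB /=.
  rewrite -comp_lfunNr -comp_lfunDr -opprB -deriv_comm // comp_lfunNr linearN /=.
  by rewrite -tformfE Ha ?oppr0 // Dh.
by exists n.+1; rewrite /lie_derived iterSr.
Qed.

Lemma semisimple_perfect h : lie_semisimple h -> lie_prod h h = h.
Proof.
move=> ss; apply: (@perfect_of_form h (tform fullv)).
- exact: tform_linl.
- exact: tform_linr.
- by case: ss.
- by move=> x y z _ _ _; apply: tform_inv.
- by move=> x; apply: semisimple_nondeg.
- by move=> v; apply: semisimple_center.
Qed.
End Cartan.

(** For dimension reasons some nonzero [w] in [U + <[u]>] is orthogonal to a complement of [P] in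
    [W]; being orthogonal to [P] too, it would lie in the radical of the form on [W]. *)
Lemma perp_perp (K : fieldType) (V : vectType K) (Q : V -> V -> K) (W U : {vspace V}) u :
  (forall v, scalar (Q^~ v)) -> (forall u, scalar (Q u)) -> (forall u v, Q u v = Q v u) ->
  (forall x, x \in W -> (forall y, y \in W -> Q x y = 0) -> x = 0) ->
  (U <= W)%VS -> u \in W -> (forall v, v \in perp Q W U -> Q v u = 0) -> u \in U.
Proof.
move=> Ql Qr Qs nd UW uW Hu; apply/negPn/negP => uU.
have lt : (\dim U < \dim (U + <[u]>))%N.
  rewrite ltn_neqAle dimvS ?addvSl // andbT; apply: contra uU => /eqP ed.
  have -> : U = (U + <[u]>)%VS by apply/eqP; rewrite eqEdim addvSl ed leqnn.
  by apply: (subvP (addvSr _ _)); rewrite memv_line.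
set P := perp Q W U; have PW : (P <= W)%VS := capvSl _ _.
have dW : (\dim (W :\: P) <= \dim U)%N.
  have := dimv_cap_compl W P; rewrite (capv_idPr PW) => e.
  by rewrite -(leq_add2l (\dim P)) e; apply: dim_perp.
have [w [wU w0 Hw]] := perp_ex Ql Qr (leq_ltn_trans dW lt).
have wW : w \in W.
  by apply: subvP wU; rewrite subv_add UW -memvE.
move/negP: w0; apply; apply/eqP/nd => // y yW.
have : y \in (W :\: P + P)%VS by rewrite addv_diff (addv_idPl PW).
move=> /memv_addP[a aW [b bP ->]]; rewrite (formDr Qr) Hw // add0r Qs.
move: wU => /memv_addP[a' a'U [_ /vlineP[t ->] ->]].
have [bW Hb] := perpP Ql Qr _ _ _ bP.
by rewrite (formDr Qr) (formZr Qr) Hb // Hu // mulr0 addr0.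
Qed.

Lemma nilp_comp (R : rcfType) (V : vectType R) (f h : 'End(V)) :
  (f \o h = h \o f)%VF -> nilp f -> nilp (f \o h)%VF.
Proof.
move=> /lfunP cm [n Hn]; exists n => v.
have comm k w : h (iter k f w) = iter k f (h w).
  elim: k => //= k IH; have := cm (iter k f w); rewrite !comp_lfunE => <-.
  by rewrite IH.
suff -> : iter n (f \o h)%VF v = iter n f (iter n h v) by rewrite Hn.
elim: n {Hn} => //= n ->; rewrite comp_lfunE comm.
by congr (f _).
Qed.

(** * Generation by ad-nilpotent elements *)

Section Centralizer.
Variables (R : rcfType) (g : lieAlgType R).
Implicit Types (U h : {vspace g}).

Definition cent U : {vspace g} := (\bigcap_(i < \dim U) lker (ad (vbasis U)`_i))%VS.

Lemma centP U v : reflect (forall u, u \in U -> lie u v = 0) (v \in cent U).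
Proof.
apply: (iffP idP) => [H u /coord_vbasis ->|H].
  rewrite lieC linear_sum /= big1 ?oppr0 // => i _; rewrite linearZ /= lieC.
  have /subv_bigcapP/(_ i isT) : (<[v]> <= cent U)%VS by rewrite -memvE.
  by rewrite -memvE memv_ker adE => /eqP ->; rewrite oppr0 scaler0.
rewrite memvE; apply/subv_bigcapP => i _; rewrite -memvE memv_ker adE.
by apply/eqP/H/vbasis_mem/mem_nth; rewrite size_tuple.
Qed.
End Centralizer.

Section NilpotentGeneration.
Variables (R : realType) (g : lieAlgType R).
Implicit Types (x y z u v w : g) (U J h I s c : {vspace g}).

Let B := tform (fullv : {vspace g}).
Let Bl : forall v, scalar (B^~ v). Proof. exact: tform_linl. Qed.
Let Br : forall v, scalar (B v). Proof. exact: tform_linr. Qed.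

Let stabf D : stab (fullv : {vspace g}) D. Proof. by move=> u _; apply: memvf. Qed.
Let BC x y : B x y = B y x. Proof. exact: tformC. Qed.
Let Bderiv D x y : deriv D -> B (D x) y = - B x (D y).
Proof. by move=> dD; apply: tform_deriv => //; apply: stabf. Qed.

Lemma definite_aniso U (Q : g -> g -> R) : definite_on U Q -> aniso Q U.
Proof.
by case=> H u uU Quu; apply/eqP/negPn/negP => /(H u uU); rewrite Quu ltxx.
Qed.

Section Complement.
Variables (s h : {vspace g}).
Hypotheses (ss : lie_semisimple s) (sh : lie_subalgebra h) (hs : (h <= s)%VS)
  (hN : forall x, x \in s -> nilp (ad x) -> x \in h).

Let s_sub := lie_subalgP _ (proj1 ss).
Let h_sub := lie_subalgP _ sh.
Let c : {vspace g} := perp B s h.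
Let cP v : reflect (v \in s /\ forall u, u \in h -> B v u = 0) (v \in c).
Proof. exact: perpP. Qed.

Lemma perp_stable x u : x \in h -> u \in c -> lie x u \in c.
Proof.
move=> xh /cP[us Hu]; apply/cP; split; first by apply: s_sub => //; apply: (subvP hs).
by move=> v vh; rewrite /B tform_inv -/B Hu ?oppr0 // h_sub.
Qed.

Let papp_s x q : x \in s -> 'X %| q -> forall v, v \in s -> papp (ad x) q v \in s.
Proof. by move=> xs qX; apply: papp_dvdX_mem => // u us; rewrite adE s_sub. Qed.

(* Eigenvectors of the hyperbolic part with nonzero eigenvalue are nilpotent,
   hence lie in [h]. *)
Lemma hyp_perp0 x q rhos : x \in s -> 'X %| q -> deriv (epapp q (ad x)) -> uniq rhos ->
  (forall v, papp (epapp q (ad x)) (\prod_(r <- rhos) ('X - r%:P)) v = 0) ->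
  forall u, u \in c -> epapp q (ad x) u = 0.
Proof.
move=> xs qX dH ur Hr u uc; set H := epapp q (ad x) in dH Hr *.
have Hs v : v \in s -> H v \in s by move=> vs; rewrite epappE papp_s.
have Hh v : v \in s -> H v \in h.
  move=> vs; apply: (split_ind (S := fun w => H w \in h) ur Hs _ _ _ vs (Hr v)).
  - by rewrite linear0 mem0v.
  - by move=> a b ah bh; rewrite linearD memvD.
  - move=> rho w _ ws Hw; have [r0|r0] := eqVneq rho 0.
      by rewrite Hw r0 scale0r mem0v.
    by rewrite Hw memvZ // hN //; apply: deriv_eigen_nilp dH Hw r0.
have [us Hu] := cP _ uc.
apply: (semisimple_nondeg ss) => [|v vs]; first exact: Hs.
by rewrite -/B Bderiv // Hu ?oppr0 // Hh.
Qed.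

(** The hyperbolic part [H] of [ad u] kills [s]: an eigenvector [w] of nonzero weight is in [h], so
    [lie u w] is in [c], where [H] vanishes. As [H] scales this bracket by the same weight, the
    bracket is 0, and so is [H w]. *)
Lemma perp_imspec u : u \in c -> imspec (ad u).
Proof.
move=> uc; have [us Hu] := cP _ uc.
have [q [qX dH Hq [rhos ur Hr]]] := deriv_hyp (deriv_ad u).
apply: (spec_Re_imspec Hq); set H := epapp q (ad u) in dH Hr *.
have Hs v : v \in s -> H v \in s by move=> vs; rewrite epappE papp_s.
apply: (etr_hyp0 (U := s) dH); last by rewrite semisimple_perfect.
move=> v vs; apply: (split_ind (S := fun w => H w = 0) ur Hs _ _ _ vs (Hr v)).
- exact: linear0.
- by move=> a b /= Ha Hb; rewrite linearD /= Ha Hb addr0.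
move=> rho w _ ws Hw; have [r0|r0] := eqVneq rho 0; first by rewrite Hw r0 scale0r.
have wh : w \in h by apply: hN => //; apply: deriv_eigen_nilp dH Hw r0.
have uwc : lie u w \in c by rewrite lieC memvN perp_stable.
have := hyp_perp0 us qX dH ur Hr uwc; rewrite -/H.
have Hcm : H (lie u w) = lie u (H w).
  by rewrite !epappE -!adE -(pappX (ad u)) papp_comm pappX.
rewrite Hcm Hw lieZr => /eqP; rewrite scaler_eq0 (negPf r0) /= => /eqP uw.
by rewrite -Hw epappE papp_dvdX_ker // adE.
Qed.

(** Being orthogonal to its centralizer in [s], [u] equals [lie u x] for some [x] in [s]. Then the
    hyperbolic part of [ad x] acts on [u] by -1, contrary to [hyp_perp0] unless [u] is 0. *)
Lemma perp_nilp0 u : u \in c -> nilp (ad u) -> u = 0.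
Proof.
move=> uc [n Hn]; have [us Hu] := cP _ uc.
have [x xs ux] : exists2 x, x \in s & u = lie u x.
  suff /memv_imgP[x xs e] : u \in (ad u @: s)%VS by exists x; rewrite // -adE.
  apply: (perp_perp Bl Br BC (fun y => @semisimple_nondeg R g s y ss)) => //.
    by apply/subvP => _ /memv_imgP[w ws ->]; rewrite adE s_sub.
  move=> v /(perpP Bl Br)[vs Hv].
  have uv0 : lie u v = 0.
    apply: (semisimple_nondeg ss) => [|w ws]; first exact: s_sub.
    by rewrite tform_inv -/B Hv ?oppr0 // -adE memv_img.
  rewrite BC /B tformfE; apply/nilp_etr/nilp_comp; last by exists n.
  by apply/lfunP => w; rewrite !comp_lfunE !adE (jacobi u v w) uv0 lie0l add0r.
have [q [qX dH Hq [rhos ur Hr]]] := deriv_hyp (deriv_ad x).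
have xu : ad x u = (-1) *: u by rewrite adE lieC -ux scaleN1r.
apply/eqP/negPn/negP => u0.
have := hyp_perp0 xs qX dH ur Hr uc; rewrite epappE (papp_eigen _ xu).
have rt : root (char_poly (emx (ad x))) (-1).
  have := papp_charpoly (ad x) u; rewrite (papp_eigen _ xu) => /eqP.
  by rewrite scaler_eq0 (negPf u0) orbF.
have := Hq ((-1)%:C); rewrite fmorph_root => /(_ rt); rewrite horner_map /= => -[->].
by move/eqP; rewrite scaleN1r oppr_eq0 (negPf u0).
Qed.
End Complement.

Lemma nilp_generate s h0 : lie_semisimple s -> no_compact_factor s ->
  lie_subalgebra h0 -> (h0 <= s)%VS ->
  (forall x, x \in s -> nilp (ad x) -> x \in h0) -> h0 = s.
Proof.
move=> ss nc sh0 h0s h0N.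
(* [h] is taken of least dimension: ad-nilpotent elements act on its complement [c] by skew
   nilpotent maps, hence trivially, so minimality forces [h] to centralize [c]. *)
pose P k := `[< exists h, [/\ lie_subalgebra h, (h <= h0)%VS,
   (forall x, x \in s -> nilp (ad x) -> x \in h) & \dim h = k] >].
have exP : exists k, P k by exists (\dim h0); apply/asboolP; exists h0; split; rewrite ?subvv.
case: (ex_minnP exP) => k /asboolP[h [sh hh0 hN dk]] mink.
have hs : (h <= s)%VS := subv_trans hh0 h0s.
suff c0 : perp B s h = 0%VS.
  apply/eqP; rewrite eqEdim h0s; apply: leq_trans (dimvS hh0).
  by have := dim_perp Bl Br s h; rewrite c0 dimv0.
set c := perp B s h.
have cP v : reflect (v \in s /\ forall u, u \in h -> B v u = 0) (v \in c) by exact: perpP.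
have s_sub := lie_subalgP _ (proj1 ss).
(* An isotropic [u] in [c] has imaginary spectrum and zero trace of the square, so it is nilpotent
   and [perp_nilp0] applies. *)
have aB : aniso B c.
  move=> u uc Buu; have im := perp_imspec ss sh hs hN uc.
  have [_ /(_ Buu) [n Hn]] := imspec_tform (@stabf (ad u)) im.
  by apply: (perp_nilp0 ss hN uc); exists n => v; apply/Hn/memvf.
have hc0 : (h :&: c)%VS = 0%VS.
  apply/eqP; rewrite -subv0; apply/subvP => u; rewrite memv_cap => /andP[uh uc].
  by rewrite memv0; apply/eqP/aB => //; have [_ ->] := cP _ uc.
have cs : (c <= s)%VS := capvSl _ _.
have hcs : (h + c)%VS = s.
  apply/eqP; rewrite eqEdim subv_add hs cs /= dimv_disjoint_sum // addnC.
  exact: dim_perp.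
have hcst x u : x \in h -> u \in c -> lie x u \in c.
  by move=> xh uc; apply: (perp_stable ss sh hs).
have skB z u v : B (ad z u) v = - B u (ad z v) by apply/Bderiv/deriv_ad.
have hc x u : x \in h -> u \in c -> lie x u = 0.
  have CE : (h :&: cent c)%VS = h.
    apply/eqP; rewrite eqEdim capvSl dk; apply/mink/asboolP.
    exists (h :&: cent c)%VS; split=> //; last 2 first.
    - exact: subv_trans (capvSl _ _) hh0.
    - move=> z zs zN; rewrite memv_cap hN //; apply/centP => v vc.
      have [n Hn] := zN; rewrite lieC -adE.
      rewrite (skew_nilp_aniso Br aB (N := ad z) (n := n)) ?oppr0 // => w wc.
      by rewrite adE hcst // hN.
    - apply/lie_subalgP => a b; rewrite !memv_cap => /andP[ah /centP aC] /andP[bh /centP bC].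
      rewrite (lie_subalgP _ sh) //; apply/centP => v vc.
      by rewrite jacobi aC // lie0l add0r bC // lie0r.
  by rewrite -{1}CE memv_cap => /andP[_ /centP H] uc; rewrite lieC H ?oppr0.
have cc a b : a \in c -> b \in c -> lie a b \in c.
  move=> ac bc; apply/cP; split; first by apply: s_sub; apply: (subvP cs).
  move=> v vh; rewrite /B tform_inv -/B lieC hc // oppr0.
  by rewrite [B b 0]form0r ?oppr0.
have sdec x : x \in s -> exists2 a, a \in h & exists2 b, b \in c & x = a + b.
  by rewrite -hcs => /memv_addP[a ah [b bc ->]]; exists a => //; exists b.
have ic : lie_ideal c s.
  apply/lie_idealP; split=> // x y /sdec[a ah [b bc ->]] yc.
  by rewrite lieDl hc // add0r cc.
have ih : lie_ideal h s.
  apply/lie_idealP; split=> // x y /sdec[a ah [b bc ->]] yh.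
  by rewrite lieDl (lieC b y) (hc y b) // oppr0 addr0 (lie_subalgP _ sh).
apply: nc; first by exists h; split; rewrite // 1?addvC 1?capvC.
split.
  split=> [|I /lie_idealP[Ic cI] solI]; first exact/lie_subalgP.
  apply: (proj2 ss) solI; apply/lie_idealP; split; first exact: subv_trans Ic cs.
  move=> x y /sdec[a ah [b bc ->]] yI.
  by rewrite lieDl hc ?add0r ?cI //; apply: (subvP Ic).
(* The form is nonpositive by imaginary spectrum; a null [u] acts on [c] by a skew nilpotent map,
   hence trivially, and is central in [s]. *)
right => u uc u0; have sc : lie_subalgebra c by apply/lie_subalgP.
have stc : stab c (ad u) by move=> v vc; rewrite adE cc.
rewrite killingE //; have im := perp_imspec ss sh hs hN uc.
have [le0 eq0] := imspec_tform stc im; rewrite lt_neqAle le0 andbT.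
apply: contra u0 => /eqP/eq0[n Hn]; apply/eqP; apply: (semisimple_center ss).
  exact: (subvP cs).
move=> x /sdec[a ah [b bc ->]]; rewrite lieDl hc // add0r lieC -adE.
by rewrite (skew_nilp_aniso Br aB (N := ad u) (n := n)) ?oppr0.
Qed.
End NilpotentGeneration.

(** [epapp r f] is the projector onto the generalized kernel of [f]. *)
Lemma fitting_proj (R : rcfType) (V : vectType R) (f : 'End(V)) :
  exists r, [/\ 'X %| 1 - r, (epapp r f \o epapp r f = epapp r f)%VF
    & nilp (f \o epapp r f)%VF].
Proof.
have [m [h]] := multiplicity_XsubC (char_poly (emx f)) 0.
rewrite (monic_neq0 (char_poly_monic _)) subr0 /= => rh chiE.
(* The exponent exceeds the multiplicity by one, so that ['X] divides [1 - r] even when 0 is not an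
   eigenvalue. *)
have /Bezout_coprimepP[[u v] /= Huv] : coprimep 'X^(m.+1) h.
  by apply: coprimep_expl; rewrite coprimep_sym coprimepX.
have [c c0 Hc] : exists2 c : R, c != 0 & u * 'X^(m.+1) + v * h = c%:P.
  move: Huv; rewrite -size_poly_eq1 => /eqP/eqP/size_poly1P[c c0 ->]; by exists c.
pose r := c^-1 *: (v * h).
have r1 : 1 - r = c^-1 *: (u * 'X^(m.+1)).
  apply/eqP; rewrite subr_eq -scalerDr Hc.
  by rewrite scale_polyC mulVf.
have rr : (epapp r f \o epapp r f = epapp r f)%VF.
  apply/eqP; rewrite -epappM -subr_eq0 -epappB -[X in _ - X]mulr1 -mulrBr -opprB mulrN.
  rewrite r1 /r; apply/eqP/(epapp0_dvd _ (epapp_charpoly f)).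
  rewrite dvdpNr -scalerAl -scalerAr !dvdpZr ?invr_eq0 // chiE exprS.
  have aux (A B C D E : {poly R}) : A * B * (C * (D * E)) = (C * A * D) * (B * E) by ring.
  by rewrite aux dvdp_mull.
exists r; split=> //; first by rewrite r1 dvdpZr ?invr_eq0 // exprSr mulrA dvdp_mull.
set P := epapp r f in rr *; have PP v0 : P (P v0) = P v0 by rewrite -comp_lfunE rr.
have Hit n w : iter n (f \o P)%VF (P w) = iter n f (P w).
  elim: n => //= n ->; rewrite comp_lfunE -!pappXn /P !epappE papp_comm.
  by have := PP w; rewrite /P !epappE => ->.
exists m.+1 => w; rewrite iterSr comp_lfunE.
have -> : f (P w) = P (f w) by rewrite /P !epappE -!(pappX f) papp_comm pappX.
rewrite Hit -pappXn /P epappE -pappM -epappE.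
rewrite (epapp0_dvd _ (epapp_charpoly f)) ?lfunE // chiE /r -scalerAr dvdpZr ?invr_eq0 //.
by rewrite mulrA [_ * v]mulrC -mulrA dvdp_mull // mulrC.
Qed.

Section LieSums.
Variables (R : rcfType) (g : lieAlgType R).
Lemma lie_suml (I : Type) (s : seq I) (F : I -> g) z :
  lie (\sum_(i <- s) F i) z = \sum_(i <- s) lie (F i) z.
Proof.
by elim/big_rec2: _ => [|i x y _ <-]; rewrite ?lie0l ?lieDl.
Qed.
Lemma lie_sumr (I : Type) (s : seq I) (F : I -> g) z :
  lie z (\sum_(i <- s) F i) = \sum_(i <- s) lie z (F i).
Proof. exact: linear_sum. Qed.
End LieSums.

(** * Complete reducibility for compact algebras *)

Section Casimir.
Variables (R : rcfType) (g : lieAlgType R) (Q : g -> g -> R) (k1 : {vspace g}) (e : seq g).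
Hypotheses (Ql : forall v, scalar (Q^~ v)) (Qr : forall u, scalar (Q u)).
Hypotheses (Qs : {in k1 &, forall u v, Q u v = Q v u})
  (ek : {subset e <= k1}) 
  (edec : forall x, x \in k1 -> x = \sum_(a <- e) (Q x a / Q a a) *: a).
Variable x : g.
Hypotheses (xk : forall y, y \in k1 -> lie x y \in k1)
  (Qx : forall y z, y \in k1 -> z \in k1 -> Q (lie x y) z = - Q y (lie x z)).

Definition casimir : 'End(g) := \sum_(a <- e) (Q a a)^-1 *: (ad a \o ad a)%VF.

Lemma casimirE v : casimir v = \sum_(a <- e) (Q a a)^-1 *: lie a (lie a v).
Proof.
by rewrite sum_lfunE; apply: eq_bigr => a _; rewrite scale_lfunE comp_lfunE !adE.
Qed.

(** The commutator is a double sum whose coefficient [m a b] is antisymmetric by invariance, while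
    the operator part is symmetric in [a] and [b]. *)
Lemma casimir_comm v : lie x (casimir v) = casimir (lie x v).
Proof.
apply/eqP; rewrite -subr_eq0 !casimirE lie_sumr -sumrB.
rewrite (eq_bigr (fun a => (Q a a)^-1 *: (lie (lie x a) (lie a v) + lie a (lie (lie x a) v)))).
  pose m a b := Q (lie x a) b / (Q a a * Q b b).
  have E (a : g) : a \in e -> (Q a a)^-1 *: (lie (lie x a) (lie a v) + lie a (lie (lie x a) v)) =
     \sum_(b <- e) m a b *: (lie b (lie a v) + lie a (lie b v)).
    move=> ae; rewrite {1 2}(edec (xk (ek ae))) !lie_suml lie_sumr -big_split scaler_sumr.
    apply: eq_bigr => b _ /=; rewrite !lieZl lieZr -scalerDr scalerA /m invfM.
    by congr (_ *: _); rewrite mulrCA.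
  rewrite big_seq (eq_bigr _ E) -big_seq; apply/eqP.
  set S := \sum_(a <- e) _; have : S = - S.
    rewrite {1}/S exchange_big /S -sumrN big_seq [RHS]big_seq; apply: eq_bigr => a ae.
    rewrite -sumrN big_seq [RHS]big_seq; apply: eq_bigr => b be.
    rewrite [lie a _ + _]addrC -scaleNr; congr (_ *: _).
    by rewrite /m (Qx (ek be) (ek ae)) [Q b b * _]mulrC mulNr (Qs (ek be) (xk (ek ae))).
  move/eqP; rewrite -addr_eq0 -mulr2n -scaler_nat scaler_eq0 pnatr_eq0 /= => /eqP //.
move=> a _; rewrite lieZr -scalerBr; congr (_ *: _).
by rewrite jacobi (jacobi x a v) lieDr addrA addrK.
Qed.
End Casimir.

Section Compact.
Variables (R : realType) (g : lieAlgType R) (k : {vspace g}).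
Hypothesis ck : compact_type k.
Implicit Types (x y z u v w a b : g) (U V h I : {vspace g}).

Let ss := proj1 ck.
Let k_sub := lie_subalgP _ (proj1 ss).
Let Q := tform k.
Let Ql : forall v, scalar (Q^~ v). Proof. exact: tform_linl. Qed.
Let Qr : forall v, scalar (Q v). Proof. exact: tform_linr. Qed.
Let stk x : x \in k -> stab k (ad x).
Proof. by move=> xk v vk; rewrite adE k_sub. Qed.

Let Qs : {in k &, forall u v, Q u v = Q v u}.
Proof. by move=> u v uk vk; apply: tformC; apply: stk. Qed.

Let Qdef : definite_on k Q.
Proof.
case: (proj2 ck) => H; [left|right] => x xk x0; have := H x xk x0;
  by rewrite killingE //; exact: (proj1 ss).
Qed.

Let Qa : aniso Q k. Proof. exact: definite_aniso. Qed.

Let Qderiv (D : 'End(g)) x y : deriv D -> stab k D -> x \in k -> y \in k ->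
  Q (D x) y = - Q x (D y).
Proof. by move=> dD sD xk yk; apply: tform_deriv => //; apply: stk. Qed.

Let papp_k x q : x \in k -> 'X %| q -> forall v, v \in k -> papp (ad x) q v \in k.
Proof. by move=> xk qX; apply: papp_dvdX_mem => // u uk; rewrite adE k_sub. Qed.

(** The hyperbolic part is skew for the definite form on [k] and diagonalizable over [R], hence
    kills [k]; [etr_hyp0] then controls the spectrum on all of [g], not only on [k]. *)
Lemma compact_imspec x : x \in k -> imspec (ad x).
Proof.
move=> xk; have [q [qX dH Hq [rhos ur Hr]]] := deriv_hyp (deriv_ad x).
apply: (spec_Re_imspec Hq); set H := epapp q (ad x) in dH Hr *.
have Hs : stab k H by move=> v vk; rewrite epappE papp_k.
apply: (etr_hyp0 (U := k) dH); last by rewrite semisimple_perfect.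
move=> v vk; apply: (split_ind (S := fun w => H w = 0) ur Hs _ _ _ vk (Hr v)).
- exact: linear0.
- by move=> a b /= Ha Hb; rewrite linearD /= Ha Hb addr0.
move=> rho w _ wk Hw; have [r0|r0] := eqVneq rho 0; first by rewrite Hw r0 scale0r.
have := Qderiv dH Hs wk wk; rewrite Hw (formZl Ql) (formZr Qr) => /eqP.
rewrite -addr_eq0 -mulr2n mulrn_eq0 /= mulf_eq0 (negPf r0) /= => /eqP /(Qa wk) ->.
by rewrite scaler0.
Qed.

(** The nilpotent part of [ad x] is skew and nilpotent on [k], so it kills [k] by definiteness; a
    derivation killing [y] commutes with [ad y]. *)
Lemma compact_nil x n : x \in k -> exists q, 'X^n %| q /\
  forall y, y \in k -> ((ad x - epapp q (ad x)) \o ad y = ad y \o (ad x - epapp q (ad x)))%VF.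
Proof.
move=> xk; have [q [qX dN [m Hm] _]] := deriv_nil n.+1 (deriv_ad x).
have qX1 : 'X %| q by apply: dvdp_trans qX; rewrite exprS dvdp_mulr.
exists q; split; first by apply: dvdp_trans qX; apply: dvdp_exp2l.
set N := ad x - _ in dN Hm *; move=> y yk.
have Ns : stab k N.
  by move=> v vk; rewrite add_lfunE opp_lfunE adE epappE memvB ?papp_k ?k_sub.
have Ny : N y = 0.
  by apply: (skew_nilp_aniso Qr Qa Ns _ (fun u _ => Hm u)) => // u v uk vk; apply: Qderiv.
have := deriv_comm y dN; rewrite Ny (_ : ad 0 = 0).
  by move/esym/eqP; rewrite subr_eq0 => /eqP.
by apply/lfunP => v; rewrite adE lie0l lfunE.
Qed.

Section Ideal.
Variable k1 : {vspace g}.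
Hypothesis k1i : lie_ideal k1 k.
Let k1k : (k1 <= k)%VS := proj1 (lie_idealP _ _ k1i).
Let k1_st x y : x \in k -> y \in k1 -> lie x y \in k1.
Proof. exact: (proj2 (lie_idealP _ _ k1i)). Qed.

Let Qa1 : aniso Q k1. Proof. by move=> u u1; apply: Qa; apply: (subvP k1k). Qed.
Let Qs1 : {in k1 &, forall u v, Q u v = Q v u}.
Proof. by move=> u v u1 v1; apply: Qs; apply: (subvP k1k). Qed.
Let Qinv x y z : x \in k -> y \in k -> z \in k -> Q (lie x y) z = - Q y (lie x z).
Proof. by move=> xk yk zk; rewrite -!adE; apply: Qderiv => //; [apply: deriv_ad|apply: stk]. Qed.

Lemma compact_ideal_perfect : lie_prod k1 k1 = k1.
Proof.
apply: (perfect_of_form Ql Qr) => //.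
- by apply/lie_subalgP => x y x1 y1; apply: k1_st => //; apply: (subvP k1k).
- by move=> x y z x1 y1 z1; apply: Qinv; apply: (subvP k1k).
- by move=> x x1 Hx; apply: Qa1 => //; apply: Hx.
suff E : lie_center k1 = 0%VS.
  by move=> v v1 Hv; apply/eqP; rewrite -memv0 -E; apply/lie_centerP.
apply: (proj2 ss).
  apply/lie_idealP; split; first exact: subv_trans (capvSl _ _) k1k.
  move=> x y xk /lie_centerP[y1 Hy]; apply/lie_centerP; split; first exact: k1_st.
  move=> u u1; rewrite jacobi (Hy u) // lie0r addr0 Hy //.
  by rewrite lieC memvN k1_st.
exists 1%N; apply/eqP; rewrite -subv0; apply/lie_prodP => a b /lie_centerP[a1 _].
by move=> /lie_centerP[_ Hb]; rewrite Hb // mem0v.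
Qed.

(* The Casimir operator is a sum of squares of operators with imaginary
   spectrum, so on its generalized kernel every term is nilpotent; the
   nilpotent parts commute with [k], hence the perfect algebra [k1] acts
   trivially there. *)
Lemma compact_split V : (forall x v, x \in k1 -> v \in V -> lie x v \in V) ->
  forall v, v \in V -> exists v0, [/\ v0 \in V, v - v0 \in lie_prod k1 V &
    forall x, x \in k1 -> lie x v0 = 0].
Proof.
move=> kV.
have [e [ue ek ne _ edec]] := orth_basis Ql Qr Qa1 Qs1.
pose C := casimir Q e.
have [r [r1 PP CP]] := fitting_proj C.
set P := epapp r C in PP CP.
have CC x v : x \in k1 -> lie x (C v) = C (lie x v).
  move=> x1; apply: (casimir_comm Qs1 ek edec) => [y|y z y1 z1].
    by apply: k1_st; apply: (subvP k1k).
  by apply: Qinv; apply: (subvP k1k).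
have xP x v : x \in k1 -> lie x (P v) = P (lie x v).
  move=> x1; rewrite /P !epappE -!adE; apply: papp_morph => u.
  by rewrite /= !adE CC.
have PPv v : P (P v) = P v by rewrite -comp_lfunE PP.
pose T a := (ad a \o P)%VF.
have imT a : a \in k1 -> imspec (T a).
  move=> a1; apply: imspec_comp; last exact/compact_imspec/(subvP k1k).
  by apply/lfunP => v; rewrite !comp_lfunE !adE -xP // PPv.
have TT a : a \in k1 -> ((ad a \o ad a) \o P = T a \o T a)%VF.
  by move=> a1; apply/lfunP => v; rewrite !comp_lfunE !adE -xP // PPv.
have nT a : a \in e -> nilp (T a).
  move=> ae; have [_] := imspec_etr (imT a (ek a ae)); apply.
  (* [C \o P] is nilpotent, so its trace is 0; since [Q] is definite, the summands all have one
     sign, and each of them vanishes. *)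
  have S0 : \sum_(a <- e) (Q a a)^-1 * etr (T a \o T a)%VF = 0.
    rewrite -[RHS](nilp_etr CP) /C; apply/esym.
    have -> : (casimir Q e \o P)%VF = \sum_(a <- e) (Q a a)^-1 *: ((ad a \o ad a) \o P)%VF.
      apply/lfunP => v; rewrite comp_lfunE casimirE sum_lfunE; apply: eq_bigr => b _.
      by rewrite scale_lfunE !comp_lfunE !adE.
    rewrite linear_sum big_seq [RHS]big_seq; apply: eq_bigr => b be.
    by rewrite linearZ /= TT // ek.
  have T0 b : b \in e -> etr (T b \o T b)%VF <= 0.
    by move=> be; have [] := imspec_etr (imT b (ek b be)).
  have Q0 b : b \in e -> Q b b != 0 by exact: ne.
  have ek' b : b \in e -> b \in k /\ b != 0.
    move=> be; split; first exact/(subvP k1k)/ek.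
    by apply: contraNneq (Q0 b be) => ->; rewrite (form0r Qr).
  have sgn b : b \in e -> (Q b b)^-1 * etr (T b \o T b)%VF = 0 -> etr (T b \o T b)%VF = 0.
    by move=> be /eqP; rewrite mulf_eq0 invr_eq0 (negPf (Q0 b be)) /= => /eqP.
  apply: sgn => //; case: Qdef => Hd.
    have := S0; move/eqP; rewrite -oppr_eq0 -sumrN big_seq psumr_eq0 => [/allP/(_ a ae)|b be].
      by rewrite ae /= oppr_eq0 => /eqP.
    have [bk b0] := ek' b be.
    by rewrite oppr_ge0 mulr_ge0_le0 ?T0 // invr_ge0 ltW // Hd.
  have := S0; move/eqP; rewrite big_seq psumr_eq0 => [/allP/(_ a ae)|b be].
    by rewrite ae /= => /eqP.
  have [bk b0] := ek' b be.
  by rewrite mulr_le0 ?T0 // invr_le0 ltW // Hd.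
(* On the range of [P], [ad a] equals its nilpotent part [N], which commutes with [ad b]; hence
   [lie a b] acts there as 0. *)
have eP a b v : a \in e -> b \in e -> lie (lie a b) (P v) = 0.
  move=> ae be; have [n Hn] := nT a ae.
  have [a1 b1] := (ek a ae, ek b be).
  have [q [qn Nc]] := compact_nil n (subvP k1k _ a1).
  have [q' Hq'] := papp_dvdXn (ad a) qn.
  set N := ad a - _ in Nc.
  have itT m w : iter m (ad a) (P w) = iter m (T a) (P w).
    elim: m => //= m ->; rewrite comp_lfunE; congr (ad a _).
    elim: m => [|m IH] /=; first by rewrite PPv.
    by rewrite comp_lfunE adE -xP // PPv.
  have aN w : lie a (P w) = N (P w).
    rewrite add_lfunE opp_lfunE adE epappE (proj1 (Hq' _)) itT Hn linear0 subr0 //.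
  have := jacobi a b (P v); rewrite (xP b) // (aN (lie b v)).
  rewrite -(xP b) // aN -!(adE b).
  have /lfunP/(_ (P v)) := Nc b (subvP k1k _ b1); rewrite !comp_lfunE => ->.
  by move/eqP; rewrite eq_sym -subr_eq0 addrK => /eqP.
have kkP x y v : x \in k1 -> y \in k1 -> lie (lie x y) (P v) = 0.
  move=> x1 y1; rewrite {1}(edec y y1) lie_sumr lie_suml big_seq big1 // => b be.
  rewrite lieZr lieZl (edec x x1) !lie_suml big_seq big1 ?scaler0 // => a ae.
  by rewrite !lieZl eP // scaler0.
have kP x v : x \in k1 -> lie x (P v) = 0.
  rewrite -{1}compact_ideal_perfect; move: x.
  apply: lie_prod_ind => [|a b Ha Hb|c a Ha|a b a1 b1]; last exact: kkP.
  - by rewrite lie0l.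
  - by rewrite lieDl Ha Hb addr0.
  - by rewrite lieZl Ha scaler0.
move=> v vV; exists (P v); split=> [||x x1]; last exact: kP.
  rewrite /P epappE; apply: papp_mem => // u uV; rewrite /C casimirE big_seq.
  by apply: memv_suml => a ae; apply: memvZ; rewrite !kV // ek.
(* ['X] divides [1 - r], so [v - P v] lies in the image of [V] under [C], which consists of sums of
   brackets with [k1]. *)
have -> : v - P v = papp C (1 - r) v by rewrite pappB papp1 /P epappE.
have CV u : u \in V -> C u \in lie_prod k1 V.
  move=> uV; rewrite /C casimirE big_seq; apply: memv_suml => a ae.
  by apply: memvZ; apply: mem_lie_prod; [apply: ek|apply: kV => //; apply: ek].
apply: (papp_dvdX_mem (U := V)) => // u uL; apply: CV.
by apply: subvP uL; apply/lie_prodP.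
Qed.
End Ideal.
End Compact.

(** ['X * q] has no constant term and takes the value |l|^2 at each eigenvalue. *)
Lemma mxtr_pow_nilp (R : rcfType) n (A : 'M[R]_n) :
  (forall k, \tr (A ^+ k.+1) = 0) -> exists m, A ^+ m = 0.
Proof.
move=> Hk; have [rs [_ H0 Htr _]] := spectrum_mx (map_mx (real_complex R) A).
have [q Hq] := real_interp rs 1 (fun z => erefl (conjc (conjc z))).
have rs0 : {in rs, forall l, l = 0}.
  apply: sum_normC0; have := Htr (map_poly (real_complex R) ('X * q)).
  rewrite hmx_toC trace_map_mx.
  have -> : \tr (hmx A ('X * q)) = 0.
    rewrite /hmx raddf_sum big1 // => -[[|i] ilt] _ /=.
      by rewrite coefXM eqxx scale0r mxtrace0.
    by rewrite mxtraceZ Hk mulr0.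
  rewrite rmorph0 => /esym; apply: etrans.
  rewrite big_seq [RHS]big_seq; apply: eq_bigr => l /Hq.
  rewrite expr1 dvdp_XsubCl /root hornerD hornerN hornerC subr_eq0 => /eqP E.
  by rewrite rmorphM /= map_polyX hornerM hornerX E.
exists (size rs); move: H0.
have -> : \prod_(l <- rs) ('X - l%:P) = map_poly (real_complex R) 'X^(size rs).
  rewrite map_polyXn big_seq (eq_bigr (fun => 'X)) => [|l /rs0 ->]; last by rewrite subr0.
  by rewrite -big_seq big_const_seq count_predT -Monoid.iteropE.
rewrite hmx_toC => /eqP; rewrite map_mx_eq0 => /eqP <-.
rewrite /hmx size_polyXn big_ord_recr /= coefXn eqxx scale1r big1 ?add0r // => i _.
by rewrite coefXn (ltn_eqF (ltn_ord i)) scale0r.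
Qed.

(** The last nonzero vector [v *m A ^+ k] is killed by [A] and, by commutation, still by the other
    matrices. *)
Lemma comm_nilp_ker (K : fieldType) n (As : seq 'M[K]_n.+1) :
  (forall A B, A \in As -> B \in As -> A *m B = B *m A) ->
  (forall A, A \in As -> exists m, A ^+ m = 0) ->
  exists2 v : 'rV[K]_n.+1, v != 0 & forall A, A \in As -> v *m A = 0.
Proof.
elim: As => [|A As IH] cm nl.
  by exists (const_mx 1) => //; apply/eqP => /rowP/(_ 0)/eqP; rewrite !mxE oner_eq0.
have [||v v0 Hv] := IH.
- by move=> B C BA CA; apply: cm; rewrite inE ?BA ?CA orbT.
- by move=> B BA; apply: nl; rewrite inE BA orbT.
have [m Hm] := nl A (mem_head _ _).
have ex : exists m, v *m A ^+ m == 0 by exists m; rewrite Hm mulmx0.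
have := ex_minnP ex; case=> -[|k] /eqP Hk mink.
  by move: v0; rewrite -Hk expr0 mulmx1 eqxx.
exists (v *m A ^+ k); first by apply/negP => /mink; rewrite ltnn.
move=> B; rewrite inE => /orP[/eqP ->|BA]; first by rewrite -mulmxA -[_ *m A]exprSr.
have AB : A ^+ k *m B = B *m A ^+ k.
  elim: (k) => [|j IHj]; first by rewrite expr0 mul1mx mulmx1.
  rewrite exprS -[A * _]/(A *m _) -mulmxA IHj !mulmxA; congr (_ *m _).
  by apply: cm; rewrite ?mem_head // inE BA orbT.
by rewrite -mulmxA AB mulmxA Hv // mul0mx.
Qed.

(** * Nilpotency of the bracket with a solvable ideal *)

Section Representations.
Variables (R : rcfType) (g : lieAlgType R).
Implicit Types (x y z : g) (c r : {vspace g}).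

(* Representations on row vectors; since matrices act on the right, brackets
   are reversed. *)
Definition lie_rep n (rho : g -> 'M[R]_n) := linear rho /\
  forall x y, rho (lie x y) = rho y *m rho x - rho x *m rho y.

Section Irreducible.
Variables (n : nat) (rho : g -> 'M[R]_n.+1).
Hypotheses (rr : lie_rep rho).
Hypothesis irr : forall U : 'M[R]_n.+1, (forall x, (U *m rho x <= U)%MS) ->
  U != 0 -> forall v : 'rV[R]_n.+1, (v <= U)%MS.

Let rB := proj2 rr.
Let rD x y : rho (x + y) = rho x + rho y.
Proof. by have := proj1 rr 1 x y; rewrite !scale1r. Qed.
Let r0 : rho 0 = 0. Proof. by apply: (addIr (rho 0)); rewrite -rD !add0r. Qed.
Let rZ a x : rho (a *: x) = a *: rho x.
Proof. by have := proj1 rr a x 0; rewrite r0 !addr0. Qed.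

Let tr_lie0 x y (q : 'M[R]_n.+1) : q *m rho y = rho y *m q -> \tr (rho (lie x y) *m q) = 0.
Proof.
move=> qy; rewrite rB mulmxBl mxtraceD [\tr (- _)]raddfN /= -!mulmxA -qy.
by rewrite [X in X - _]mxtrace_mulC -mulmxA subrr.
Qed.

Let pow_comm (A B : 'M[R]_n.+1) k : A *m B = B *m A -> A ^+ k *m B = B *m A ^+ k.
Proof.
move=> AB; elim: k => [|k IH]; first by rewrite expr0 mul1mx mulmx1.
by rewrite exprS -[A * _]/(A *m _) -mulmxA IH !mulmxA AB.
Qed.

(** The common kernel of [bs] is a nonzero invariant subspace, so irreducibility makes it
    everything. *)
Let ker_stable0 (v : 'rV[R]_n.+1) (bs : seq g) : v != 0 ->
  (forall z, z \in bs -> v *m rho z = 0) ->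
  (forall w : 'rV[R]_n.+1, (forall z, z \in bs -> w *m rho z = 0) ->
     forall x z, z \in bs -> w *m rho x *m rho z = 0) ->
  forall z, z \in bs -> rho z = 0.
Proof.
move=> v0 Hv st; pose U := (\bigcap_(i < size bs) kermx (rho bs`_i))%MS.
have UP (w : 'rV[R]_n.+1) : reflect (forall z, z \in bs -> w *m rho z = 0) (w <= U)%MS.
  apply: (iffP sub_bigcapmxP) => [H z /(nthP 0)[i ib <-]|H i _].
    by apply/sub_kermxP; exact: (H (Ordinal ib) isT).
  by apply/sub_kermxP/H/mem_nth.
have Uall : forall w : 'rV[R]_n.+1, (w <= U)%MS.
  apply: irr => [x|].
    apply/row_subP => i; rewrite row_mul; apply/UP => z zb; apply: st => //.
    by apply/UP/row_sub.
  by apply: contraNneq v0 => U0; rewrite -submx0 -U0; apply/UP.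
move=> z zb; apply/row_matrixP => i; rewrite row0 rowE.
by have /UP/(_ z zb) := Uall (delta_mx 0 i).
Qed.

(** A bracket with [c] has trace 0 against any matrix commuting with the image of [c], in particular
    against its own powers; so it is nilpotent, and the common kernel of these commuting nilpotents
    is invariant. *)
Lemma irr_abelian_ideal c : lie_ideal c fullv ->
  (forall a b, a \in c -> b \in c -> rho a *m rho b = rho b *m rho a) ->
  forall z, z \in lie_prod fullv c -> rho z = 0.
Proof.
move=> /lie_idealP[_ ci] cm.
have sub : (lie_prod fullv c <= c)%VS by apply/lie_prodP => x y _ yc; apply: ci; rewrite ?memvf.
have trq q z : (forall a, a \in c -> q *m rho a = rho a *m q) ->
    z \in lie_prod fullv c -> \tr (rho z *m q) = 0.
  move=> Hq; move: z; apply: lie_prod_ind => [|a b Ha Hb|t a Ha|a b _ bc].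
  - by rewrite r0 mul0mx mxtrace0.
  - by rewrite rD mulmxDl mxtraceD Ha Hb addr0.
  - by rewrite rZ -scalemxAl mxtraceZ Ha mulr0.
  - by apply: tr_lie0; apply: Hq.
have nl z : z \in lie_prod fullv c -> exists m, rho z ^+ m = 0.
  move=> zc; apply: mxtr_pow_nilp => k; rewrite exprS; apply: trq => // a ac.
  by apply: pow_comm; apply: cm => //; apply: (subvP sub).
pose bs := vbasis (lie_prod fullv c).
have bsP z : z \in bs -> z \in lie_prod fullv c by apply: vbasis_mem.
have [||v v0 Hv] := @comm_nilp_ker R n [seq rho z | z <- bs].
- by move=> _ _ /mapP[a /bsP/(subvP sub) ac ->] /mapP[b /bsP/(subvP sub) bc ->]; apply: cm.
- by move=> _ /mapP[a /bsP ac ->]; apply: nl.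
have sumr (w : 'rV[R]_n.+1) z : (forall b, b \in bs -> w *m rho b = 0) -> z \in lie_prod fullv c ->
    w *m rho z = 0.
  move=> Hw /coord_vbasis ->; elim/big_rec: _ => [|i y _ IH]; first by rewrite r0 mulmx0.
  by rewrite rD rZ mulmxDr IH addr0 -scalemxAr Hw ?scaler0 // mem_nth ?size_tuple.
have Hbs : forall z, z \in bs -> rho z = 0.
  apply: (ker_stable0 v0) => [z zb|w Hw x z zb].
    by apply: Hv; apply: map_f.
  have := rB z x => /(congr1 (mulmx w)); rewrite mulmxBr !mulmxA.
  rewrite (Hw z zb) mul0mx subr0 => <-; apply: sumr => //.
  by rewrite lieC memvN mem_lie_prod ?memvf // (subvP sub) ?bsP.
move=> z zc; apply/row_matrixP => i; rewrite row0 rowE; apply: sumr => // b bb.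
by rewrite Hbs // mulmx0.
Qed.

Lemma lie_derived_ideal c i : lie_ideal c fullv -> lie_ideal (lie_derived i c) fullv.
Proof.
move=> ci; elim: i => //= i /lie_idealP[_ H]; apply/lie_idealP; split; first exact: subvf.
move=> x y _; move: y; apply: lie_prod_ind => [|a b Ha Hb|t a Ha|a b ac bc].
- by rewrite lie0r mem0v.
- by rewrite lieDr memvD.
- by rewrite lieZr memvZ.
- by rewrite jacobi memvD ?mem_lie_prod ?H ?memvf.
Qed.

(** An eigenvector-free form of Lie's theorem, climbing the derived series from 0: if term [i.+1]
    acts commutatively, its image is central; consisting of sums of brackets, it is nilpotent by
    traces, hence 0, and term [i] acts commutatively. *)
Lemma irr_solvable_ideal c : lie_ideal c fullv -> lie_solvable c ->
  forall z, z \in lie_prod fullv c -> rho z = 0.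
Proof.
move=> ci [m cm0]; apply: irr_abelian_ideal => //.
pose cm i := forall a b, a \in lie_derived i c -> b \in lie_derived i c ->
   rho a *m rho b = rho b *m rho a.
suff : cm 0%N by [].
have : cm m by move=> a b; rewrite cm0 memv0 => /eqP ->; rewrite r0 mul0mx mulmx0.
elim: (m) => // i IH Hi; apply: IH.
have di := lie_derived_ideal i.+1 ci; have di0 := lie_derived_ideal i ci.
have z0 := irr_abelian_ideal di Hi.
have ctr z x : z \in lie_derived i.+1 c -> rho z *m rho x = rho x *m rho z.
  move=> zc; have := rB x z; rewrite z0 ?mem_lie_prod ?memvf // => /eqP.
  by rewrite eq_sym subr_eq0 => /eqP.
have trq q z : (forall a, q *m rho a = rho a *m q) ->
    z \in lie_derived i.+1 c -> \tr (rho z *m q) = 0.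
  move=> Hq; move: z; apply: lie_prod_ind => [|a b Ha Hb|t a Ha|a b _ bc].
  - by rewrite r0 mul0mx mxtrace0.
  - by rewrite rD mulmxDl mxtraceD Ha Hb addr0.
  - by rewrite rZ -scalemxAl mxtraceZ Ha mulr0.
  - by apply: tr_lie0; apply: Hq.
have d0 z : z \in lie_derived i.+1 c -> rho z = 0.
  move=> zc; have [m' Hm] : exists m, rho z ^+ m = 0.
    apply: mxtr_pow_nilp => k; rewrite exprS; apply: trq => // a.
    by apply: pow_comm; apply: ctr.
  have [||v v0 Hv] := @comm_nilp_ker R n [:: rho z].
  - by move=> A B; rewrite !inE => /eqP -> /eqP ->.
  - by move=> A; rewrite inE => /eqP ->; exists m'.
  apply: (@ker_stable0 v [:: z] v0 _ _ z); last by rewrite inE.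
    by move=> y; rewrite inE => /eqP ->; apply: Hv; rewrite inE.
  move=> w Hw x y; rewrite inE => /eqP ->; rewrite -mulmxA -ctr // mulmxA Hw ?mul0mx //.
  by rewrite inE.
move=> a b ac bc; have := rB b a; rewrite d0 => [/eqP|].
  by rewrite eq_sym subr_eq0 => /eqP.
exact: mem_lie_prod.
Qed.
End Irreducible.
End Representations.

Section RepNilpotent.
Variables (R : rcfType) (g : lieAlgType R) (c : {vspace g}).
Hypotheses (ci : lie_ideal c fullv) (cs : lie_solvable c).

Let intertwine_rep n m (rho : g -> 'M[R]_n) (sig : g -> 'M[R]_m) (S : 'M[R]_(m, n)) :
  lie_rep rho -> linear sig -> row_free S -> (forall x, S *m rho x = sig x *m S) ->
  lie_rep sig.
Proof.
move=> [_ rB] sl Sf H; split=> // x y; apply: (row_free_inj Sf).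
by rewrite mulmxBl -!mulmxA -!H rB mulmxBr !mulmxA -!H.
Qed.

Let intertwine_rep' n m (rho : g -> 'M[R]_n) (sig : g -> 'M[R]_m) (S : 'M[R]_(n, m)) :
  lie_rep rho -> linear sig -> row_full S -> (forall x, rho x *m S = S *m sig x) ->
  lie_rep sig.
Proof.
move=> [_ rB] sl Sf H; split=> // x y; apply: (row_full_inj Sf).
by rewrite mulmxBr !mulmxA -!H -!mulmxA -!H rB mulmxBl !mulmxA.
Qed.

(** Induction on dimension: a proper invariant subspace gives a sub- and a quotient representation,
    and nilpotency indices add. *)
Lemma rep_nilp n (rho : g -> 'M[R]_n) : lie_rep rho ->
  forall z, z \in lie_prod fullv c -> exists m, rho z ^+ m = 0.
Proof.
have [N Hn] : exists N, (n <= N)%N by exists n.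
elim: N n Hn rho => [|N IH] n Hn rho rr z zc.
  move: rho {rr} Hn; case: n => // rho _; exists 1%N; apply/matrixP => -[] //.
case: n Hn rho rr => [|n] Hn rho rr; first by exists 1%N; apply/matrixP => -[].
have rl := proj1 rr.
have [irr|nirr] := pselect (forall U : 'M[R]_n.+1, (forall x, (U *m rho x <= U)%MS) ->
  U != 0 -> forall v : 'rV[R]_n.+1, (v <= U)%MS).
  by exists 1%N; rewrite expr1; apply: (irr_solvable_ideal rr irr ci cs).
have [U [st U0 [v vU]]] : exists U : 'M[R]_n.+1, [/\ forall x, (U *m rho x <= U)%MS,
    U != 0 & exists v : 'rV[R]_n.+1, ~~ (v <= U)%MS].
  apply: contrapT => H; apply: nirr => U st U0 v; apply/negPn/negP => vU.
  by apply: H; exists U; split=> //; exists v.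
have rkU : (\rank U < n.+1)%N.
  rewrite ltn_neqAle rank_leq_row andbT; apply: contra vU => fU.
  by apply: submx_full.
pose Rb := row_base U; pose sig x := Rb *m rho x *m pinvmx Rb.
have Hsig x : Rb *m rho x = sig x *m Rb.
  by rewrite /sig mulmxKpV // (eqmxMr _ (eq_row_base U)) eq_row_base.
have sigl : linear sig.
  by move=> a x y; rewrite /sig rl mulmxDr mulmxDl -scalemxAr -scalemxAl.
have Rf : row_free Rb := row_base_free U.
have [a Ha] := IH _ (leq_trans rkU Hn) sig (intertwine_rep rr sigl Rf Hsig) z zc.
(* A column basis of the cokernel models the projection to the quotient by [U]. *)
have [Cb [Cf CK]] : exists Cb : 'M[R]_(n.+1, \rank (cokermx U)), row_full Cb /\
    forall w : 'rV[R]_n.+1, (w <= U)%MS = (w *m Cb == 0).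
  exists (col_base (cokermx U)); split; first exact: col_base_full.
  move=> w; rewrite submxE -{1}(mulmx_base (cokermx U)) mulmxA.
  apply/eqP/eqP => [/eqP|->]; last by rewrite mul0mx.
  by rewrite mulmx_free_eq0 ?row_base_free // => /eqP.
have [L HL] : exists L, L *m Cb = 1%:M by exists (pinvmx Cb); apply: mulVpmx.
pose tau x := L *m rho x *m Cb.
have Htau x : rho x *m Cb = Cb *m tau x.
  apply/eqP; rewrite -subr_eq0 /tau !mulmxA -mulmxBl -[X in X - _]mul1mx -mulmxBl.
  apply/eqP/row_matrixP => i; rewrite row0 !row_mul; apply/eqP; rewrite -CK.
  apply: submx_trans (submxMr _ _) (st x).
  by rewrite CK -row_mul mulmxBl mul1mx -mulmxA HL mulmx1 subrr row0.
have taul : linear tau.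
  by move=> s x y; rewrite /tau rl mulmxDr mulmxDl -scalemxAr -scalemxAl.
have rkC : (\rank (cokermx U) < n.+1)%N.
  by rewrite mxrank_coker ltn_subrL /= lt0n mxrank_eq0 U0.
have [b Hb] := IH _ (leq_trans rkC Hn) tau (intertwine_rep' rr taul Cf Htau) z zc.
have powR j : Rb *m rho z ^+ j = sig z ^+ j *m Rb.
  elim: j => [|j IHj]; first by rewrite !expr0 mulmx1 mul1mx.
  rewrite exprS -[_ * _]/(_ *m _) mulmxA Hsig -mulmxA IHj mulmxA.
  by rewrite [in RHS]exprS.
have powC j : rho z ^+ j *m Cb = Cb *m tau z ^+ j.
  elim: j => [|j IHj]; first by rewrite !expr0 mulmx1 mul1mx.
  rewrite exprSr -[_ * _]/(_ *m _) -mulmxA Htau mulmxA IHj -mulmxA.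
  by rewrite [in RHS]exprSr.
exists (b + a)%N; rewrite exprD -[_ * _]/(_ *m _).
have /submxP[X ->] : (rho z ^+ b <= Rb)%MS.
  apply/row_subP => i; rewrite eq_row_base CK -row_mul powC Hb mulmx0 row0 //.
by rewrite -mulmxA powR Ha mul0mx mulmx0.
Qed.

Lemma ad_rep : lie_rep (fun x : g => emx (ad x)).
Proof.
split=> [a x y|x y]; first by rewrite adD adZ linearP.
by rewrite ad_lie linearB /= !emx_comp.
Qed.

Lemma ideal_nilp z : z \in lie_prod fullv c -> nilp (ad z).
Proof.
move=> /(rep_nilp ad_rep)[m Hm]; apply/nilpP; exists m.
apply: emx_inj; rewrite emx_epapp linear0 -Hm.
rewrite /hmx size_polyXn big_ord_recr /= coefXn eqxx scale1r big1 ?add0r // => i _.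
by rewrite coefXn (ltn_eqF (ltn_ord i)) scale0r.
Qed.
End RepNilpotent.

(** * One-parameter groups and polynomials vanishing on them *)

Section MatrixExponential.
Variable R : realType.

Lemma cvg_pseries_bound (c : nat -> R) (B M x : R) : 0 <= B -> 0 <= M ->
  (forall m, `|c m| <= B * (M ^+ m / m`!%:R)) -> cvgn (pseries c x).
Proof.
move=> B0 M0 Hc; apply: normed_cvg.
apply: (@series_le_cvg _ _ (B \*: exp_coeff (M * `|x|))).
- by move=> n /=.
- by move=> n; rewrite /= mulr_ge0 // divr_ge0 ?exprn_ge0 ?mulr_ge0.
- move=> n /=; rewrite -[X in _ <= X]/(B * ((M * `|x|) ^+ n / n`!%:R)).
  by rewrite exprMn normrM normrX mulrAC mulrA ler_wpM2r ?exprn_ge0.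
exact/is_cvg_seriesZ/is_cvg_series_exp_coeff.
Qed.

Variables (n : nat) (A : 'M[R]_n).
Let M := \sum_(i < n) \sum_(j < n) `|A i j|.
Let M_ge0 : 0 <= M. Proof. by rewrite sumr_ge0 // => i _; rewrite sumr_ge0. Qed.

Let colM j : \sum_(k < n) `|A k j| <= M.
Proof. by apply: ler_sum => k _; rewrite (bigD1 j) //= lerDl sumr_ge0. Qed.

Lemma mxpow_bound m i j : `|(A ^+ m) i j| <= M ^+ m.
Proof.
elim: m i j => [|m IH] i j.
  by rewrite !expr0 mxE; case: (_ == _); rewrite ?normr1 ?normr0.
rewrite exprSr mxE (le_trans (ler_norm_sum _ _ _)) //.
rewrite exprSr; apply: le_trans (ler_wpM2l (exprn_ge0 m M_ge0) (colM j)).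
by rewrite mulr_sumr ler_sum // => k _; rewrite normrM ler_wpM2r.
Qed.

(** Coefficients in s of the entries of A^l exp(sA); termwise differentiation is the shift of [l] by
    one. *)
Let coef l i j m : R := (A ^+ (m + l)) i j / m`!%:R.

Let coef_cvg l i j x : cvgn (pseries (coef l i j) x).
Proof.
apply: (@cvg_pseries_bound _ (M ^+ l) M); rewrite ?exprn_ge0 // => m.
rewrite normrM [`|_^-1|]ger0_norm ?invr_ge0 // mulrA ler_wpM2r ?invr_ge0 //.
by rewrite -exprD addnC mxpow_bound.
Qed.

Let coef_diffs l i j : pseries_diffs (coef l i j) = coef l.+1 i j.
Proof.
apply/funext => m; rewrite /pseries_diffs /coef factS natrM invfM addSnnS.
by rewrite mulrCA mulVKf ?pnatr_eq0 // mulrC.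
Qed.

Lemma expmxE (s : R) i j : expmx (s *: A) i j = limn (pseries (coef 0 i j) s).
Proof.
rewrite mxE; congr (limn (series _)); apply/funext => m; rewrite /coef /= addn0.
rewrite mulrAC; congr (_ / _).
elim: m i j => [|m IH] i j; first by rewrite !expr0 mulr1.
rewrite !exprSr !mxE mulr_suml; apply: eq_bigr => k _.
by rewrite IH mxE; ring.
Qed.

Lemma expmx0 : expmx (0 *: A) = 1%:M.
Proof.
apply/matrixP => i j; rewrite expmxE.
have -> : pseries (coef 0 i j) 0 = series (fun m : nat => if m == 0%N then (1%:M : 'M[R]_n) i j else 0).
  congr series; apply/funext => -[|m]; rewrite /coef /=; first by rewrite expr0 divr1 mulr1.
  by rewrite exprS mul0r mulr0.
apply/cvg_lim => //; apply: cvg_near_cst.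
near=> m; rewrite /series /=.
have m0 : (0 < m)%N by near: m; exists 1%N.
by rewrite -(prednK m0) big_nat_recl //= big1 ?addr0.
Unshelve. all: by end_near.
Qed.

Lemma is_derive_expmx (s : R) i j :
  is_derive s 1 (fun s : R => expmx (s *: A) i j)
    (\sum_(k < n) A k j * expmx (s *: A) i k).
Proof.
have -> : (fun s : R => expmx (s *: A) i j) = (fun s => limn (pseries (coef 0 i j) s)).
  by apply/funext => t; rewrite expmxE.
have -> : \sum_(k < n) A k j * expmx (s *: A) i k = limn (pseries (pseries_diffs (coef 0 i j)) s).
  rewrite coef_diffs; apply/esym/cvg_lim => //.
  have -> : pseries (coef 1 i j) s = (fun m => \sum_(k < n) A k j * pseries (coef 0 i k) s m).
    apply/funext => m; rewrite /pseries /series /=.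
    under [RHS]eq_bigr do rewrite mulr_sumr.
    rewrite exchange_big /=; apply: eq_bigr => l _.
    rewrite /coef addn0 addn1 exprSr mxE !mulr_suml; apply: eq_bigr => k _.
    by ring.
  under eq_bigr do rewrite expmxE.
  apply: cvg_big => [|k _]; first exact: add_continuous.
  apply: cvgM; first exact: cvg_cst.
  exact: coef_cvg.
apply: (@pseries_snd_diffs _ _ (`|s| + 1)); rewrite ?coef_diffs ?coef_diffs; try exact: coef_cvg.
by rewrite [X in _ < X]ger0_norm ?ltrDl // addr_ge0.
Qed.
End MatrixExponential.

Section MpolyDerivation.
Variables (R : realType) (n : nat).
Local Notation N := (n * n)%N.
Local Notation MP := (mpoly.mpoly N R).
Implicit Types (A : 'M[R]_n) (p q : MP).

Definition mvar (i j : 'I_n) : MP := mpoly.mpolyX R (mpoly.mnm1 (mxvec_index i j)).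

Lemma mpoly_alg_ind (P : MP -> Prop) :
  (forall c, P (mpoly.mpolyC N c)) -> (forall i j, P (mvar i j)) ->
  (forall p q, P p -> P q -> P (p + q)) -> (forall p q, P p -> P q -> P (p * q)) ->
  forall p, P p.
Proof.
move=> PC PX PD PM p.
have P1 : P 1 by have := PC 1; rewrite mpoly.mpolyC1.
have P0 : P 0 by have := PC 0; rewrite mpoly.mpolyC0.
rewrite (mpoly.mpolyE p); apply: (big_ind P) => // m _.
rewrite -mpoly.mul_mpolyC; apply: (PM) => //.
rewrite mpoly.mpolyXE_id; apply: (big_ind P) => [//|x y|t _]; first exact: PM.
elim: (m t) => [|k IH]; first by rewrite expr0.
rewrite exprS; apply: (PM) => //.
by case/mxvec_indexP: t {IH} => i j; apply: PX.
Qed.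

Definition mlin (c : 'M[R]_n) : MP := \sum_(i < n) \sum_(j < n) c i j *: mvar i j.

Lemma mlin_linear : linear mlin.
Proof.
move=> a c d; rewrite /mlin scaler_sumr -big_split; apply: eq_bigr => i _ /=.
rewrite scaler_sumr -big_split; apply: eq_bigr => j _ /=.
by rewrite !mxE scalerDl scalerA.
Qed.
HB.instance Definition _ := GRing.isLinear.Build R _ _ _ mlin mlin_linear.

Lemma mlin_delta i j : mlin (delta_mx i j) = mvar i j.
Proof.
rewrite /mlin (bigD1 i) //= [X in _ + X]big1 => [|k ki]; last first.
  by rewrite big1 // => l _; rewrite mxE (negPf ki) scale0r.
rewrite (bigD1 j) //= [X in _ + X + _]big1 => [|l lj]; last first.
  by rewrite mxE (negPf lj) andbF scale0r.
by rewrite mxE !eqxx scale1r !addr0.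
Qed.

(* The derivation of the coordinate ring induced by [X' = X *m A]. *)
Definition mder A p : MP := \sum_(i < n) \sum_(j < n)
  mpoly.mderiv (mxvec_index i j) p * mlin (delta_mx i j *m A^T).

Lemma mder_linear A : linear (mder A).
Proof.
move=> a p q; rewrite /mder scaler_sumr -big_split; apply: eq_bigr => i _ /=.
rewrite scaler_sumr -big_split; apply: eq_bigr => j _ /=.
by rewrite linearP mulrDl scalerAl.
Qed.
HB.instance Definition _ A := GRing.isLinear.Build R _ _ _ (mder A) (mder_linear A).

Lemma mderM A p q : mder A (p * q) = mder A p * q + p * mder A q.
Proof.
rewrite /mder mulr_suml mulr_sumr -big_split; apply: eq_bigr => i _ /=.
rewrite mulr_suml mulr_sumr -big_split; apply: eq_bigr => j _ /=.
by rewrite mpoly.mderivM mulrDl mulrAC mulrA.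
Qed.

Lemma mderC A c : mder A (mpoly.mpolyC N c) = 0.
Proof.
by rewrite /mder big1 // => i _; rewrite big1 // => j _; rewrite mpoly.mderivC mul0r.
Qed.

Lemma mder_var A i j : mder A (mvar i j) = mlin (delta_mx i j *m A^T).
Proof.
have mxI k l : (mxvec_index k l == mxvec_index i j) = (k == i) && (l == j).
  apply/eqP/andP => [|[/eqP -> /eqP ->] //].
  move/(congr1 (mxvec (delta_mx i j : 'M[R]_n) 0)); rewrite !mxvecE !mxE !eqxx /=.
  by case: (k == i); case: (l == j) => // /eqP; rewrite eq_sym oner_eq0.
have E k l : mpoly.mderiv (mxvec_index k l) (mvar i j) = ((k == i) && (l == j))%:R.
  rewrite mpoly.mderivX mpoly.mnm1E eq_sym mxI.
  case: andP => [[/eqP -> /eqP ->]|_]; last by rewrite scale0r.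
  rewrite scale1r -[RHS](mpoly.mpolyX0 N R); congr (mpoly.mpolyX R _).
  by apply/mpoly.mnmP => t; rewrite mpoly.mnmBE subnn mpoly.mnm0E.
rewrite /mder (bigD1 i) //= [X in _ + X]big1 => [|k ki]; last first.
  by rewrite big1 // => l _; rewrite E (negPf ki) mul0r.
rewrite (bigD1 j) //= [X in _ + X + _]big1 => [|l lj]; last first.
  by rewrite E (negPf lj) andbF mul0r.
by rewrite E !eqxx mul1r !addr0.
Qed.

Lemma mder_lin A c : mder A (mlin c) = mlin (c *m A^T).
Proof.
rewrite {1}/mlin linear_sum [c in RHS]matrix_sum_delta mulmx_suml linear_sum.
apply: eq_bigr => i _; rewrite linear_sum mulmx_suml linear_sum; apply: eq_bigr => j _.
by rewrite linearZ /= mder_var -scalemxAl linearZ.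
Qed.

Lemma mderB A B p : mder (A - B) p = mder A p - mder B p.
Proof.
rewrite /mder -sumrB; apply: eq_bigr => i _; rewrite -sumrB; apply: eq_bigr => j _.
by rewrite linearB /= mulmxBr linearB /= mulrBr.
Qed.

Lemma mder_comm A B p : A *m B = B *m A -> mder A (mder B p) = mder B (mder A p).
Proof.
move=> AB; elim/mpoly_alg_ind: p => [c|i j|p q Hp Hq|p q Hp Hq].
- by rewrite !mderC.
- by rewrite !mder_var !mder_lin -!mulmxA -!trmx_mul AB.
- by rewrite !linearD /= Hp Hq.
- by rewrite !mderM !linearD /= !mderM Hp Hq; ring.
Qed.

(** Both sides obey the Leibniz rule, so coordinate functions suffice; there it is the equation X' =
    X A. *)
Lemma is_derive_meval A p (s : R) :
  is_derive s 1 (fun s : R => mpoly.meval (mxvec (expmx (s *: A)) 0) p)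
    (mpoly.meval (mxvec (expmx (s *: A)) 0) (mder A p)).
Proof.
elim/mpoly_alg_ind: p => [c|i j|p q Hp Hq|p q Hp Hq].
- rewrite mderC mpoly.meval0.
  under eq_fun do rewrite mpoly.mevalC.
  exact: is_derive_cst.
- rewrite mder_var.
  have -> : (fun s : R => mpoly.meval (mxvec (expmx (s *: A)) 0) (mvar i j)) =
     (fun s => expmx (s *: A) i j).
    by apply/funext => t; rewrite mpoly.mevalXU mxvecE.
  have -> : mpoly.meval (mxvec (expmx (s *: A)) 0) (mlin (delta_mx i j *m A^T)) =
     \sum_(k < n) A k j * expmx (s *: A) i k.
    rewrite raddf_sum (bigD1 i) //= [X in _ + X]big1 ?addr0 => [|k ki]; last first.
      rewrite raddf_sum big1 // => l _ /=; rewrite mpoly.mevalZ mxE big1 ?mul0r // => m _.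
      by rewrite mxE (negPf ki) mul0r.
    rewrite raddf_sum; apply: eq_bigr => k _ /=; rewrite mpoly.mevalZ mpoly.mevalXU mxvecE.
    congr (_ * _); rewrite mxE (bigD1 j) //= big1 ?addr0 => [|m mj].
      by rewrite !mxE !eqxx mul1r.
    by rewrite !mxE (negPf mj) andbF mul0r.
  exact: is_derive_expmx.
- rewrite linearD mpoly.mevalD.
  under eq_fun do rewrite mpoly.mevalD.
  exact: is_deriveD.
- rewrite mderM mpoly.mevalD !mpoly.mevalM.
  under eq_fun do rewrite mpoly.mevalM.
  have := is_deriveM Hp Hq; rewrite -[(_ * _)%R]/(fun s => _ s * _ s) => H.
  apply: (is_derive_eq H).
  by rewrite -[_ *: _]/(_ * _) -[X in _ + X = _]/(_ * _) addrC; congr (_ + _); rewrite mulrC.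
Qed.
End MpolyDerivation.

(** * Jordan decomposition on the coordinate ring *)

Section GenEigenSums.
Variables (F : fieldType) (V : lmodType F) (f s : {linear V -> V}).

(** On these sums [s] is the semisimple part of [f]. The module may be infinite-dimensional, so this
    predicate takes the place of a characteristic polynomial. *)
Inductive geig_sum : V -> Prop :=
| GeigSum0 : geig_sum 0
| GeigSumD u v : geig_sum u -> geig_sum v -> geig_sum (u + v)
| GeigSumE l k u : papp f (('X - l%:P) ^+ k) u = 0 -> s u = l *: u -> geig_sum u.

Hypothesis fs : forall u, f (s u) = s (f u).
Let nil (u : V) := f u - s u.

Let nilD u v : nil (u + v) = nil u + nil v.
Proof. by rewrite /nil [f _]linearD [s _]linearD opprD addrACA. Qed.

Let iter_nil0 k : iter k nil 0 = 0.
Proof. by elim: k => //= k ->; rewrite /nil [f _]linear0 [s _]linear0 subr0. Qed.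

Let iter_nilD k u v : iter k nil (u + v) = iter k nil u + iter k nil v.
Proof. by elim: k => //= k ->; rewrite nilD. Qed.

Let iter_nilE l u j : s u = l *: u -> iter j nil u = papp f (('X - l%:P) ^+ j) u.
Proof.
move=> su; elim: j => [|j IH]; first by rewrite expr0 papp1.
rewrite iterS IH exprS pappM pappB pappX pappC /nil; congr (_ - _).
have -> : s (papp f (('X - l%:P) ^+ j) u) = papp f (('X - l%:P) ^+ j) (s u).
  by apply: papp_morph => w; rewrite fs.
by rewrite su linearZ.
Qed.

Lemma geig_sum_nilp u : geig_sum u -> exists k, iter k nil u = 0.
Proof.
elim=> [|{}u v _ [k Hk] _ [m Hm]|l k {}u Hu su]; first by exists 0%N.
  exists (k + m)%N; rewrite iter_nilD {1}addnC !iterD Hk Hm !iter_nil0 addr0 //.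
by exists k; rewrite (iter_nilE _ su).
Qed.

(** A polynomial congruent to (X - l)^j, to high enough order, at the eigenvalues occurring in [u]
    acts on [u] as (f - s)^j; it depends on [u]. *)
Lemma geig_sum_papp u j : geig_sum u -> exists Q, papp f Q u = iter j nil u.
Proof.
(* The induction carries the congruence conditions, because the polynomials found for two summands
   cannot be combined directly. *)
move=> Hu; suff [ls [K H]] : exists (ls : seq F) (K : nat), forall Q,
    (forall l, l \in ls -> ('X - l%:P) ^+ K %| Q - ('X - l%:P) ^+ j) ->
    papp f Q u = iter j nil u.
  have [Q HQ] := poly_crt K (fun l => ('X - l%:P) ^+ j) (undup_uniq ls).
  by exists Q; apply: H => l ll; apply: HQ; rewrite mem_undup.
elim: Hu => [|{}u v _ [ls [K H]] _ [ls' [K' H']]|l k {}u Hu su].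
- by exists [::], 0%N => Q _; rewrite linear0 iter_nil0.
- exists (ls ++ ls'), (maxn K K') => Q HQ; rewrite linearD iter_nilD /=; congr (_ + _).
    apply: H => l ll; apply: dvdp_trans (HQ l _); last by rewrite mem_cat ll.
    by rewrite dvdp_exp2l ?leq_maxl.
  apply: H' => l ll; apply: dvdp_trans (HQ l _); last by rewrite mem_cat ll orbT.
  by rewrite dvdp_exp2l ?leq_maxr.
- exists [:: l], k => Q /(_ l (mem_head _ _)) HQ; rewrite (iter_nilE _ su).
  apply/eqP; rewrite -subr_eq0 -pappB; apply/eqP; exact: papp_dvd HQ Hu.
Qed.

End GenEigenSums.

Section MpolyJordan.
Variables (R : realType) (n : nat) (A : 'M[R]_n) (q : {poly R}).
Local Notation C := R[i].
Local Notation toC := (map_poly (real_complex R)).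
Local Notation N := (n * n)%N.
Local Notation MP := (mpoly.mpoly N R).
Let chi := char_poly A.
Hypothesis qP : forall l, root (toC chi) l ->
  ('X - l%:P) ^+ size chi %| toC q - l%:P.
Let S := hmx A q.
Let fA : {linear MP -> MP} := mder A.
Let fS : {linear MP -> MP} := mder S.

Let AS : A *m S = S *m A.
Proof.
have pw i : A *m A ^+ i = A ^+ i *m A.
  elim: i => [|i IH]; first by rewrite expr0 mulmx1 mul1mx.
  by rewrite exprS -[A * _]/(A *m _) {1}IH mulmxA.
rewrite /S /hmx mulmx_sumr mulmx_suml; apply: eq_bigr => i _.
by rewrite -scalemxAr -scalemxAl pw.
Qed.

Let fAT : {linear 'M[R]_n -> 'M[R]_n} := mulmxr A^T.

Let papp_AT p c : papp fAT p c = c *m (hmx A p)^T.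
Proof.
rewrite /papp /hmx raddf_sum /= mulmx_sumr; apply: eq_bigr => i _.
rewrite linearZ /= -scalemxAr; congr (_ *: _).
elim: (nat_of_ord i) => [|j IH] /=; first by rewrite expr0 trmx1 mulmx1.
by rewrite IH exprS -[A * _]/(A *m _) trmx_mul mulmxA.
Qed.

Local Notation gsum := (geig_sum (clin fA) (clin fS)).

Let gsum_lin (w : cpx R 'M[R]_n) : gsum (clin (@mlin R n) w).
Proof.
have chi0 : toC chi != 0 by rewrite map_poly_eq0; apply/monic_neq0/char_poly_monic.
have Hw : papp (clin fAT) (toC chi) w = 0.
  rewrite [w]cpx_split linearD linearZ /= !papp_clin !papp_AT hmx_char_poly trmx0 !mulmx0.
  by rewrite [cinj 0](_ : _ = 0) // scaler0 addr0.
have mor p u : clin (@mlin R n) (papp (clin fAT) p u) = papp (clin fA) p (clin (@mlin R n) u).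
  by apply: papp_morph => x; congr (_, _); rewrite /= mder_lin.
move: w Hw; apply: (geig_ind chi0) => [|u v Hu Hv|l u rl Hu].
- by rewrite linear0; apply: GeigSum0.
- by rewrite linearD; apply: GeigSumD.
rewrite size_map_poly in Hu.
apply: (@GeigSumE _ _ _ _ l (size chi)).
  by rewrite -mor Hu linear0.
have E : clin fS (clin (@mlin R n) u) = clin (@mlin R n) (papp (clin fAT) (toC q) u).
  rewrite [u]cpx_split !linearD !linearZ /= !papp_clin !papp_AT !clin_inj /=.
  by rewrite !mder_lin.
by apply: etrans E _; rewrite (papp_eqC (qP rl) Hu) linearZ.
Qed.

Let mul_l (v : MP) : linear ( *%R^~ v). Proof. by move=> a x y; rewrite mulrDl scalerAl. Qed.
Let mul_r (u : MP) : linear ( *%R u). Proof. by move=> a x y; rewrite mulrDr scalerAr. Qed.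

Let gsum_mul u v : gsum u -> gsum v -> gsum (cbil (fun x y : MP => x * y) u v).
Proof.
pose br := cbil (fun x y : MP => x * y).
have brDl (a b c : cpx R MP) : br (a + b) c = br a c + br b c by exact: cbilDl mul_l _ _ _.
have brDr (a b c : cpx R MP) : br a (b + c) = br a b + br a c by exact: cbilDr mul_r _ _ _.
have brZl (a : C) (b c : cpx R MP) : br (a *: b) c = a *: br b c by exact: cbilZl mul_l _ _ _.
have brZr (a : C) (b c : cpx R MP) : br b (a *: c) = a *: br b c by exact: cbilZr mul_r _ _ _.
have brd B (a b : cpx R MP) : clin (mder B) (br a b) = br (clin (mder B) a) b + br a (clin (mder B) b).
  by congr (_, _); rewrite /= ?linearD ?linearN /= !mderM ?opprD addrACA.
have br0l b : br 0 b = 0 by have := brZl 0 0 b; rewrite !scale0r.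
have br0r b : br b 0 = 0 by have := brZr 0 b 0; rewrite !scale0r.
rewrite -/br => Hu Hv; elim: Hu => [|{}u u' _ Hu _ Hu'|l k {}u Hu su].
- by rewrite br0l; apply: GeigSum0.
- by rewrite brDl; apply: GeigSumD.
elim: Hv => [|{}v v' _ Hv _ Hv'|m j {}v Hv sv].
- by rewrite br0r; apply: GeigSum0.
- by rewrite brDr; apply: GeigSumD.
apply: (@GeigSumE _ _ _ _ (l + m) (k + j)).
  exact: (geig_bil brDl brDr brZl brZr (brd A) Hu Hv).
by apply: etrans (brd S u v) _; rewrite [clin _ u]su [clin _ v]sv brZl brZr -scalerDl.
Qed.

(** Eigenvalues add on products because [mder A] and [mder S] are derivations, so all polynomials
    are reached from constants and linear forms. *)
Lemma gsum_cinj p : gsum (cinj p).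
Proof.
elim/mpoly_alg_ind: p => [c|i j|p p' Hp Hp'|p p' Hp Hp'].
- apply: (@GeigSumE _ _ _ _ 0 1).
    by rewrite expr1 subr0 pappX; apply: etrans (clin_inj fA _) _; rewrite /= mderC.
  by apply: etrans (clin_inj fS _) _; rewrite /= mderC scale0r.
- by rewrite -mlin_delta -clin_inj; apply: gsum_lin.
- by rewrite cinjD; apply: GeigSumD.
- by have := gsum_mul Hp Hp'; rewrite cbil_inj; [|exact: mul_l|exact: mul_r].
Qed.

Let cfs (w : cpx R MP) : clin fA (clin fS w) = clin fS (clin fA w).
Proof. by congr (_, _); rewrite /= mder_comm // AS. Qed.

Let iter_nil j p : iter j (fun u => clin fA u - clin fS u) (cinj p) =
  cinj (iter j (mder (A - S)) p).
Proof.
elim: j => //= j ->; rewrite !clin_inj mderB /=.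
by congr (_, _); rewrite /= ?subr0.
Qed.

Lemma mder_nilp p : exists k, iter k (mder (A - S)) p = 0.
Proof.
have [k] := geig_sum_nilp cfs (gsum_cinj p); rewrite iter_nil => -[Hk].
by exists k.
Qed.

Lemma mder_papp p j : exists r : {poly R}, papp (mder A) r p = iter j (mder (A - S)) p.
Proof.
have [Q] := geig_sum_papp cfs j (gsum_cinj p); rewrite iter_nil => /(congr1 fst) /= <-.
(* [p] is real, so only the real parts of the coefficients contribute to the first component. *)
exists (\poly_(i < size Q) complex.Re Q`_i).
rewrite (papp_widen _ _ (size_poly _ _)).
have it i : iter i (clin fA) (cinj p) = cinj (iter i fA p).
  by elim: i => //= i ->; rewrite clin_inj.
rewrite /papp; elim/big_ind2: _ => [//|u v u' v' -> -> //|i _].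
by rewrite coef_poly ltn_ord it /= scaler0 subr0.
Qed.
End MpolyJordan.

(** * Exponentials of nilpotent derivations *)

Section NilpotentExponential.
Variables (R : realType).

Definition exppoly K : {poly R} := \poly_(i < K) (i`!%:R)^-1.

Lemma expmx_nilp n (A : 'M[R]_n) K : A ^+ K = 0 -> expmx A = hmx A (exppoly K).
Proof.
move=> AK; have A0 m : (K <= m)%N -> A ^+ m = 0.
  by move=> Km; rewrite -(subnK Km) exprD AK mulr0.
apply/matrixP => i j; rewrite mxE.
have -> : hmx A (exppoly K) i j = \sum_(0 <= m < K) (A ^+ m) i j / m`!%:R.
  rewrite /hmx summxE big_mkord (big_ord_widen _ (fun m => ((exppoly K)`_m *: A ^+ m) i j) (size_poly _ _)).
  rewrite big_mkcond; apply: eq_bigr => m _; rewrite mxE coef_poly ltn_ord mulrC.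
  case: ltnP => // le; have := nth_default 0 le; rewrite coef_poly ltn_ord => ->.
  by rewrite mulr0.
apply/cvg_lim => //; apply: cvg_near_cst; near=> m.
have Km : (K <= m)%N by near: m; exists K.
rewrite /series /= (big_cat_nat _ Km) //= [X in _ + X]big_nat_cond [X in _ + X]big1 ?addr0 // => l.
by case/andP=> /andP[/A0 -> _] _; rewrite mxE mul0r.
Unshelve. all: by end_near.
Qed.

Variable g : lieAlgType R.
Implicit Types (D : 'End(g)) (x y : g).

Lemma emx_exp D : emx (endo_exp D) = expmx (emx D).
Proof. exact: passmx.hommxK (vbasisP _) (vbasisP _) _. Qed.

Lemma endo_exp_nilp D K : epapp 'X^K D = 0 -> endo_exp D = epapp (exppoly K) D.
Proof.
move=> DK; apply: emx_inj; rewrite emx_exp emx_epapp; apply: expmx_nilp.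
have := congr1 (@emx _ _) DK; rewrite linear0 emx_epapp => <-.
rewrite /hmx size_polyXn big_ord_recr /= coefXn eqxx scale1r big1 ?add0r // => i _.
by rewrite coefXn (ltn_eqF (ltn_ord i)) scale0r.
Qed.

(** Divided powers: the exponential is their sum, and their Leibniz rule has no binomial
    coefficients. *)
Let dv D m x := (m`!%:R)^-1 *: iter m D x.

Let dvS D m x : D (dv D m x) = (m.+1)%:R *: dv D m.+1 x.
Proof.
by rewrite /dv linearZ /= scalerA factS natrM invfM mulrA mulfV ?mul1r // pnatr_eq0.
Qed.

Let dv_lie D m x y : deriv D ->
  dv D m (lie x y) = \sum_(i < m.+1) lie (dv D i x) (dv D (m - i) y).
Proof.
move=> dD; elim: m => [|m IH].
  by rewrite big_ord1 /dv fact0 /= invr1 !scale1r.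
have nz : (m.+1)%:R != 0 :> R by rewrite pnatr_eq0.
apply: (scalerI nz); rewrite -dvS IH linear_sum /=.
pose G i := lie (dv D i x) (dv D (m.+1 - i) y).
rewrite (eq_bigr (fun i : 'I_m.+1 => (i.+1)%:R *: G i.+1 + (m.+1 - i)%:R *: G i)); last first.
  move=> i _; rewrite dD !dvS lieZl [lie (dv D i x) (_ *: _)]lieZr /G subSS; congr (_ + _).
  by rewrite subSn // -ltnS.
rewrite big_split /=.
have -> : \sum_(i < m.+1) (i.+1)%:R *: G i.+1 = \sum_(i < m.+2) (i : nat)%:R *: G i.
  by rewrite [RHS]big_ord_recl scale0r add0r.
have -> : \sum_(i < m.+1) (m.+1 - i)%:R *: G i = \sum_(i < m.+2) (m.+1 - i)%:R *: G i.
  by rewrite [RHS]big_ord_recr /= subnn scale0r addr0.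
rewrite -big_split scaler_sumr; apply: eq_bigr => i _ /=.
by rewrite -scalerDl -natrD subnKC // -ltnS.
Qed.

Let iter0 D j : iter j D 0 = 0.
Proof. by elim: j => //= j ->; rewrite linear0. Qed.

Let papp_exp D L x : papp D (exppoly L) x = \sum_(i < L) dv D i x.
Proof.
rewrite (papp_widen _ _ (size_poly _ _)); apply: eq_bigr => i _.
by rewrite coef_poly ltn_ord.
Qed.

Let papp_exp_eq D K L x : (K <= L)%N -> (forall v, iter K D v = 0) ->
  papp D (exppoly K) x = papp D (exppoly L) x.
Proof.
move=> KL DK; rewrite !papp_exp (big_ord_widen _ (fun i => dv D i x) KL).
rewrite big_mkcond; apply: eq_bigr => i _; case: ltnP => // Ki.
by rewrite /dv -(subnK Ki) iterD DK iter0 scaler0.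
Qed.

Lemma exp_nilp_automorphism D : deriv D -> nilp D -> lie_automorphism (endo_exp D).
Proof.
(* The successor keeps the truncated exponential nonempty, so its constant coefficient is 1. *)
move=> dD [K0 HK0]; pose K := K0.+1.
have DK v : iter K D v = 0 by rewrite iterS HK0 linear0.
have E : endo_exp D = epapp (exppoly K) D.
  apply: endo_exp_nilp; apply/lfunP => v; rewrite epappE pappXn DK lfunE //.
have Dbig i v : (K <= i)%N -> dv D i v = 0.
  by move=> Ki; rewrite /dv -(subnK Ki) iterD DK iter0 scaler0.
rewrite E; split.
  apply/eqP; rewrite -subv0; apply/subvP => v; rewrite memv_ker epappE => /eqP Ev.
  rewrite memv0; apply/negPn/negP => v0.
  (* The last nonzero iterate of [v] lies in the kernel of [D], so the exponential fixes it; yet the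
     exponential kills [v] and commutes with [D]. *)
  have ex : exists m, iter m D v == 0 by exists K; rewrite DK.
  have := ex_minnP ex; case=> -[|m] Hm mn; first by rewrite /= (negPf v0) in Hm.
  have : iter m D v == 0.
    have e0 : D (iter m D v) = 0 *: iter m D v by rewrite scale0r; apply/eqP.
    have := papp_eigen (exppoly K) e0.
    rewrite horner_coef0 coef_poly /= fact0 invr1 scale1r => <-.
    by rewrite -pappXn papp_comm Ev linear0.
  by move=> /mn; rewrite ltnn.
(* With the bound doubled, a term with [i + j] at least [L] has [i] or [j] at least [K] and
   vanishes, so truncating by total degree loses nothing. *)
move=> x y; rewrite !epappE; pose L := (K + K)%N.
rewrite !(@papp_exp_eq D K L) ?leq_addr // !papp_exp.
pose F i j := lie (dv D i x) (dv D j y).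
transitivity (\sum_(i < L) \sum_(j < L) F i j); last first.
  by rewrite lie_suml; apply: eq_bigr => i _; rewrite lie_sumr.
transitivity (\sum_(m < L) \sum_(i < L) \sum_(j < L) (if (i + j == m)%N then F i j else 0)).
  apply: eq_bigr => m _; rewrite dv_lie // (big_ord_widen L (fun i => F i (m - i)%N)) //.
  rewrite big_mkcond; apply: eq_bigr => i _; rewrite ltnS.
  case: leqP => im; last first.
    rewrite big1 // => j _; case: eqP => // ijm; move: im.
    by rewrite -ijm ltnNge leq_addr.
  have ml : (m - i < L)%N by apply: leq_ltn_trans (leq_subr _ _) (ltn_ord m).
  rewrite (bigD1 (Ordinal ml)) //= subnKC // eqxx big1 ?addr0 // => j jm.
  case: eqP => // ijm; case/negP: jm; rewrite -val_eqE /= -ijm addKn //.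
rewrite exchange_big /=; apply: eq_bigr => i _; rewrite exchange_big /=; apply: eq_bigr => j _.
case: (ltnP (i + j) L) => ij.
  rewrite (bigD1 (Ordinal ij)) //= eqxx big1 ?addr0 // => m mij.
  by case: eqP => // e; case/negP: mij; rewrite -val_eqE /= e.
rewrite big1 => [|m _]; last first.
  by case: eqP => // e; have := ltn_ord m; rewrite -e ltnNge ij.
rewrite /F; case: (leqP K i) => Ki; first by rewrite Dbig // lie0l.
rewrite (Dbig j) ?lie0r // leqNgt; apply/negP => jK.
by move: ij; rewrite leqNgt /L -addSn leq_add // ltnW.
Qed.
End NilpotentExponential.

(** * Nil-invariance and nilpotent Jordan parts *)

Section NilInvariance.
Variables (R : realType) (g : lieAlgType R) (b : {symmetric g}).
Hypothesis nb : nil_invariant b.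
Local Notation C := R[i].
Local Notation toC := (map_poly (real_complex R)).

(* If [p] vanishes on the curve [exp (s ad x)], all its iterated derivatives
   along [ad x] vanish at 1; those along the nilpotent Jordan component are
   polynomials in the former. *)
Lemma nil_part_skew (x : g) (q : {poly R}) :
  (forall l, root (toC (char_poly (emx (ad x)))) l ->
     ('X - l%:P) ^+ size (char_poly (emx (ad x))) %| toC q - l%:P) ->
  deriv (ad x - epapp q (ad x)) -> nilp (ad x - epapp q (ad x)) ->
  forall u v, b ((ad x - epapp q (ad x)) u) v = - b u ((ad x - epapp q (ad x)) v).
Proof.
set D := ad x - _ => qP dD nD u v; apply: nb => //.
move=> t; split.
  apply: exp_nilp_automorphism.
    move=> y z; rewrite !scale_lfunE dD lieZl lieZr scalerDr //.
  case: nD => n Hn; exists n => w.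
  have -> : iter n (t *: D) w = t ^+ n *: iter n D w.
    elim: n {Hn} => [|n IH] /=; first by rewrite expr0 scale1r.
    by rewrite scale_lfunE IH linearZ /= scalerA exprS.
  by rewrite Hn scaler0.
move=> p Hp; pose A := emx (ad x); pose S := hmx A q.
have DE : emx D = A - S by rewrite /D linearB /= emx_epapp.
have p0 (s : R) j : mpoly.meval (mxvec (expmx (s *: A)) 0) (iter j (mder A) p) = 0.
  elim: j s => [|j IH] s.
    have /Hp : Inn (endo_exp (ad (s *: x))) by constructor.
    by rewrite /poly_eval -[endo_mx _]/(emx _) emx_exp adZ linearZ.
  have H := is_derive_meval A (iter j (mder A) p) s.
  rewrite iterS -(@derive_val _ _ _ _ _ _ _ H).
  under eq_fun do rewrite IH.
  exact: derive_cst.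
have q0 j : mpoly.meval (mxvec 1%:M 0) (iter j (mder (A - S)) p) = 0.
  have [r <-] := mder_papp qP p j; rewrite /papp raddf_sum big1 // => i _ /=.
  by rewrite mpoly.mevalZ -(expmx0 A) p0 mulr0.
have [K HK] := mder_nilp qP p.
(* Downward induction on the order of the iterate, starting from one that is 0: each function of [s]
   has derivative 0 and vanishes at [s = 0]. *)
suff H j : (j <= K)%N -> forall s : R,
    mpoly.meval (mxvec (expmx (s *: (A - S))) 0) (iter (K - j) (mder (A - S)) p) = 0.
  have := H K (leqnn _) t; rewrite subnn /=.
  by rewrite /poly_eval -[endo_mx _]/(emx _) emx_exp linearZ /= DE.
elim: j => [_ s|j IH jK s]; first by rewrite subn0 HK mpoly.meval0.
pose G (s : R) := mpoly.meval (mxvec (expmx (s *: (A - S))) 0) (iter (K - j.+1) (mder (A - S)) p).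
have dG (r : R) : is_derive r 1 G 0.
  have := is_derive_meval (A - S) (iter (K - j.+1) (mder (A - S)) p) r.
  by rewrite -iterS subnSK // IH // ltnW.
have := is_derive_0_is_cst 0 s dG; rewrite /G => <-.
by rewrite expmx0 q0.
Qed.

Lemma ad_nilp_skew (z : g) : nilp (ad z) -> forall u v, b (lie z u) v = - b u (lie z v).
Proof.
move=> nz u v.
(* All eigenvalues are 0, so [q = 0] gives the semisimple part. *)
have E : ad z - epapp 0 (ad z) = ad z.
  by apply/lfunP => w; rewrite add_lfunE opp_lfunE epappE papp0 subr0.
rewrite -!adE -E; apply: nil_part_skew; rewrite ?E //; last exact: deriv_ad.
move=> l; have [rs [_ Hr _ H]] := specP (ad z); rewrite H => lrs.
have /nilpP[n /Hr/(_ l lrs)] := nz.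
rewrite map_polyXn => /rootP; rewrite hornerXn => /eqP; rewrite expf_eq0 => /andP[_ /eqP ->].
by rewrite !rmorph0 subrr dvdp0.
Qed.
End NilInvariance.

(** [f] is invertible on its Fitting image, so the second component can be written with any power
    [M]; only [m] depends on [f]. *)
Lemma fitting_dec (R : rcfType) (V : vectType R) (f : 'End(V)) :
  exists m, forall M v, exists v0 w, v = v0 + iter M f w /\ iter m f v0 = 0.
Proof.
have [r [rX PP [m Hm]]] := fitting_proj f; set P := epapp r f in PP Hm.
have PPv v : P (P v) = P v by rewrite -comp_lfunE PP.
have fP v : P (f v) = f (P v) by rewrite /P !epappE -!(pappX f) papp_comm.
exists m => M v; exists (P v).
have e1 : (epapp (1 - r) f \o epapp (1 - r) f = epapp (1 - r) f)%VF.
  apply/lfunP => u; rewrite comp_lfunE.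
  have E w : epapp (1 - r) f w = w - P w by rewrite /P !epappE pappB papp1.
  by rewrite !E linearB /= PPv subrr subr0.
have eM : epapp ((1 - r) ^+ M.+1) f = epapp (1 - r) f.
  by elim: M => [|M IH]; rewrite ?expr1 // exprS epappM IH.
have [q Hq] := papp_dvdXn f (dvdp_exp2r M rX : 'X^M %| _).
exists (papp f q (epapp (1 - r) f v)); split.
  rewrite -(proj2 (Hq _)) -epappE -comp_lfunE -epappM mulrC -exprS eM.
  by rewrite epappE pappB papp1 /P epappE addrC subrK.
have <- : iter m (f \o P)%VF (P v) = iter m f (P v).
  elim: m {Hm} => //= k ->; rewrite comp_lfunE; congr (f _).
  by elim: k => [|k IH] /=; rewrite ?PPv // fP IH.
exact: Hm.
Qed.

(** * Elements acting by skew endomorphisms *)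

Section SkewElements.
Variables (R : realType) (g : lieAlgType R) (b : {symmetric g}).
Hypothesis nb : nil_invariant b.
Local Notation toC := (map_poly (real_complex R)).
Implicit Types (x y z u v w : g).

Lemma bformC u v : b u v = b v u.
Proof. by rewrite hermC expr0 mul1r. Qed.
Lemma bform_r u : scalar (b u). Proof. by move=> a v w; rewrite linearP. Qed.
Lemma bform_l v : scalar (b^~ v).
Proof. by move=> a u w /=; rewrite !(bformC _ v) bform_r. Qed.

Definition skew x := forall u v, b (lie x u) v = - b u (lie x v).

Lemma skewD x y : skew x -> skew y -> skew (x + y).
Proof.
move=> Hx Hy u v; rewrite !lieDl (formDl bform_l) (formDr bform_r) Hx Hy.
by rewrite opprD.
Qed.

Lemma skewZ a x : skew x -> skew (a *: x).
Proof.
by move=> Hx u v; rewrite !lieZl (formZl bform_l) (formZr bform_r) Hx mulrN.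
Qed.

Lemma skew_lie x y : skew x -> skew y -> skew (lie x y).
Proof.
move=> Hx Hy u v.
have E w : lie (lie x y) w = lie x (lie y w) - lie y (lie x w).
  by rewrite (jacobi x y w) addrK.
rewrite !E (formBl bform_l) (formDr bform_r) (formNr bform_r) !(Hx, Hy) !opprK.
by rewrite opprD opprK addrC.
Qed.

(** A subspace of maximal dimension inside [P]; this turns quantified linear conditions into
    subspaces. *)
Lemma vspace_of_pred (P : g -> Prop) : P 0 -> (forall x y, P x -> P y -> P (x + y)) ->
  (forall a x, P x -> P (a *: x)) -> exists U : {vspace g}, forall x, x \in U <-> P x.
Proof.
move=> P0 PD PZ.
pose Q k := `[< exists U : {vspace g}, (forall x, x \in U -> P x) /\ \dim U = k >].
have exQ : exists k, Q k.
  exists 0%N; apply/asboolP; exists 0%VS; split; last exact: dimv0.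
  by move=> x; rewrite memv0 => /eqP ->.
have ubQ k : Q k -> (k <= \dim {:g})%N.
  by move=> /asboolP[U [_ <-]]; apply/dimvS/subvf.
have [k /asboolP[U [UP dU]] maxk] := ex_maxnP exQ ubQ.
exists U => x; split=> [/UP //|Px]; apply/negPn/negP => xU.
have : Q (\dim (U + <[x]>)).
  apply/asboolP; exists (U + <[x]>)%VS; split=> // y /memv_addP[u uU [_ /vlineP[a ->] ->]].
  by apply: PD; [apply: UP|apply: PZ].
move=> /maxk; rewrite -dU => le; case/negP: xU.
have -> : U = (U + <[x]>)%VS by apply/eqP; rewrite eqEdim addvSl le.
by apply: (subvP (addvSr _ _)); rewrite memv_line.
Qed.

Lemma skew_semisimple s : lie_semisimple s -> no_compact_factor s ->
  forall x, x \in s -> skew x.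
Proof.
move=> ss nc; have [|||U HU] := @vspace_of_pred (fun x => x \in s /\ skew x).
- split; first exact: mem0v.
  by move=> u v; rewrite !lie0l (form0l bform_l) (form0r bform_r) oppr0.
- by move=> x y [xs Hx] [ys Hy]; split; [apply: memvD|apply: skewD].
- by move=> a x [xs Hx]; split; [apply: memvZ|apply: skewZ].
suff E : U = s by move=> x; rewrite -E => /HU[].
apply: nilp_generate => //.
- apply/lie_subalgP => x y /HU[xs Hx] /HU[ys Hy]; apply/HU; split; last exact: skew_lie.
  by apply: (lie_subalgP _ (proj1 ss)).
- by apply/subvP => x /HU[].
- by move=> x xs nx; apply/HU; split=> //; apply: ad_nilp_skew.
Qed.

Section Radical.
Variable x : g.
Hypothesis Hx : forall y, nilp (ad (lie x y)).
Let D := ad x.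
Let DE u : D u = lie x u. Proof. exact: adE. Qed.
Let skD u : skew (D u). Proof. by rewrite DE; apply/ad_nilp_skew/Hx. Qed.

(** Each derivative falling on [u] uses up one of the [a] powers that kill it, so [k] of the [a + k]
    derivatives can be pulled out of the bracket. *)
Let lie_iter a u k w : iter a D u = 0 -> exists z, lie u (iter (a + k) D w) = iter k D z.
Proof.
elim: a u k => [|a IH] u k.
  by move=> /= ->; exists 0; rewrite lie0l; elim: k => //= k <-; rewrite linear0.
move=> Hu; elim: k => [|k IHk]; first by eexists.
have [z Hz] := IHk.
have [z' Hz'] : exists z, lie (D u) (iter (a + k.+1) D w) = iter k.+1 D z.
  by apply: IH; rewrite -iterSr.
exists (z - z').
have -> : (a.+1 + k.+1 = (a.+1 + k).+1)%N by rewrite addnS.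
have E : lie u (D (iter (a.+1 + k) D w)) = D (lie u (iter (a.+1 + k) D w)) - lie (D u) (iter (a.+1 + k) D w).
  by rewrite !DE (jacobi x u) addrC addKr.
rewrite iterS E Hz addSnnS Hz'.
have -> : iter k.+1 D (z - z') = iter k.+1 D z - iter k.+1 D z'.
  by elim: (k.+1) => //= j ->; rewrite linearB.
by [].
Qed.

(** The defect of skewness of [D]. *)
Let sig u v := b (D u) v + b u (D v).

Let sig_skew u v : skew u -> skew v -> sig u v = 0.
Proof.
move=> Hu Hv; rewrite /sig !DE (lieC x u) (formNl bform_l) Hu opprK (lieC x v) (formNr bform_r).
by rewrite -Hv (lieC v u) (formNl bform_l) bformC subrr.
Qed.

(** Of the [m.+3] powers, [m] are absorbed by [u], two bring [lie u v] into the form [D (D z)], and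
    the last is the bracket with [x]. What remains is, up to sign, [b (D (D z)) x], which is 0
    because [D z] is skew. *)
Let perp01 m u w : iter m D u = 0 -> b u (iter m.+3 D w) = 0.
Proof.
move=> Hu; rewrite iterS; set v := iter m.+2 D w.
have Hv : skew v by rewrite /v iterS; apply: skD.
have [z Hz] := lie_iter 2 w Hu; rewrite addn2 -/v /= in Hz.
rewrite DE (lieC x v) (formNr bform_r) -Hv (lieC v u) (formNl bform_l) Hz.
rewrite DE (lieC x) (formNl bform_l) opprK.
have := skD z x x; rewrite [in RHS]bformC => /eqP.
by rewrite -addr_eq0 -mulr2n mulrn_eq0 /= => /eqP.
Qed.

(** [sig] vanishes on the Fitting image because values of [D] are skew, across the two parts by
    [perp01], and on the generalized kernel because [D] agrees there with its nilpotent part. *)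
Lemma skew_radical : skew x.
Proof.
move=> u v; apply/eqP; rewrite -addr_eq0 -!DE; apply/eqP; rewrite -/(sig u v).
have [m Hm] := fitting_dec D.
have [u0 [uw [-> Hu0]]] := Hm m.+3 u; have [v0 [vw [-> Hv0]]] := Hm m.+3 v.
have DD a c : D (a + c) = D a + D c := linearD D a c.
have sDl a c d : sig (a + c) d = sig a d + sig c d.
  by rewrite /sig DD !(formDl bform_l) addrACA.
have sDr a c d : sig a (c + d) = sig a c + sig a d.
  by rewrite /sig DD !(formDr bform_r) addrACA.
have sC a c : sig a c = sig c a by rewrite /sig addrC bformC [b (D a) c]bformC.
have cross a w : iter m D a = 0 -> sig a (iter m.+3 D w) = 0.
  move=> Ha; rewrite /sig perp01 -?iterSr ?iterS ?Ha ?linear0 // add0r.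
  by rewrite -iterS iterSr perp01.
rewrite sDl !sDr (cross u0) // [sig (iter _ _ _) v0]sC (cross v0) // addr0 add0r.
rewrite [sig (iter _ _ _) _]sig_skew ?addr0; try by rewrite iterS; apply: skD.
have [q [qX dN nN qP]] := deriv_nil m (deriv_ad x).
have := nil_part_skew nb qP dN nN u0 v0.
have E w : iter m D w = 0 -> (ad x - epapp q (ad x)) w = D w.
  move=> Hw; rewrite add_lfunE opp_lfunE epappE.
  by have [q' /(_ w)[-> _]] := papp_dvdXn (ad x) qX; rewrite Hw linear0 subr0.
by rewrite !E // => H; rewrite /sig H addNr.
Qed.
End Radical.
End SkewElements.

(** * The metric radical *)

Section CorollaryC.
Variables (R : realType) (g : lieAlgType R) (b : {symmetric g}) (k s r : {vspace g}).
Hypotheses (nb : nil_invariant b) (levi : levi_decomposition k s r)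
  (noideal : forall I : {vspace g},
     lie_ideal I fullv -> (I <= metric_radical b)%VS -> I = 0%VS).
Implicit Types (x y z u v w : g).

Let rad : solvable_radical r. Proof. by case: levi. Qed.
Let ck : compact_type k. Proof. by case: levi. Qed.
Let ss : lie_semisimple s. Proof. by case: levi => _ _ []. Qed.
Let nc : no_compact_factor s. Proof. by case: levi => _ _ []. Qed.
Let ks0 a c : a \in k -> c \in s -> lie a c = 0.
Proof.
case: levi => _ _ _ e _ ak cs; apply/eqP.
by rewrite -memv0 -e mem_lie_prod.
Qed.

Local Notation G := (s + r)%VS.
Local Notation Z := (lie_center G).
Local Notation P := (metric_radical b).

Let r_ideal x y : y \in r -> lie x y \in r.
Proof. by case: rad => /lie_idealP[_ H] _ _ yr; apply: H; rewrite ?memvf. Qed.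
Let r_ideal' x y : x \in r -> lie x y \in r.
Proof. by move=> xr; rewrite lieC memvN r_ideal. Qed.
Let rG y : y \in r -> y \in G. Proof. exact: subvP (addvSr _ _) y. Qed.
Let sG y : y \in s -> y \in G. Proof. exact: subvP (addvSl _ _) y. Qed.

Let gdec x : exists a c d, [/\ a \in k, c \in s, d \in r & x = a + c + d].
Proof.
have : x \in (k + s + r)%VS by case: levi => _ _ _ _ [e _]; rewrite e memvf.
by move=> /memv_addP[_ /memv_addP[a ak [c cs ->]] [d dr ->]]; exists a, c, d.
Qed.

Let sr0 x : x \in s -> x \in r -> x = 0.
Proof.
case: levi => _ _ _ _ [_]; rewrite directv_addE => /and3P[_ _ /eqP e] xs xr.
apply/eqP; rewrite -memv0 -e memv_cap xr andbT.
exact: subvP (addvSr _ _) x xs.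
Qed.

Let G_ideal x y : y \in G -> lie x y \in G.
Proof.
have [a [c [d [ak cs dr ->]]]] := gdec x; move=> /memv_addP[y1 y1s [y2 y2r ->]].
rewrite lieDr; apply: memvD; last exact/rG/r_ideal.
rewrite !lieDl ks0 // add0r; apply: memvD; last exact/rG/r_ideal'.
by apply: sG; apply: (lie_subalgP _ (proj1 ss)).
Qed.

Let skG y : y \in G -> skew b y.
Proof.
move=> /memv_addP[y1 y1s [y2 y2r ->]]; apply: skewD.
  exact: (skew_semisimple nb ss nc y1s).
apply: (skew_radical nb) => w; case: rad => ri rs _.
by apply: (ideal_nilp ri rs); rewrite lie_prodC mem_lie_prod ?memvf.
Qed.

(** [x] itself need not be skew: skewness of [y] and [z] moves it across, so [b] on [s + r] is
    invariant under all of [g]. *)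
Let bG x y z : y \in G -> z \in G -> b (lie x y) z = - b y (lie x z).
Proof.
move=> yG zG; rewrite (lieC x y) (formNl (bform_l b)) (skG yG) opprK.
rewrite (lieC x z) (formNr (bform_r b)) opprK -[RHS]opprK -(skG zG) (lieC z y).
by rewrite (formNl (bform_l b)) opprK bformC.
Qed.

Let PP x : reflect (forall v, b x v = 0) (x \in P).
Proof. by apply: (iffP mem_orthovP) => H v; move=> *; apply: H; rewrite ?memvf. Qed.

Let ZP z : reflect (z \in G /\ forall y, y \in G -> lie y z = 0) (z \in Z).
Proof. exact: lie_centerP. Qed.

(* The radical of the form restricted to [s + r] is central: its bracket with
   [s + r] is an ideal contained in the metric radical. *)
Let radG_center q : q \in G -> (forall y, y \in G -> b q y = 0) -> q \in Z.
Proof.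
pose Q := perp b G G.
have QP v : reflect (v \in G /\ forall u, u \in G -> b v u = 0) (v \in Q).
  by apply: perpP; [apply: bform_l|apply: bform_r].
have Qi x v : v \in Q -> lie x v \in Q.
  move=> /QP[vG Hv]; apply/QP; split=> [|u uG]; first exact: G_ideal.
  by rewrite bG // Hv ?oppr0 // G_ideal.
have GQ0 : lie_prod G Q = 0%VS.
  apply: noideal.
    apply/lie_idealP; split=> [|x y _]; first exact: subvf.
    move: y; apply: lie_prod_ind => [|u v Hu Hv|c u Hu|u v uG vQ].
    - by rewrite lie0r mem0v.
    - by rewrite lieDr memvD.
    - by rewrite lieZr memvZ.
    - by rewrite jacobi memvD // mem_lie_prod ?G_ideal ?Qi.
  apply/lie_prodP => u v uG /QP[vG Hv]; apply/PP => x.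
  by rewrite (skG uG) Hv ?oppr0 // lieC memvN G_ideal.
move=> qG Hq; apply/ZP; split=> // y yG; apply/eqP.
by rewrite -memv0 -GQ0 mem_lie_prod //; apply/QP.
Qed.

Let PG x y : x \in P -> y \in G -> lie x y \in (Z :&: P)%VS.
Proof.
move=> /PP Hx yG; have xyP v : b (lie x y) v = 0.
  by rewrite lieC (formNl (bform_l b)) (skG yG) Hx !oppr0.
by rewrite memv_cap radG_center ?G_ideal //; apply/PP.
Qed.

Let Zi x z : z \in Z -> lie x z \in Z.
Proof.
move=> /ZP[zG Hz]; apply/ZP; split=> [|y yG]; first exact: G_ideal.
by rewrite jacobi (Hz y) // lie0r addr0 Hz // lieC memvN G_ideal.
Qed.

Let Zr z : z \in Z -> z \in r.
Proof.
case: rad => _ _ H; apply: subvP z; apply: H.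
  by apply/lie_idealP; split=> [|x z _]; [apply: subvf|apply: Zi].
exists 1%N; apply/eqP; rewrite -subv0; apply/lie_prodP => a c /ZP[aG _].
by move=> /ZP[_ Hc]; rewrite Hc // mem0v.
Qed.

Let centralizes x := forall y, y \in G -> lie x y \in Z.

Let cM_lie x m : centralizes m -> centralizes (lie x m).
Proof.
move=> Hm y yG; have -> : lie (lie x m) y = lie x (lie m y) - lie m (lie x y).
  by rewrite (jacobi x m y) addrK.
by apply: memvB; [exact/Zi/Hm|exact/Hm/G_ideal].
Qed.

Let cMD x y : centralizes x -> centralizes y -> centralizes (x + y).
Proof. by move=> Hx Hy u uG; rewrite lieDl memvD ?Hx ?Hy. Qed.

Let cMZ a x : centralizes x -> centralizes (a *: x).
Proof. by move=> Hx u uG; rewrite lieZl memvZ ?Hx. Qed.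

Let cMN x : centralizes x -> centralizes (- x).
Proof. by move=> Hx u uG; rewrite lieNl memvN Hx. Qed.

Let cM0 : centralizes 0.
Proof. by move=> u _; rewrite lie0l mem0v. Qed.

Let k1_ex : exists k1 : {vspace g}, forall a, a \in k1 <->
  a \in k /\ exists2 d, d \in r & centralizes (a + d).
Proof.
apply: vspace_of_pred.
- by split; [exact: mem0v|exists 0; rewrite ?mem0v ?addr0].
- move=> x y [xk [d dr Hd]] [yk [e er He]]; split; first exact: memvD.
  by exists (d + e); rewrite ?memvD // addrACA; apply: cMD.
- move=> c x [xk [d dr Hd]]; split; first exact: memvZ.
  by exists (c *: d); rewrite ?memvZ // -scalerDr; apply: cMZ.
Qed.

Section K1.
Variable k1 : {vspace g}.
Hypothesis k1P : forall a, a \in k1 <-> a \in k /\ exists2 d, d \in r & centralizes (a + d).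

Let k1i : lie_ideal k1 k.
Proof.
apply/lie_idealP; split=> [|x y xk /k1P[yk [d dr Hd]]]; first by apply/subvP => x /k1P[].
apply/k1P; split; first exact: (lie_subalgP _ (proj1 (proj1 ck))).
by exists (lie x d); rewrite ?r_ideal // -lieDr; apply: cM_lie.
Qed.

(* [k1] acts on [(s + r) / Z] through the solvable radical, hence trivially,
   because it is perfect. *)
Let k1_centralizes a : a \in k1 -> centralizes a.
Proof.
case: rad => _ [m rm] _.
(* The correction [d] is pushed down the derived series of [r] until it is 0. *)
suff H i c : c \in k1 -> exists2 d, d \in lie_derived i r & centralizes (c + d).
  by move=> /(H m)[d]; rewrite rm memv0 => /eqP ->; rewrite addr0.
elim: i c => [|i IH] c; first by move=> /k1P[].
rewrite -{1}(compact_ideal_perfect ck k1i); move: c.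
apply: lie_prod_ind => [|x y [d dr Hd] [e er He]|t x [d dr Hd]|x y x1 y1].
- by exists 0; rewrite ?mem0v ?addr0.
- by exists (d + e); rewrite ?memvD // addrACA; apply: cMD.
- by exists (t *: d); rewrite ?memvZ // -scalerDr; apply: cMZ.
have [d dr Hd] := IH x x1; have [e er He] := IH y y1.
exists (- lie d e); first by rewrite memvN mem_lie_prod.
(* Both summands on the right are brackets with elements already known to centralize. *)
have -> : lie x y - lie d e = lie (- y) (x + d) + lie (- d) (y + e).
  rewrite !lieNl !lieDr (lieC y x) (lieC y d) !opprD !opprK.
  by rewrite addrA -[_ + lie d y - lie d y]addrA subrr addr0.
by apply: cMD; apply: cM_lie.
Qed.

Let G_split v : v \in G -> exists v0, [/\ v0 \in G, v - v0 \in Z &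
  forall a, a \in k1 -> lie a v0 = 0].
Proof.
move=> vG; have [|v0 [v0G dv Hv]] := compact_split ck k1i (V := G) _ vG.
  by move=> x w _; apply: G_ideal.
exists v0; split=> //; apply: subvP dv; apply/lie_prodP => x w x1 wG.
exact: k1_centralizes.
Qed.

Let W w := w \in G /\ forall a, a \in k1 -> lie a w = 0.

Let W_k c w : c \in k -> W w -> W (lie c w).
Proof.
move=> ck' [wG Hw]; split=> [|a a1]; first exact: G_ideal.
rewrite jacobi (Hw a) // lie0r addr0; apply: Hw.
by rewrite lieC memvN; have [_ H] := lie_idealP _ _ k1i; apply: H.
Qed.

(** The properties of the [r]-component of an element of the metric radical that survive bracketing
    with [k]. *)
Let R1 d := [/\ d \in r, centralizes d & forall y w, W w -> b d (lie y w) = 0].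

Let R1_center d : R1 d -> d \in Z.
Proof.
have [|||R1V R1P] := @vspace_of_pred R g R1.
- by split; [exact: mem0v|exact: cM0|move=> y w _; rewrite (form0l (bform_l b))].
- move=> x y [xr cx bx] [yr cy by_]; split; [exact: memvD|exact: cMD|].
  by move=> u w Ww; rewrite (formDl (bform_l b)) bx // by_ // addr0.
- move=> a x [xr cx bx]; split; [exact: memvZ|exact: cMZ|].
  by move=> u w Ww; rewrite (formZl (bform_l b)) bx // mulr0.
have R1k c x : c \in k -> R1 x -> R1 (lie c x).
  move=> ck' [xr cx bx]; split; [exact: r_ideal|exact: cM_lie|].
  move=> y w Ww; have [wG _] := Ww; rewrite bG; [|exact: rG|exact: G_ideal].
  rewrite jacobi (formDr (bform_r b)) (bx _ w Ww) (bx _ _ (W_k ck' Ww)).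
  by rewrite addr0 oppr0.
(* Modulo [Z], which commutes with [x] in [r], any [v] is [k1]-invariant. *)
have E x v : R1 x -> v \in G -> exists2 w, W w & lie x v = lie x w.
  move=> [xr _ _] vG; have [v0 [v0G dv Hv]] := G_split vG.
  exists v0; first by [].
  apply/eqP; rewrite -subr_eq0 -lieBr; have [_ ->] := ZP _ dv; rewrite ?rG //.
have I0 : lie_prod R1V G = 0%VS.
  apply: noideal; last first.
    apply/lie_prodP => x v /R1P x1 vG; have [w Ww ->] := E x v x1 vG.
    have [wG _] := Ww; have [_ _ bx] := x1; apply/PP => u.
    by rewrite lieC (formNl (bform_l b)) (skG wG) opprK lieC (formNr (bform_r b)) bx ?oppr0.
  apply/lie_idealP; split=> [|x y _]; first exact: subvf.
  move: y; apply: lie_prod_ind => [|u v Hu Hv|t u Hu|u v uR vG].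
  - by rewrite lie0r mem0v.
  - by rewrite lieDr memvD.
  - by rewrite lieZr memvZ.
  (* Only the [k]-component contributes, since [lie u v] is central in [s + r]. *)
  have [a [c [e [ak cs er ->]]]] := gdec x; have /R1P uR1 := uR.
  have [ur cu _] := uR1; have [_ Hz] := ZP _ (cu v vG).
  rewrite !lieDl (Hz c) ?sG // (Hz e) ?rG // !addr0 jacobi.
  apply: memvD; apply: mem_lie_prod => //; last exact: G_ideal.
  by apply/R1P/R1k.
move=> dR; have [dr _ _] := dR; apply/ZP; split; first exact: rG.
move=> y yG; rewrite lieC; apply/eqP; rewrite oppr_eq0 -memv0 -I0.
by apply: mem_lie_prod => //; apply/R1P.
Qed.

Let P_sub x : x \in P -> x \in (k + Z)%VS.
Proof.
move=> xP; have cx : centralizes x by move=> y yG; have := PG xP yG; rewrite memv_cap => /andP[].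
have [a [c [d [ak cs dr xE]]]] := gdec x.
(* For [u] in [s], [lie x u] and [lie d u] lie in [r] and [lie a u] is 0; so [lie c u] lies in both
   [s] and [r], and [c] is central in [s]. *)
have c0 : c = 0.
  apply: (semisimple_center ss cs) => u us; apply: sr0.
    exact: (lie_subalgP _ (proj1 ss)).
  have := Zr (cx u (sG us)); rewrite xE !lieDl ks0 // add0r => cur.
  rewrite lieC memvN -[lie c u](addrK (lie d u)); apply: memvB => //; exact: r_ideal'.
move: xE; rewrite c0 addr0 => xE.
have a1 : a \in k1 by apply/k1P; split=> //; exists d; rewrite -?xE.
rewrite xE; apply: memv_add => //; apply: R1_center; split=> //.
  have -> : d = x - a by rewrite xE addrC addKr.
  by apply: cMD => //; apply: cMN; apply: k1_centralizes.
(* [x] pairs to 0 with everything, and skewness of [w] moves the bracket onto [a], which commutes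
   with [w]. *)
move=> y w [wG Hw]; have -> : d = x - a by rewrite xE addrC addKr.
have /PP Hx := xP; rewrite (formBl (bform_l b)) Hx sub0r lieC (formNr (bform_r b)) opprK.
by rewrite -[LHS]opprK -(skG wG) lieC Hw // oppr0 (form0l (bform_l b)) oppr0.
Qed.

Lemma metric_radical_sub_k1 : (P <= k + Z)%VS.
Proof. exact/subvP/P_sub. Qed.
End K1.

Lemma metric_radical_sub : (P <= k + Z)%VS /\ (lie_prod P G <= Z :&: P)%VS.
Proof.
split; first by have [k1 H] := k1_ex; apply: metric_radical_sub_k1 H.
by apply/lie_prodP => x y xP yG; apply: PG.
Qed.
End CorollaryC.

Theorem corollaryC (R : realType) (g : lieAlgType R) (b : {symmetric g})
    (k s r : {vspace g}) :
  nil_invariant b ->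
  levi_decomposition k s r ->
  (forall I : {vspace g},
     lie_ideal I fullv -> (I <= metric_radical b)%VS -> I = 0%VS) ->
  (metric_radical b <= k + lie_center (s + r))%VS /\
  (lie_prod (metric_radical b) (s + r)
     <= lie_center (s + r) :&: metric_radical b)%VS.
Proof. exact: metric_radical_sub. Qed.
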